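(* The problem of deciding whether an instance of gGASP with $|A^*|=p$ whose underlying social network $(N,L)$ is acyclic has an individually stable feasible assignment is in FPT with respect to $p$.
   Context: An instance of the group activity selection problem with graph structure (gGASP) consists of: a finite set of players $N=\{1,\dots,n\}$; a finite set of activities $A=A^*\cup\{a_\emptyset\}$, where $A^*=\{a_1,\dots,a_p\}$ is the set of $p$ non-void activities and $a_\emptyset\notin A^*$ is the void activity; for each player $i$ a complete and transitive preference relation $\succeq_i$ on the set of alternatives $(A^*\times\{1,\dots,n\})\cup\{(a_\emptyset,1)\}$, with strict part $\succ_i$; and a set $L$ of edges making $(N,L)$ an undirected graph (the social network). Two alternatives can be compared under $\succeq_i$ in unit time. A graph is acyclic if it is a forest. An assignment is a map $\pi:N\to A$. For $a\in A^*$ let $\pi^a=\{i\in N:\pi(i)=a\}$; let $\pi_i=\{j\in N:\pi(j)=\pi(i)\}$ if $\pi(i)\ne a_\emptyset$, and $\pi_i=\{i\}$ if $\pi(i)=a_\emptyset$. A coalition $S\subseteq N$ is feasible if it is connected in $(N,L)$; $\pi$ is feasible if $\pi_i$ is feasible for every $i\in N$. $\pi$ is individually rational if $(\pi(i),|\pi_i|)\succeq_i(a_\emptyset,1)$ for every $i\in N$. Given a feasible assignment $\pi$, player $i$ has a feasible IS-deviation to $a\in A^*$ with $a\neq\pi(i)$ if $\pi^a\cup\{i\}$ is connected in $(N,L)$, $(a,|\pi^a|+1)\succ_i(\pi(i),|\pi_i|)$, and $(a,|\pi^a|+1)\succeq_j(a,|\pi^a|)$ for all $j\in\pi^a$. A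 feasible assignment is individually stable if it is individually rational and no player has a feasible IS-deviation. A problem is in FPT with respect to a parameter $k$ if each instance $I$ can be solved in time $f(k)\cdot\mathrm{poly}(|I|)$ for some computable function $f$. *)

(* Defs.v *)
From HB Require Import structures.
From mathcomp Require Import all_boot all_order all_algebra.
Set Implicit Arguments.
Unset Strict Implicit.
Unset Printing Implicit Defensive.

(** * Random access machines *)

(* A unit-cost RAM over nat with addition, truncated subtraction and halving
   (no multiplication), presented as a structured while language.  The memory
   consists of infinitely many arrays of registers; array names are static, so
   a program touches finitely many of them.  [Ask] is the unit-time query to
   the oracle that comes with the input. *)

Definition memory := nat -> nat -> nat.

Definition oracle := nat -> nat -> nat -> nat -> nat -> bool.

Inductive expr :=
| Const of nat
| Read of nat & expr
| Add of expr & expr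
| Sub of expr & expr
| Half of expr
| Ask of expr & expr & expr & expr & expr.

Inductive prog :=
| Skip
| Write of nat & expr & expr
| Seq of prog & prog
| If of expr & prog & prog
| While of expr & prog.

Fixpoint eval (O : oracle) (m : memory) (e : expr) : nat :=
  match e with
  | Const c => c
  | Read x e1 => m x (eval O m e1)
  | Add e1 e2 => eval O m e1 + eval O m e2
  | Sub e1 e2 => eval O m e1 - eval O m e2
  | Half e1 => (eval O m e1)./2
  | Ask e1 e2 e3 e4 e5 =>
      O (eval O m e1) (eval O m e2) (eval O m e3) (eval O m e4) (eval O m e5)
  end.

Fixpoint ecost (e : expr) : nat :=
  match e with
  | Const _ => 1
  | Read _ e1 | Half e1 => (ecost e1).+1
  | Add e1 e2 | Sub e1 e2 => (ecost e1 + ecost e2).+1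
  | Ask e1 e2 e3 e4 e5 =>
      (ecost e1 + ecost e2 + ecost e3 + ecost e4 + ecost e5).+1
  end.

Definition write (m : memory) (x i v : nat) : memory :=
  fun y j => if (y == x) && (j == i) then v else m y j.

(* [exec O c m t m']: started in memory [m], the program [c] halts after
   exactly [t] steps in memory [m'].  A test succeeds when it is nonzero. *)
Inductive exec (O : oracle) : prog -> memory -> nat -> memory -> Prop :=
| ExecSkip m :
    exec O Skip m 1 m
| ExecWrite x e1 e2 m :
    exec O (Write x e1 e2) m (ecost e1 + ecost e2).+1
      (write m x (eval O m e1) (eval O m e2))
| ExecSeq c1 c2 m t1 m1 t2 m2 :
    exec O c1 m t1 m1 -> exec O c2 m1 t2 m2 ->
    exec O (Seq c1 c2) m (t1 + t2) m2
| ExecIfTrue e c1 c2 m t m' :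
    eval O m e != 0 -> exec O c1 m t m' ->
    exec O (If e c1 c2) m (ecost e + t).+1 m'
| ExecIfFalse e c1 c2 m t m' :
    eval O m e = 0 -> exec O c2 m t m' ->
    exec O (If e c1 c2) m (ecost e + t).+1 m'
| ExecWhileTrue e c m t1 m1 t2 m2 :
    eval O m e != 0 -> exec O c m t1 m1 -> exec O (While e c) m1 t2 m2 ->
    exec O (While e c) m (ecost e + t1 + t2).+1 m2
| ExecWhileFalse e c m :
    eval O m e = 0 -> exec O (While e c) m (ecost e).+1 m.

Lemma exec_det O c m t m1 t' m2 :
  exec O c m t m1 -> exec O c m t' m2 -> t = t' /\ m1 = m2.
Proof.
move=> H; elim: H t' m2 => {c m t m1}; do ?[by move=> *; match goal with
    | [ H : exec _ _ _ _ _ |- _ ] => inversion H end].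
- move=> c1 c2 m t1 m1 t2 m2 _ IH1 _ IH2 t' m' H; inversion H; subst.
  by do 2![match goal with
    | [ IH : forall t m, exec O ?c ?k t m -> _, E : exec O ?c ?k _ _ |- _ ] =>
      have [? ?] := IH _ _ E; clear IH; subst end].
- move=> e c1 c2 m t m' nz _ IH t' m2 H; inversion H; subst; last first.
    by move: nz; match goal with [ E : eval _ _ _ = 0 |- _ ] => rewrite E end.
  by match goal with [ E : exec O c1 _ _ _ |- _ ] => have [-> ->] := IH _ _ E end.
- move=> e c1 c2 m t m' z _ IH t' m2 H; inversion H; subst.
    by match goal with [ E : is_true (eval _ _ _ != 0) |- _ ] => rewrite z in E end.
  by match goal with [ E : exec O c2 _ _ _ |- _ ] => have [-> ->] := IH _ _ E end.
- move=> e c m t1 m1 t2 m2 nz _ IH1 _ IH2 t' m' H; inversion H; subst; last first.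
    by move: nz; match goal with [ E : eval _ _ _ = 0 |- _ ] => rewrite E end.
  by do 2![match goal with
    | [ IH : forall t m, exec O ?c ?k t m -> _, E : exec O ?c ?k _ _ |- _ ] =>
      have [? ?] := IH _ _ E; clear IH; subst end].
- move=> e c m z t' m' H; inversion H; subst; last by [].
  by match goal with [ E : is_true (eval _ _ _ != 0) |- _ ] => rewrite z in E end.
Qed.

(* The [x]-th input sequence is stored at the start of the [x]-th array; all
   other registers contain 0. *)
Definition load (s : seq (seq nat)) : memory :=
  fun x i => nth 0 (nth [::] s x) i.

Definition output (m : memory) : nat := m 0 0.

Definition no_oracle : oracle := fun _ _ _ _ _ => false.

Definition computable (f : nat -> nat) : Prop :=
  exists c : prog, forall k : nat, exists (t : nat) (m : memory),
    exec no_oracle c (load [:: [:: k]]) t m /\ output m = f k.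

(** * Fixed-parameter tractability *)

(* [instance] singles out the objects of type [T] that are instances of the
   problem: nothing is required of the algorithm on the others. *)
Record param_problem := ParamProblem {
  carrier : Type;
  instance : carrier -> Prop;
  yes_instance : carrier -> Prop;
  encoding : carrier -> seq (seq nat);
  queries : carrier -> oracle;
  isize : carrier -> nat;
  parameter : carrier -> nat
}.

Definition FPT (P : param_problem) : Prop :=
  exists (c : prog) (f : nat -> nat) (q : {poly nat}),
    computable f /\
    forall x : carrier P, instance x ->
      exists (t : nat) (m : memory),
        [/\ exec (queries x) c (load (encoding x)) t m,
            t <= f (parameter x) * q.[isize x]%R
          & output m != 0 <-> yes_instance x].

(** * Graphs *)

Section Graphs.

Variables (V : finType) (e : rel V).

Definition induced (S : {set V}) : rel V :=
  [rel u v | [&& u \in S, v \in S & e u v]].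

Definition connected_in (S : {set V}) : Prop :=
  {in S &, forall u v, connect (induced S) u v}.

(* [c] lists the vertices of a cycle; lists of size 2 come from the two
   orientations of a single edge. *)
Definition acyclic : Prop := forall c : seq V, ucycle e c -> size c < 3.

End Graphs.

(** * Group activity selection *)

(* Players are 0, ..., n-1; [Some a] is a non-void activity and [None] is the
   void one. *)
Definition activity (p : nat) := option 'I_p.

Definition alternative (n p : nat) : pred (activity p * nat) :=
  fun x => if x.1 is Some _ then 0 < x.2 <= n else x.2 == 1.

Arguments alternative : clear implicits.

(* The values of [pref i] outside [alternative] are irrelevant. *)
Record gGASP := GGASP {
  nplayers : nat;
  nacts : nat;
  pref : 'I_nplayers -> rel (activity nacts * nat);
  pref_total : forall i, {in alternative nplayers nacts &, total (pref i)};
  pref_trans : forall i, {in alternative nplayers nacts & &, transitive (pref i)};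
  adj : rel 'I_nplayers;
  adj_sym : symmetric adj;
  adj_irr : irreflexive adj
}.

Section Stability.

Variable I : gGASP.

Notation player := 'I_(nplayers I).

Definition assignment := {ffun player -> activity (nacts I)}.

Definition spref (i : player) (x y : activity (nacts I) * nat) : bool :=
  pref i x y && ~~ pref i y x.

Variable pi : assignment.

Definition players_at (a : 'I_(nacts I)) : {set player} :=
  [set j | pi j == Some a].

Definition coalition (i : player) : {set player} :=
  if pi i is Some a then players_at a else [set i].

Definition feasible : Prop := forall i, connected_in (@adj I) (coalition i).

Definition individually_rational : Prop :=
  forall i, pref i (pi i, #|coalition i|) (None, 1).

Definition feasible_IS_deviation (i : player) (a : 'I_(nacts I)) : Prop :=
  [/\ pi i != Some a,
      connected_in (@adj I) (players_at a :|: [set i]),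
      spref i (Some a, #|players_at a| + 1) (pi i, #|coalition i|)
    & forall j, j \in players_at a ->
        pref j (Some a, #|players_at a| + 1) (Some a, #|players_at a|)].

Definition individually_stable : Prop :=
  [/\ feasible, individually_rational
    & forall i a, ~ feasible_IS_deviation i a].

End Stability.

(** * The decision problem *)

Definition edges (I : gGASP) : seq ('I_(nplayers I) * 'I_(nplayers I)) :=
  [seq e : 'I_(nplayers I) * 'I_(nplayers I) <- enum {: 'I_(nplayers I) * 'I_(nplayers I)}
     | (e.1 < e.2) && @adj I e.1 e.2].

Definition gGASP_encoding (I : gGASP) : seq (seq nat) :=
  [:: [:: nplayers I; nacts I; size (edges I)];
      [seq val e.1 | e <- edges I];
      [seq val e.2 | e <- edges I]].

Definition activity_code (p : nat) (a : activity p) : nat :=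
  if a is Some j then (val j).+1 else 0.

(* Query [(i, ca, k, cb, l)]: does player [i] weakly prefer [(a, k)] to
   [(b, l)], where [ca] and [cb] are the codes of [a] and [b]?  Malformed
   queries are answered negatively. *)
Definition gGASP_queries (I : gGASP) : oracle := fun i ca k cb l =>
  [exists j : 'I_(nplayers I), exists a : activity (nacts I),
    exists b : activity (nacts I),
    [&& val j == i, activity_code a == ca, activity_code b == cb,
        (a, k) \in alternative (nplayers I) (nacts I),
        (b, l) \in alternative (nplayers I) (nacts I)
      & pref j (a, k) (b, l)]].

(* Preferences are available through queries and do not contribute to the
   size; listing them would change the size only polynomially. *)
Definition gGASP_size (I : gGASP) : nat :=
  nplayers I + nacts I + size (edges I).

Definition acyclic_gGASP_IS : param_problem := {|
  carrier := gGASP;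
  instance := fun I => acyclic (@adj I);
  yes_instance := fun I => exists pi : assignment I, individually_stable pi;
  encoding := gGASP_encoding;
  queries := gGASP_queries;
  isize := gGASP_size;
  parameter := nacts
|}.

(* Main.v *)
Require Import Defs.
From mathcomp Require Import all_boot all_order all_algebra.
From mathcomp Require Import zify.
Set Implicit Arguments.
Unset Strict Implicit.
Unset Printing Implicit Defensive.

(* Fix, for every activity, whether it is used and, if so, whether some
   participant vetoes one more member; this guess G is a number below
   4^(p + 1).  Given G, stability is a conjunction of conditions on single
   vertices and on single edges, as a deviation to a used activity a is only
   possible for a neighbour of a member.  The forest is eliminated leaf by leaf,
   and eliminated subtrees are merged into their remaining neighbour.  For each
   subtree the table records the activity a and intended coalition size k of its
   root, the number t of members of that coalition inside the subtree, and two
   numbers s and q accounting for events: each completed coalition of activity b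
   adds 2^(2 b), and each designated vetoer of b adds 2^(2 b + 1) to s, and both
   add 1 to q.  Because the binary expansion is the only way to write G as a sum
   of popcount(G) powers of two, the final condition s = G, q = popcount(G) says
   that every used activity has exactly one coalition, which is therefore
   connected, and exactly one designated vetoer if it is guessed to have one.
   Merging is plain addition and no set operations are needed. *)

(** * Loop programs *)

(** For vetoes only the positive guess is certified: if [G] denies a veto for [b], the edge
    conditions forbid every wish to enter [b], which is safe whether or not vetoers exist. Sizes are
    intended before they are counted, because preferences refer to the final size while the
    coalition is still being assembled. The forest becomes one tree through a virtual void vertex
    [n], to which a vertex without remaining neighbours is attached. The sum [s] stays below
    [3 * 4 ^ p * (n + 1)], so all eight table indices fit below one bound [M], the product of
    [4 ^ (p + 1)] and a linear function of the input size. The program is a fixed nest of loops with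
    bounds at most [M], so its time is polynomial in [M], and a power of [4 ^ (p + 1)] splits off as
    the factor depending on the parameter. *)

(* [CFor x b i c] runs [c] with the counter [x.[0]] ranging over the numbers
   below the content of register [b.[i]]. *)
Inductive cmd :=
| CWrite of nat & expr & expr
| CSeq of cmd & cmd
| CIf of expr & cmd
| CFor of nat & nat & nat & cmd.

Fixpoint run (O : oracle) (c : cmd) (m : memory) : memory :=
  match c with
  | CWrite x e1 e2 => write m x (eval O m e1) (eval O m e2)
  | CSeq c1 c2 => run O c2 (run O c1 m)
  | CIf e c => if eval O m e != 0 then run O c m else m
  | CFor x b i c =>
      iter (m b i) (fun m1 => let m2 := run O c m1 in write m2 x 0 (m2 x 0).+1)
        (write m x 0 0)
  end.

(** The while loop rereads its bound before every round, whereas [run] reads it once; the two agree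
    for programs that satisfy [bounded_by]. *)
Fixpoint compile (c : cmd) : prog :=
  match c with
  | CWrite x e1 e2 => Write x e1 e2
  | CSeq c1 c2 => Seq (compile c1) (compile c2)
  | CIf e c => If e (compile c) Skip
  | CFor x b i c =>
      Seq (Write x (Const 0) (Const 0))
        (While (Defs.Sub (Read b (Const i)) (Read x (Const 0)))
           (Seq (compile c)
              (Write x (Const 0) (Add (Read x (Const 0)) (Const 1)))))
  end.

Fixpoint writes (c : cmd) : seq nat :=
  match c with
  | CWrite x _ _ => [:: x]
  | CSeq c1 c2 => writes c1 ++ writes c2
  | CIf _ c => writes c
  | CFor x _ _ c => x :: writes c
  end.

(* The loop bounds lie in the arrays [bs], which are never written. *)
Fixpoint bounded_by (bs : seq nat) (c : cmd) : bool :=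
  match c with
  | CWrite x _ _ => x \notin bs
  | CSeq c1 c2 => bounded_by bs c1 && bounded_by bs c2
  | CIf _ c => bounded_by bs c
  | CFor x b _ c =>
      [&& b \in bs, x \notin bs, x \notin writes c & bounded_by bs c]
  end.

(** [N] stands for a common bound on all loop bounds. For a loop, 9 is 3 for the initial write plus
    6 for the failing test, and 12 is 6 for a successful test plus 6 for the increment. *)
Fixpoint cost (c : cmd) (N : nat) : nat :=
  match c with
  | CWrite _ e1 e2 => (ecost e1 + ecost e2).+1
  | CSeq c1 c2 => cost c1 N + cost c2 N
  | CIf e c => (ecost e + cost c N).+2
  | CFor _ _ _ c => 9 + N * (cost c N + 12)
  end.

Lemma write_other m x i v y j : y != x -> write m x i v y j = m y j.
Proof. by rewrite /write => /negbTE ->. Qed.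

Lemma write_same m x i v : write m x i v x i = v.
Proof. by rewrite /write !eqxx. Qed.

Lemma run_frame O c m y j : y \notin writes c -> run O c m y j = m y j.
Proof.
elim: c m => [x e1 e2|c1 IH1 c2 IH2|e c IH|x b i c IH] m /=.
- by rewrite inE => /write_other ->.
- by rewrite mem_cat negb_or => /andP[h1 h2]; rewrite IH2 ?IH1.
- by case: ifP => // _; apply: IH.
- rewrite inE negb_or => /andP[hx hc].
  by elim: (m b i) => [|k IHk] /=; rewrite write_other ?IH.
Qed.

Lemma bounded_by_writes bs c b :
  bounded_by bs c -> b \in bs -> b \notin writes c.
Proof.
move=> + hb; elim: c => [x e1 e2|c1 IH1 c2 IH2|e c IH|x b' i c IH] //=.
- by rewrite inE => hx; apply: contra hx => /eqP <-.
- by case/andP=> /IH1 h1 /IH2 h2; rewrite mem_cat negb_or h1 h2.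
- case/and4P=> _ hx _ /IH h; rewrite inE negb_or h andbT.
  by apply: contra hx => /eqP <-.
Qed.

Lemma run_for O x b i c m (P : nat -> memory -> Prop) :
  x \notin writes c ->
  P 0 (write m x 0 0) ->
  (forall j m1, j < m b i -> m1 x 0 = j -> P j m1 ->
     P j.+1 (write (run O c m1) x 0 j.+1)) ->
  P (m b i) (run O (CFor x b i c) m).
Proof.
move=> hx h0 hS /=; set F := (X in iter _ X _).
suff h k : k <= m b i ->
    P k (iter k F (write m x 0 0)) /\ iter k F (write m x 0 0) x 0 = k.
  by case: (h _ (leqnn _)).
elim: k => [|k IH] hk /=; first by rewrite write_same.
have [hP e] := IH (ltnW hk).
rewrite {1 3}/F /= run_frame // e write_same; split=> //.
exact: hS.
Qed.

(** The arrays in [bs] are never written, so every loop bound met during the run still has its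
    initial value, at most [N]; this yields termination and the time bound together. *)
Lemma run_exec O bs c m N :
  bounded_by bs c -> (forall b i, b \in bs -> m b i <= N) ->
  exists2 t, exec O (compile c) m t (run O c m) & t <= cost c N.
Proof.
elim: c m => [x e1 e2|c1 IH1 c2 IH2|e c IH|x b i c IH] m /=.
- by move=> _ _; eexists; first exact: ExecWrite.
- case/andP=> w1 w2 hN.
  have [t1 E1 l1] := IH1 _ w1 hN.
  have [|t2 E2 l2] := IH2 (run O c1 m) w2.
    by move=> b i hb; rewrite run_frame ?hN // (bounded_by_writes w1).
  by exists (t1 + t2); [apply: ExecSeq E1 E2 | rewrite leq_add].
- move=> w hN; case: ifP => [nz|/eqP z].
    have [t E l] := IH _ w hN.
    by exists (ecost e + t).+1; [exact: ExecIfTrue | lia].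
  by exists (ecost e + 1).+1; [apply: ExecIfFalse => //; exact: ExecSkip | lia].
- case/and4P=> hb hx hxc w hN.
  have hbc := bounded_by_writes w hb.
  have nbx : b != x by apply: contra hx => /eqP <-.
  set F := (X in iter _ X _).
  set W := While _ _.
  (* A loop in progress: [j] rounds are done and [k] remain. *)
  suff h k j m1 : j + k = m b i -> m1 x 0 = j ->
      (forall b' i', b' \in bs -> m1 b' i' = m b' i') ->
      exists2 t, exec O W m1 t (iter k F m1) & t <= 6 + k * (cost c N + 12).
    have [||b' i' hb'|t E l] := h (m b i) 0 (write m x 0 0) => //.
    - by rewrite write_same.
    - by rewrite write_other //; apply: contra hx => /eqP <-.
    exists (3 + t).
      by apply: ExecSeq E; apply: (ExecWrite _ _ (Const 0) (Const 0)).
    have := hN b i hb; nia.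
  elim: k j m1 => [|k IHk] j m1 ejk mx mb.
    exists 6; last by lia.
    by apply: ExecWhileFalse => /=; rewrite mb // mx -ejk; lia.
  have [|t1 E1 l1] := IH m1 w; first by move=> b' i' hb'; rewrite mb ?hN.
  have [||b' i' hb'|t2 E2 l2] := IHk j.+1 (F m1).
  - by lia.
  - by rewrite /F /= write_same run_frame // mx.
  - rewrite /F /= write_other ?run_frame ?mb //.
      exact: (bounded_by_writes w).
    by apply: contra hx => /eqP <-.
  exists (5 + (t1 + 6) + t2).+1; last by nia.
  rewrite iterSr; apply: ExecWhileTrue E2; last first.
    apply: ExecSeq E1 _; rewrite /F -[X in write _ _ _ X]addn1.
    exact: (ExecWrite _ _ (Const 0) (Add (Read x (Const 0)) (Const 1))).
  by rewrite /= mb // mx -ejk; lia.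
Qed.

(** The exponent depends on the program text only. Adding the exponents of a sequence is wasteful,
    but gives one power that dominates both parts. *)
Lemma cost_poly c : exists C d, forall N, cost c N <= C * N.+1 ^ d.
Proof.
elim: c => [x e1 e2|c1 [C1 [d1 h1]] c2 [C2 [d2 h2]]|e c [C [d h]]|x b i c [C [d h]]].
- by exists (ecost e1 + ecost e2).+1, 0 => N; rewrite expn0 muln1.
- exists (C1 + C2), (d1 + d2) => N /=; rewrite mulnDl leq_add //.
    by apply: leq_trans (h1 N) _; rewrite leq_mul // leq_pexp2l ?leq_addr.
  by apply: leq_trans (h2 N) _; rewrite leq_mul // leq_pexp2l ?leq_addl.
- exists (ecost e + 2 + C), d => N /=; rewrite mulnDl.
  have := h N; have : 0 < N.+1 ^ d by rewrite expn_gt0.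
  nia.
- exists (9 + (C + 12)), d.+1 => N /=; rewrite mulnDl leq_add //.
    by rewrite leq_pmulr // expn_gt0.
  rewrite expnS mulnCA leq_mul //.
  have := h N; have : 0 < N.+1 ^ d by rewrite expn_gt0.
  nia.
Qed.

(** * Exhaustive search *)

(* A variable [(x, b, i)] of a search is stored in [x.[0]] and ranges over the
   numbers below the content of [b.[i]]. *)
Definition variables := seq (nat * nat * nat).

Definition search (xs : variables) (cond : expr) (X : nat) (idx val : expr) :=
  foldr (fun x c => CFor x.1.1 x.1.2 x.2 c) (CIf cond (CWrite X idx val)) xs.

Definition registers (xs : variables) := [seq x.1.1 | x <- xs].

Definition in_range (m : memory) (xs : variables) (vs : seq nat) :=
  all2 (fun v x => v < m x.1.2 x.2) vs xs.

Definition search_ok (xs : variables) (X : nat) :=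
  uniq (X :: registers xs) && all (fun x => x.1.2 \notin X :: registers xs) xs.

Lemma writes_search xs cond X idx val y :
  y \notin X :: registers xs -> y \notin writes (search xs cond X idx val).
Proof.
elim: xs => [|x xs IH] //=; rewrite !inE !negb_or => /and3P[h1 h2 h3].
by rewrite h2 IH // inE negb_or h1.
Qed.

Lemma in_range_eq m1 m2 xs us :
  (forall x, x \in xs -> m1 x.1.2 x.2 = m2 x.1.2 x.2) ->
  in_range m1 xs us = in_range m2 xs us.
Proof.
elim: us xs => [|u us IH] [|x xs] //= h.
rewrite /in_range /= h ?inE ?eqxx //; congr (_ && _).
by apply: IH => y hy; apply: h; rewrite inE hy orbT.
Qed.

(* The hypothesis says that the value of the three expressions does not depend
   on the entries of [X] written by the search. *)
Lemma run_search O xs cond X idx val m (C : seq nat -> bool)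
    (I V : seq nat -> nat) :
  search_ok xs X ->
  (forall m' vs, in_range m xs vs -> [seq m' c 0 | c <- registers xs] = vs ->
     (forall y j, y \notin X :: registers xs -> m' y j = m y j) ->
     (forall j, (forall us, in_range m xs us -> C us -> I us <> j) ->
        m' X j = m X j) ->
     (eval O m' cond != 0) = C vs /\
     (C vs -> eval O m' idx = I vs /\ eval O m' val = V vs)) ->
  forall j, let m1 := run O (search xs cond X idx val) m in
    (exists us, [/\ in_range m xs us, C us, I us = j & m1 X j = V us]) \/
    ((forall us, in_range m xs us -> C us -> I us <> j) /\ m1 X j = m X j).
Proof.
case/andP=> + /allP; elim: xs m C I V => [|[[c b] i] xs IH] m C I V.
  move=> _ _ H j /=.
  have [||||-> h] := H m [::] => //.
  case: ifP => hC; last first.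
    by right; split=> // -[|//] _; rewrite hC.
  case: (h hC) => -> ->; rewrite /write eqxx /=.
  case: eqP => [->|ne]; first by left; exists [::]; split.
  by right; split=> // -[|//] _ _; apply: nesym.
set cs := registers _ => /= /andP[hX /andP[hc ucs]] hb H j.
set body := search xs cond X idx val.
have cX : c != X by apply: contra hX => /eqP <-; rewrite inE eqxx.
have bc : b \notin X :: c :: registers xs by apply: (hb (c, b, i)); rewrite inE eqxx.
have cbody : c \notin writes body.
  by apply: writes_search; rewrite inE negb_or cX.
(* [box k] is the part of the search space visited after [k] rounds of the outermost loop, and [P k]
   is the conclusion restricted to it. *)
pose box k us := in_range m ((c, b, i) :: xs) us && (head 0 us < k).
pose P k m1 := (forall y j, y \notin X :: c :: registers xs -> m1 y j = m y j) /\
  forall j, (exists us, [/\ box k us, C us, I us = j & m1 X j = V us]) \/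
    ((forall us, box k us -> C us -> I us <> j) /\ m1 X j = m X j).
suff [_ /(_ j) [[us [/andP[h _] h1 h2 h3]]|[h1 h2]]] :
    P (m b i) (run O (CFor c b i body) m).
- by left; exists us.
- right; split=> // us hus; apply: h1; rewrite /box hus /=.
  by case: us hus => [//|u us] /= /andP[].
apply: run_for => //.
  split=> [y j'|j'].
    by rewrite !inE !negb_or => /and3P[_ h _]; rewrite write_other.
  right; rewrite write_other 1?eq_sym //; split=> // us.
  by rewrite /box ltn0 andbF.
move=> k m1 hk m1c [fr sp]; split=> [y j' hy|].
  rewrite write_other; last by move: hy; rewrite !inE !negb_or => /and3P[].
  rewrite run_frame ?fr //; apply: writes_search.
  by move: hy; rewrite !inE !negb_or => /and3P[h1 _ h2]; rewrite h1.
have rng us : in_range m1 xs us = in_range m xs us.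
  apply: in_range_eq => x hx; rewrite fr //.
  by apply: hb; rewrite inE hx orbT.
have kb us : in_range m xs us -> in_range m ((c, b, i) :: xs) (k :: us).
  by rewrite /in_range /= hk.
move=> j'; rewrite write_other 1?eq_sym //.
have [|||[us [h1 h2 h3 h4]]|[h1 h2]] :=
    IH m1 (fun us => C (k :: us)) (fun us => I (k :: us))
      (fun us => V (k :: us)) _ _ _ j'.
- by move: hX; rewrite inE negb_or => /andP[_ h]; rewrite /= h.
- move=> x hx; have := hb x; rewrite inE hx orbT => /(_ isT).
  by rewrite !inE !negb_or => /and3P[-> _ ->].
- move=> m' us; rewrite rng => hus e fr' nh.
  apply: (H m' (k :: us) (kb _ hus)) => /=.
  + by rewrite e fr' ?m1c // inE negb_or cX.
  + move=> y j1; rewrite !inE !negb_or => /and3P[h1 h2 h3].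
    by rewrite fr' ?fr ?inE ?negb_or ?h1 ?h2.
  (* A cell that no tuple ever hits has not been hit in the earlier rounds either. *)
  + move=> j1 hj1; rewrite nh; last first.
      by move=> us' /=; rewrite rng => /kb /hj1.
    case: (sp j1) => [[us' [/andP[h1 _] h2 h3]]|[]//].
    by case: (hj1 _ h1 h2 h3).
- left; exists (k :: us); split=> //.
  by rewrite /box kb -?rng //= ltnSn.
- case: (sp j') => [[us [/andP[h3 h4] h5 h6 h7]]|[h3 h4]].
    left; exists us; split; rewrite ?h2 //.
    by rewrite /box h3 (leq_trans h4).
  right; rewrite h2 h4; split=> // -[|v us] //.
  rewrite /box /= ltnS [v <= k]leq_eqVlt => /andP[h5 /orP[/eqP e|h6]].
    by rewrite e; apply: h1; rewrite rng; move: h5 => /andP[].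
  by apply: h3; apply/andP; split.
Qed.

(** With the constant value 1 it does not matter which of several tuples aiming at the same cell
    writes last. *)
Lemma run_search_flag O xs cond X idx m (C : seq nat -> bool)
    (I : seq nat -> nat) :
  search_ok xs X ->
  (forall m' vs, in_range m xs vs -> [seq m' c 0 | c <- registers xs] = vs ->
     (forall y j, y \notin X :: registers xs -> m' y j = m y j) ->
     (forall j, (forall us, in_range m xs us -> C us -> I us <> j) ->
        m' X j = m X j) ->
     (eval O m' cond != 0) = C vs /\ (C vs -> eval O m' idx = I vs)) ->
  forall j, run O (search xs cond X idx (Const 1)) m X j != 0 <->
    (m X j != 0 \/ exists us, [/\ in_range m xs us, C us & I us = j]).
Proof.
move=> ok H j.
have [||] := @run_search O xs cond X idx (Const 1) m C I (fun=> 1) ok _ j.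
- move=> m' vs h1 h2 h3 h4.
  by have [-> h] := H m' vs h1 h2 h3 h4; split=> // /h ->.
- by move=> [us [h1 h2 h3 ->]]; split=> // _; right; exists us.
- move=> [h1 ->]; split=> [->|[//|[us [h2 h3 h4]]]]; first by left.
  by case: (h1 us).
Qed.

(** * Expressions *)

(** Zero is false and every other number is true: truncated subtraction from 1 is negation, and
    addition is disjunction. *)
Definition eNot e := Defs.Sub (Const 1) e.
Definition eAnd e1 e2 := eNot (Add (eNot e1) (eNot e2)).
Definition eEq e1 e2 := eNot (Add (Defs.Sub e1 e2) (Defs.Sub e2 e1)).
Definition eOdd e := Defs.Sub e (Add (Half e) (Half e)).
Definition eQuad e := Add (Add e e) (Add e e).
Definition eVar x := Read x (Const 0).

Section Expressions.

Variables (O : oracle) (m : memory).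

Lemma eval_not e : (eval O m (eNot e) != 0) = ~~ (eval O m e != 0).
Proof. by rewrite /eNot /=; lia. Qed.

Lemma eval_not_value e : eval O m (eNot e) = (eval O m e == 0).
Proof. by rewrite /eNot /=; case: (eval O m e). Qed.

Lemma eval_and e1 e2 :
  (eval O m (eAnd e1 e2) != 0) = (eval O m e1 != 0) && (eval O m e2 != 0).
Proof. by rewrite /eAnd /eNot /=; lia. Qed.

Lemma eval_eq e1 e2 : (eval O m (eEq e1 e2) != 0) = (eval O m e1 == eval O m e2).
Proof. by rewrite /eEq /eNot /=; lia. Qed.

Lemma eval_odd e : eval O m (eOdd e) = odd (eval O m e).
Proof. by rewrite /eOdd /=; lia. Qed.

Lemma eval_quad e : eval O m (eQuad e) = 4 * eval O m e.
Proof. by rewrite /eQuad /=; lia. Qed.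

Lemma eval_var x : eval O m (eVar x) = m x 0.
Proof. by []. Qed.

Lemma eval_ask e1 e2 e3 e4 e5 :
  (eval O m (Ask e1 e2 e3 e4 e5) != 0) =
  O (eval O m e1) (eval O m e2) (eval O m e3) (eval O m e4) (eval O m e5).
Proof. by move=> /=; case: (O _ _ _ _ _). Qed.

End Expressions.

(** * Multidimensional arrays *)

(** The numeral in base [M] with digits [xs], most significant digit first; it is the address of a
    cell of a multidimensional array. *)
Definition encode (M : nat) (xs : seq nat) := foldl (fun a x => a * M + x) 0 xs.


Lemma encode_rcons M xs x : encode M (rcons xs x) = encode M xs * M + x.
Proof. by rewrite /encode foldl_rcons. Qed.

Lemma encode_lt M xs : all (fun x => x < M) xs -> encode M xs < M ^ size xs.
Proof.
elim/last_ind: xs => [//|xs x IH].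
rewrite all_rcons encode_rcons size_rcons expnS => /andP[hx /IH h].
by nia.
Qed.

Lemma encode_inj M xs ys : size xs = size ys ->
  all (fun x => x < M) xs -> all (fun x => x < M) ys ->
  encode M xs = encode M ys -> xs = ys.
Proof.
elim/last_ind: xs ys => [|xs x IH] ys; first by case: ys.
case/lastP: ys => [|ys y]; first by rewrite size_rcons.
rewrite !size_rcons !all_rcons !encode_rcons => -[e] /andP[hx hxs] /andP[hy hys] h.
have M0 : 0 < M by lia.
have := congr1 (divn^~ M) h; rewrite !divnMDl // !divn_small // !addn0.
move=> h1; rewrite (IH ys) //; congr rcons.
by move: h; rewrite h1 => /addnI.
Qed.

(* Array 4 is filled with the multiples of [M], which makes up for the lack of
   a multiplication. *)
Definition eIdx (es : seq expr) :=
  foldl (fun a e => Add (Read 4 a) e) (Const 0) es.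


(** An address has at most eight digits, so a multiplication by [M] is only applied to prefixes of
    at most seven digits, and the table of multiples up to [M ^ 7] suffices. *)
Lemma eval_idx O m M es :
  0 < M -> (forall i, i <= M ^ 7 -> m 4 i = i * M) ->
  all (fun e => eval O m e < M) es -> size es <= 8 ->
  eval O m (eIdx es) = encode M [seq eval O m e | e <- es].
Proof.
move=> M0 h; elim/last_ind: es => [//|es e IH].
rewrite all_rcons size_rcons ltnS map_rcons encode_rcons => /andP[_ he] hs.
rewrite /eIdx foldl_rcons /= IH ?(leqW hs) // h //.
apply/ltnW; apply: leq_trans (encode_lt _) _.
  by rewrite all_map.
by rewrite leq_pexp2l ?size_map.
Qed.

Opaque eNot eAnd eEq eOdd eQuad eVar eIdx.

(** * Elimination orders of forests *)

(** Otherwise every vertex of [W] has two distinct neighbours in [W], and a simple path in [W] can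
    be prolonged at its head forever, since running into itself would close a cycle; this
    contradicts finiteness. *)
Lemma acyclic_leaf (V : finType) (e : rel V) (W : {set V}) :
  symmetric e -> irreflexive e -> acyclic e -> W != set0 ->
  exists2 v, v \in W & {in W &, forall x y, e v x -> e v y -> x = y}.
Proof.
move=> sym irr acy /set0Pn[v0 v0W].
case: (boolP [exists v in W, [forall x in W, forall y in W,
    e v x ==> e v y ==> (x == y)]]) => [/exists_inP[v vW h]|no].
  exists v => // x y xW yW vx vy.
  by move/forall_inP/(_ x xW)/forall_inP/(_ y yW): h; rewrite vx vy => /eqP.
exfalso.
have next v u : v \in W -> exists x, [/\ x \in W, e v x & x != u].
  move=> vW; move/exists_inPn/(_ v vW): no.
  case/forall_inPn=> x xW /forall_inPn[y yW].
  rewrite !negb_imply => /and3P[vx vy xy].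
  case: (eqVneq x u) => [xu|]; last by exists x.
  by exists y; split=> //; rewrite -xu eq_sym.
have grow k : exists v s,
    [/\ size s = k, path e v s, uniq (v :: s) & all (mem W) (v :: s)].
  elim: k => [|k [v [s [<- pth un al]]]].
    by exists v0, [::]; split; rewrite //= v0W.
  have vW : v \in W by case/andP: al.
  (* [x] differs from the second vertex of the path, so a cycle closed by [x] would have at least
     three vertices. For empty [s] the default [v] does no harm. *)
  have [x [xW vx xu]] := next v (head v s) vW.
  case: (boolP (x \in v :: s)) => [|xs]; last first.
    by exists x, (v :: s); split; rewrite //= 1?sym ?vx // ?xs // xW.
  rewrite inE; case: eqP => [xv|_ /= xs]; first by rewrite xv irr in vx.
  exfalso; case/splitPr: xs un pth xu {al} => s1 s2 un pth xu.
  have cyc : ucycle e (v :: rcons s1 x).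
    rewrite /ucycle /= rcons_path last_rcons sym vx andbT.
    move: pth un; rewrite -cat_rcons cat_path => /andP[-> _] /=.
    by rewrite mem_cat negb_or cat_uniq => /andP[/andP[-> _] /and3P[-> _ _]].
  have := acy _ cyc; rewrite /= size_rcons.
  by case: s1 xu {un pth cyc} => //=; rewrite eqxx.
have [v [s [hs _ un _]]] := grow #|V|.
by have := uniq_leq_size un (fun x _ => mem_enum V x); rewrite -cardE /= hs ltnn.
Qed.

(* [ov r] is a vertex with at most one neighbour among the vertices which are
   not eliminated before step [r], and [ou r] is that neighbour; the virtual
   vertex [n] stands for a missing one. *)
Definition elimination_step (n : nat) (adj : rel nat) (ov ou : nat -> nat) r :=
  [/\ ov r < n, forall r', r' < r -> ov r' <> ov r,
      ou r = n \/ [/\ ou r < n, adj (ov r) (ou r) &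
                      forall r', r' <= r -> ov r' <> ou r]
    & forall x, x < n -> (forall r', r' <= r -> ov r' <> x) ->
        adj (ov r) x -> x = ou r].

Definition elimination_order n adj ov ou :=
  forall r, r < n -> elimination_step n adj ov ou r.

(** * Binary digits *)

Definition bit (i N : nat) := odd (iter i half N).

Definition bitcount (K N : nat) := \sum_(i < K) bit i N.

Lemma bitS i N : bit i.+1 N = bit i N./2.
Proof. by rewrite /bit iterSr. Qed.

Lemma sum_recl K (x : nat -> nat) :
  \sum_(i < K.+1) x i = x 0 + \sum_(i < K) x i.+1.
Proof. exact: big_ord_recl. Qed.

Lemma sum_pow2_recl K (x : nat -> nat) :
  \sum_(i < K.+1) x i * 2 ^ i = x 0 + 2 * \sum_(i < K) x i.+1 * 2 ^ i.
Proof.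
rewrite (sum_recl _ (fun i => x i * 2 ^ i)) muln1 big_distrr /=; congr (_ + _).
by apply: eq_bigr => i _; rewrite expnS mulnCA.
Qed.

Lemma bitcount_recl K N : bitcount K.+1 N = odd N + bitcount K N./2.
Proof.
rewrite /bitcount (sum_recl _ (fun i => nat_of_bool (bit i N))).
by congr (_ + _); apply: eq_bigr => i _; rewrite bitS.
Qed.

(** A sum of powers of two has at most as many binary ones as it has terms. The summand [y], counted
    as [y] units, is the carry that the induction passes on to the next digit. *)
Lemma bitcount_le K (x : nat -> nat) y :
  bitcount K (\sum_(i < K) x i * 2 ^ i + y) <= \sum_(i < K) x i + y.
Proof.
elim: K x y => [|K IH] x y; first by rewrite /bitcount big_ord0.
rewrite bitcount_recl sum_pow2_recl sum_recl.
have := IH (fun i => x i.+1) (x 0 + y)./2; set S := \sum_(i < K) _ * _.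
set T := \sum_(i < K) _.
have -> : (x 0 + 2 * S + y)./2 = S + (x 0 + y)./2 by lia.
by set B := bitcount _ _; lia.
Qed.

(* Among the ways of writing [N] as a sum of powers of two, the binary
   expansion is the only one with the least number of terms. *)
Lemma binary_expansion_unique K N (x : nat -> nat) :
  \sum_(i < K) x i * 2 ^ i = N -> \sum_(i < K) x i = bitcount K N ->
  forall i, i < K -> x i = bit i N.
Proof.
elim: K N x => [//|K IH] N x.
rewrite bitcount_recl sum_pow2_recl sum_recl.
have := @bitcount_le K (fun i => x i.+1) (x 0)./2.
have := IH N./2 (fun i => x i.+1).
set S := \sum_(i < K) _ * _; set T := \sum_(i < K) _ => IH' le1 eN eC.
have e1 : N./2 = S + (x 0)./2 by lia.
(* A carry of [c] into the next digit replaces [2 * c] terms by [c], so with a minimal number of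
   terms there is no carry. *)
have x0 : (x 0)./2 = 0 by rewrite e1 in eC; lia.
case=> [|i] hi; first by rewrite /bit /=; lia.
by rewrite bitS IH'; lia.
Qed.

Lemma bit_sum K (x : nat -> bool) i :
  i < K -> bit i (\sum_(j < K) x j * 2 ^ j) = x i.
Proof.
elim: K x i => [//|K IH] x i.
rewrite (sum_pow2_recl _ (fun i => nat_of_bool (x i))).
set S := \sum_(j < K) _.
case: i => [_|i hi]; first by rewrite /bit /=; lia.
rewrite bitS -[RHS](IH (fun i => x i.+1)) //; congr bit.
by rewrite -/S; case: (x 0); lia.
Qed.

Lemma sum_pow2_lt K (x : nat -> bool) : \sum_(j < K) x j * 2 ^ j < 2 ^ K.
Proof.
elim: K => [|K IH]; first by rewrite big_ord0.
rewrite big_ord_recr expnS mul2n -addnn /=.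
by case: (x K); rewrite ?mul1n ?mul0n ?addn0 ?ltn_add2r // ltn_addl.
Qed.

Lemma sum_bits K N : N < 2 ^ K -> \sum_(i < K) bit i N * 2 ^ i = N.
Proof.
elim: K N => [|K IH] N; first by rewrite big_ord0; case: N.
rewrite (sum_pow2_recl _ (fun i => nat_of_bool (bit i N))) expnS => hN.
under eq_bigr => i _ do rewrite bitS.
by rewrite IH /bit /=; lia.
Qed.

(** * Dynamic programming over an elimination order *)

(* The activity code, the intended coalition size, and whether the vertex is
   the distinguished opponent to an enlargement of its coalition. *)
Definition label : Type := nat * nat * bool.

Definition act (l : label) := l.1.1.
Definition csize (l : label) := l.1.2.
Definition witness (l : label) := l.2.

Definition void_label : label := (0, 1, false).

Section Preferences.

Variable O : oracle.

Definition strictly i a k b l := O i a k b l && ~~ O i b l a k.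

(** In a coalition of all [n] players the query about size [n + 1] is malformed, and its members
    count as vetoers; this is harmless, since no player is left outside. *)
Definition vetoes i a k := (a != 0) && ~~ O i a k.+1 a k.

(* The guess [G] has bit [2 b] set if the activity of code [b] is used, and bit
   [2 b + 1] set if moreover some participant refuses a newcomer. *)
Definition wants_unused p G i a k :=
  has (fun c => ~~ bit c.+1.*2 G && strictly i c.+1 1 a k) (iota 0 p).

Definition admissible p G i a k := O i a k 0 1 && ~~ wants_unused p G i a k.

Definition wants_to_join G i a k b l :=
  [&& b != 0, ~~ bit b.*2.+1 G & strictly i b l.+1 a k].

End Preferences.

Definition top_weight a := if a == 0 then 0 else 2 ^ a.*2.

Definition joined (l1 l2 : label) := (act l1 == act l2) && (act l2 != 0).

Section Table.

Variables (O : oracle) (n p G : nat) (ov ou : nat -> nat).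

Definition compatible r (lam : nat -> label) (t : nat) :=
  let u := ou r in let v := ov r in
  if joined (lam v) (lam u) then csize (lam v) == csize (lam u)
  else [&& t == csize (lam v),
           ~~ wants_to_join O G u (act (lam u)) (csize (lam u))
                (act (lam v)) (csize (lam v))
         & ~~ wants_to_join O G v (act (lam v)) (csize (lam v))
                (act (lam u)) (csize (lam u))].

(* Step [r] adds the values accumulated at [ov r] to those of [ou r].  The
   edge between them is checked at that moment: if it leaves the coalition of
   [ov r], then that coalition is complete and must have the intended size. *)
Fixpoint members (lam : nat -> label) r w :=
  if r is r'.+1 then
    members lam r' w +
    (if (w == ou r') && joined (lam (ov r')) (lam (ou r'))
     then members lam r' (ov r') else 0)
  else 1.

(** Common form of the two event counters: [f] is charged at every vertex, and [g] at the top of a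
    coalition, when the edge above it is processed. *)
Fixpoint total (f g : label -> nat) (lam : nat -> label) r w :=
  if r is r'.+1 then
    total f g lam r' w +
    (if w == ou r' then
       total f g lam r' (ov r') +
       (if joined (lam (ov r')) (lam (ou r')) then 0 else g (lam (ov r')))
     else 0)
  else f (lam w).

(** Designation as a witness is an option offered to every vetoer; how many use it is settled by the
    final count alone. *)
Fixpoint good (lam : nat -> label) r w :=
  if r is r'.+1 then
    good lam r' w &&
    ((w == ou r') ==>
     good lam r' (ov r') && compatible r' lam (members lam r' (ov r')))
  else
    if w == n then lam n == void_label
    else admissible O p G w (act (lam w)) (csize (lam w)) &&
         (witness (lam w) ==> vetoes O w (act (lam w)) (csize (lam w))).

Definition code_sum :=
  total (fun l => if witness l then 2 ^ (act l).*2.+1 else 0)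
        (fun l => top_weight (act l)).

Definition item_count := total (fun l => witness l) (fun l => act l != 0).

Definition realizable r w a k t s q := exists lam,
  [/\ good lam r w, act (lam w) = a, csize (lam w) = k, members lam r w = t &
      code_sum lam r w = s /\ item_count lam r w = q].

Definition alive r w := all (fun r' => ov r' != w) (iota 0 r).

Lemma aliveP r w : reflect (forall r', r' < r -> ov r' <> w) (alive r w).
Proof.
apply: (iffP allP) => h r'.
  by move=> hr; apply/eqP/h; rewrite mem_iota.
by rewrite mem_iota => /h /eqP.
Qed.

Lemma aliveS r w : alive r.+1 w = alive r w && (ov r != w).
Proof. by rewrite /alive -addn1 iotaD all_cat /= andbT. Qed.

Variable adj : rel nat.
Hypothesis elim : elimination_order n adj ov ou.

Lemma ov_lt r : r < n -> ov r < n.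
Proof. by case/elim. Qed.

Lemma ov_inj r1 r2 : r1 < n -> r2 < n -> ov r1 = ov r2 -> r1 = r2.
Proof.
move=> h1 h2 e; case: (ltngtP r1 r2) => // h.
  by case: (elim h2) => _ /(_ _ h) [].
by case: (elim h1) => _ /(_ _ h) []; rewrite e.
Qed.

Lemma alive_ov r : r < n -> alive r (ov r).
Proof. by case/elim => _ h _ _; apply/aliveP. Qed.

Lemma ou_le r : r < n -> ou r <= n.
Proof. by case/elim => _ _ [->|[/ltnW]]. Qed.

Lemma alive_root r : r <= n -> alive r n.
Proof.
move=> hr; apply/aliveP => r' hr' e.
by have := ov_lt (leq_trans hr' hr); rewrite e ltnn.
Qed.

Lemma alive_ouS r : r < n -> alive r.+1 (ou r).
Proof.
move=> hr; case: (elim hr) => _ _ [->|[_ _ h]] _; first exact: alive_root.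
exact/aliveP.
Qed.

Lemma alive_ou r : r < n -> alive r (ou r).
Proof. by move/alive_ouS; rewrite aliveS => /andP[]. Qed.

Lemma ov_neq_ou r : r < n -> ov r != ou r.
Proof. by move/alive_ouS; rewrite aliveS => /andP[]. Qed.

Lemma ov_surj w : w < n -> exists2 r, r < n & ov r = w.
Proof.
move=> hw; pose F (r : 'I_n) := Ordinal (ov_lt (ltn_ord r)).
have Finj : injective F.
  by move=> r1 r2 /(congr1 val) /(ov_inj (ltn_ord r1) (ltn_ord r2)) /val_inj.
have [H _ HK] := injF_bij Finj.
by exists (H (Ordinal hw)) => //; have /(congr1 val) := HK (Ordinal hw).
Qed.

(** The vertex into which [j] has been merged after [r] steps, so that the vertices hosted by [w]
    form the subtree collected at [w]. *)
Fixpoint host r j :=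
  if r is r'.+1 then
    if host r' j == ov r' then ou r' else host r' j
  else j.

Lemma host_alive r w : alive r w -> host r w = w.
Proof.
elim: r => [//|r IH]; rewrite aliveS => /andP[/IH /= ->].
by rewrite eq_sym => /negbTE ->.
Qed.

(** A table entry speaks of a labelling of all vertices, but only the labels in the subtree
    collected at [w] matter. This is what allows two labellings to be glued. *)
Lemma values_local r w lam1 lam2 :
  r <= n -> alive r w -> (forall j, host r j = w -> lam1 j = lam2 j) ->
  [/\ members lam1 r w = members lam2 r w,
      code_sum lam1 r w = code_sum lam2 r w,
      item_count lam1 r w = item_count lam2 r w
    & good lam1 r w = good lam2 r w].
Proof.
rewrite /code_sum /item_count.
elim: r w => [|r IH] w hr al h.
  by rewrite /= h //; case: eqP => // <-; rewrite h.
have hr' := ltnW hr; move: al; rewrite aliveS => /andP[al nv].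
have hw j : host r j = w -> lam1 j = lam2 j.
  by move=> e; apply: h; rewrite /= e eq_sym (negbTE nv).
have [e1 e2 e3 e4] := IH w hr' al hw.
rewrite /= e1 e2 e3 e4; case: (eqVneq w (ou r)) => [ewu|] //=.
have hv j : host r j = ov r -> lam1 j = lam2 j.
  by move=> e; apply: h; rewrite /= e eqxx.
have [v1 v2 v3 v4] := IH (ov r) hr' (alive_ov hr) hv.
have lv : lam1 (ov r) = lam2 (ov r) by apply/hv/host_alive/alive_ov.
have lu : lam1 (ou r) = lam2 (ou r) by apply: hw; rewrite ewu host_alive ?alive_ou.
by rewrite /compatible v1 v2 v3 v4 lv lu.
Qed.

Lemma realizable_frame r w a k t s q :
  w != ou r -> realizable r.+1 w a k t s q <-> realizable r w a k t s q.
Proof.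
move=> /negbTE nu.
have e lam : [/\ good lam r.+1 w = good lam r w,
    members lam r.+1 w = members lam r w,
    code_sum lam r.+1 w = code_sum lam r w
  & item_count lam r.+1 w = item_count lam r w].
  by rewrite /code_sum /item_count /= nu /= !addn0 andbT.
by split=> -[lam h]; exists lam; case: (e lam) h => -> -> -> ->.
Qed.

Definition mergeable r a k b l t :=
  if (b == a) && (a != 0) then l == k
  else [&& t == l, ~~ wants_to_join O G (ou r) a k b l
         & ~~ wants_to_join O G (ov r) b l a k].

(** The recurrence of the dynamic program: the subtrees collected at [ou r] and [ov r] are disjoint,
    so their labellings can be chosen independently, up to the condition on the edge between
    them. *)
Lemma realizable_merge r a k t s q : r < n ->
  realizable r.+1 (ou r) a k t s q <->
  exists t1 s1 q1 b l t2 s2 q2,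
    [/\ realizable r (ou r) a k t1 s1 q1, realizable r (ov r) b l t2 s2 q2,
        mergeable r a k b l t2
      & [/\ t = t1 + (if (b == a) && (a != 0) then t2 else 0),
         s = s1 + (s2 + (if (b == a) && (a != 0) then 0 else top_weight b))
       & q = q1 + (q2 + (if (b == a) && (a != 0) then 0 else b != 0))]].
Proof.
move=> hr; split.
  case=> lam [gd <- <- <- [<- <-]]; move: gd; rewrite /= eqxx /= => /and3P[g1 g2 g3].
  exists (members lam r (ou r)), (code_sum lam r (ou r)), (item_count lam r (ou r)),
    (act (lam (ov r))), (csize (lam (ov r))), (members lam r (ov r)),
    (code_sum lam r (ov r)), (item_count lam r (ov r)); split.
  - by exists lam.
  - by exists lam.
  - by [].
  - by rewrite /code_sum /item_count /= eqxx.
case=> t1 [s1 [q1 [b [l [t2 [s2 [q2 [[lam1 [g1 a1 k1 m1 [c1 i1]]]]]]]]]]].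
case=> lam2 [g2 a2 k2 m2 [c2 i2]] mg [-> -> ->].
(* The labelling for [ov r] on the subtree collected there, and the one for [ou r] elsewhere. *)
pose lam j := if host r j == ov r then lam2 j else lam1 j.
have [u1 u2 u3 u4] : [/\ members lam r (ou r) = members lam1 r (ou r),
    code_sum lam r (ou r) = code_sum lam1 r (ou r),
    item_count lam r (ou r) = item_count lam1 r (ou r)
  & good lam r (ou r) = good lam1 r (ou r)].
  apply: values_local => [||j e]; rewrite ?(ltnW hr) ?alive_ou //.
  by rewrite /lam e eq_sym (negbTE (ov_neq_ou hr)).
have [v1 v2 v3 v4] : [/\ members lam r (ov r) = members lam2 r (ov r),
    code_sum lam r (ov r) = code_sum lam2 r (ov r),
    item_count lam r (ov r) = item_count lam2 r (ov r)
  & good lam r (ov r) = good lam2 r (ov r)].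
  apply: values_local => [||j e]; rewrite ?(ltnW hr) ?alive_ov //.
  by rewrite /lam e eqxx.
have lu : lam (ou r) = lam1 (ou r).
  by rewrite /lam host_alive ?alive_ou // eq_sym (negbTE (ov_neq_ou hr)).
have lv : lam (ov r) = lam2 (ov r).
  by rewrite /lam host_alive ?alive_ov // eqxx.
exists lam; rewrite /code_sum /item_count /= eqxx -/code_sum -/item_count /=.
rewrite -/(code_sum _ _ _) -/(item_count _ _ _) u1 u2 u3 u4 v1 v2 v3 v4.
rewrite /compatible /joined lu lv a1 k1 m1 c1 i1 a2 k2 m2 c2 i2 g1 g2.
by split.
Qed.

Lemma realizable_player w a k t s q : w < n ->
  realizable 0 w a k t s q <->
  [/\ admissible O p G w a k, t = 1 &
      s = 0 /\ q = 0 \/ [/\ vetoes O w a k, s = 2 ^ a.*2.+1 & q = 1]].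
Proof.
move=> hw; have nw : (w == n) = false by apply/negbTE; rewrite ltn_eqF.
rewrite /realizable /code_sum /item_count /= nw; split.
  case=> lam [/andP[h1 h2] <- <- <- [<- <-]]; split=> //.
  by move: h2; case: (witness _) => /=; [right | left].
case=> h1 -> [[-> ->]|[h2 -> ->]].
  by exists (fun=> (a, k, false)); rewrite /= h1.
by exists (fun=> (a, k, true)); rewrite /= h1.
Qed.

Lemma realizable_root a k t s q :
  realizable 0 n a k t s q <-> [/\ a = 0, k = 1, t = 1, s = 0 & q = 0].
Proof.
rewrite /realizable /code_sum /item_count /= eqxx; split.
  by case=> lam [/eqP -> <- <- <- [<- <-]].
by case=> -> -> -> -> ->; exists (fun=> void_label).
Qed.

Definition hosted r w := \sum_(j < n.+1) (host r j == w).

Lemma hostedS r w : alive r.+1 w ->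
  hosted r.+1 w = hosted r w + (if w == ou r then hosted r (ov r) else 0).
Proof.
rewrite aliveS => /andP[_ nv]; rewrite /hosted.
case: (eqVneq w (ou r)) => [e|nu]; rewrite -?big_split ?addn0 /=;
  apply: eq_bigr => j _ /=; case: (eqVneq (host r j) (ov r)) => [->|_] //.
- by rewrite -e eqxx (negbTE nv).
- by rewrite addn0.
- by rewrite [_ == w]eq_sym (negbTE nu) (negbTE nv).
Qed.

Lemma hosted_le r w : hosted r w <= n.+1.
Proof.
rewrite -[leqRHS]card_ord -sum1_card; apply: leq_sum => j _.
by case: (_ == _).
Qed.

Hypothesis O_bound : forall i a k b l, O i a k b l ->
  [/\ i < n, a <= p & 0 < k <= n].

(** A subtree of [h] vertices has seen [h - 1] merges. Each vertex adds at most [2 * 4 ^ p] for a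
    witness and each merge at most [4 ^ p] for a completed coalition, which gives
    [3 * 4 ^ p * h - 4 ^ p]; likewise there are at most [h + (h - 1)] items. The bound [n + 1] on
    sizes covers the virtual vertex when [n = 0]. *)
Lemma good_bounds lam r w : r <= n -> w <= n -> alive r w -> good lam r w ->
  [/\ act (lam w) <= p, csize (lam w) <= n.+1, members lam r w <= hosted r w,
      code_sum lam r w + 2 ^ p.*2 <= 3 * 2 ^ p.*2 * hosted r w
    & item_count lam r w < 2 * hosted r w].
Proof.
rewrite /code_sum /item_count; elim: r w => [|r IH] w hr hw al.
  have -> : hosted 0 w = 1.
    rewrite /hosted (bigD1 (Ordinal (hw : w < n.+1))) //= eqxx big1 // => j.
    by rewrite -val_eqE /= => /negbTE ->.
  have pw : 2 ^ p.*2.+1 = 2 * 2 ^ p.*2 by rewrite expnS.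
  rewrite /=; case: eqP => [->|_].
    by move=> /eqP -> /=; split; rewrite // muln1; lia.
  case/andP=> /andP[/O_bound[_ ha /andP[_ hk]] _] _; split=> //.
  - exact: leqW.
  - case: ifP => _; last by lia.
    have : 2 ^ (act (lam w)).*2.+1 <= 2 ^ p.*2.+1.
      by rewrite leq_pexp2l // ltnS leq_double.
    by rewrite pw; lia.
  - by case: (witness _).
rewrite hostedS //=; case/andP=> g.
have hr' := ltnW hr; move: al; rewrite aliveS => /andP[al nv].
have [h1 h2 h3 h4 h5] := IH w hr' hw al g.
case: (eqVneq w (ou r)) => [e|_ _] /=; last by rewrite !addn0.
case/andP=> g' _.
have [v1 v2 v3 v4 v5] := IH (ov r) hr' (ltnW (ov_lt hr)) (alive_ov hr) g'.
split=> //.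
- by rewrite leq_add //; case: ifP.
- have : (if joined (lam (ov r)) (lam (ou r)) then 0
          else top_weight (act (lam (ov r)))) <= 2 ^ p.*2.
    rewrite /top_weight; case: ifP => // _; case: ifP => // _.
    by rewrite leq_pexp2l // leq_double.
  by move: h4 v4; rewrite mulnDr; lia.
- have : (if joined (lam (ov r)) (lam (ou r)) then 0
          else nat_of_bool (act (lam (ov r)) != 0)) <= 1.
    by case: ifP => // _; case: (_ != 0).
  by move: h5 v5; rewrite mulnDr; lia.
Qed.

Lemma realizable_bounds r w a k t s q :
  r <= n -> w <= n -> alive r w -> realizable r w a k t s q ->
  [/\ a <= p, k <= n.+1, t <= n.+1, s < 3 * 2 ^ p.*2 * n.+1 & q < 2 * n.+1].
Proof.
move=> hr hw al [lam [g <- <- <- [<- <-]]].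
have [h1 h2 h3 h4 h5] := good_bounds hr hw al g.
have hc := hosted_le r w; split=> //.
- exact: leq_trans h3 hc.
- apply: leq_trans (leq_mul (leqnn _) hc); apply: leq_trans h4.
  by rewrite -ltn_psubLR ?subnn // expn_gt0.
- by apply: leq_trans h5 _; rewrite leq_mul.
Qed.

(** Unfolds the recursion of [good]: when a vertex is eliminated, its conditions are taken over by
    its neighbour, so the vertices still alive always carry all of them. *)
Lemma good_alive lam r : r <= n ->
  (forall w, w <= n -> alive r w -> good lam r w) <->
  (forall w, w <= n -> good lam 0 w) /\
  (forall r', r' < r -> compatible r' lam (members lam r' (ov r'))).
Proof.
elim: r => [_|r IH hr].
  by split=> [h|[h _]]; [split=> // w hw; apply: h | move=> w hw _; apply: h].
have [IH1 IH2] := IH (ltnW hr); split=> [h|[h1 h2]].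
  have := h _ (ou_le hr) (alive_ouS hr); rewrite /= eqxx /= => /and3P[_ gv cv].
  have [|h1 h2] := IH1.
    move=> w hw al; case: (eqVneq (ov r) w) => [<- //|nv].
    by have := h w hw; rewrite aliveS al nv => /(_ isT) /andP[].
  split=> // r'; rewrite ltnS leq_eqVlt => /orP[/eqP -> //|]; exact: h2.
have {IH1 IH2} h3 : forall w, w <= n -> alive r w -> good lam r w.
  by apply: IH2; split=> // r' hr'; apply: h2; rewrite ltnW.
move=> w hw; rewrite aliveS => /andP[al _] /=.
by rewrite h3 //=; apply/implyP => _; rewrite h3 ?h2 ?alive_ov // ltnW ?ov_lt.
Qed.

Lemma alive_last w : w <= n -> alive n w = (w == n).
Proof.
rewrite leq_eqVlt => /orP[/eqP ->|hw]; first by rewrite eqxx alive_root.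
rewrite ltn_eqF //; apply/negbTE/negP => /aliveP h.
by have [r hr e] := ov_surj hw; case: (h r hr e).
Qed.

Lemma good_root lam : good lam n n <->
  (forall w, w <= n -> good lam 0 w) /\
  (forall r, r < n -> compatible r lam (members lam r (ov r))).
Proof.
rewrite -good_alive //; split=> [h w hw|h]; last first.
  by apply: h => //; rewrite alive_last.
by rewrite alive_last // => /eqP ->.
Qed.

(** Conservation law: a merge moves the value of the eliminated vertex to its neighbour, so the sum
    over the vertices still alive grows only by the charges [g]. *)
Lemma total_alive f g lam r : r <= n ->
  \sum_(w < n.+1 | alive r w) total f g lam r w =
  \sum_(w < n.+1) f (lam w) +
  \sum_(r' < r) (if joined (lam (ov r')) (lam (ou r')) then 0
                 else g (lam (ov r'))).
Proof.
elim: r => [_|r IH hr]; first by rewrite big_ord0 addn0; apply: eq_bigl.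
rewrite [X in _ = _ + X]big_ord_recr addnA -IH 1?ltnW //=.
have hv : ov r < n.+1 by rewrite ltnW // ltnS ov_lt.
have hu : ou r < n.+1 by rewrite ltnS ou_le.
rewrite [in RHS](bigD1 (Ordinal hv)) ?alive_ov //=.
rewrite [LHS](eq_bigl (fun w : 'I_n.+1 => alive r w && (w != Ordinal hv))); last first.
  by move=> w; rewrite aliveS -val_eqE /= eq_sym.
rewrite [LHS]big_split [RHS]addnAC [RHS]addnC /=; congr (_ + _).
rewrite (bigD1 (Ordinal hu)) /=; last first.
  by rewrite alive_ou // -val_eqE /= eq_sym ov_neq_ou.
rewrite eqxx big1 ?addn0 // => w /andP[_].
by rewrite -val_eqE /= => /negbTE ->.
Qed.

Lemma total_root f g lam :
  total f g lam n n = \sum_(w < n.+1) f (lam w) +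
  \sum_(r < n) (if joined (lam (ov r)) (lam (ou r)) then 0 else g (lam (ov r))).
Proof.
rewrite -total_alive // (big_pred1 (@ord_max n)) // => w.
by rewrite alive_last // -ltnS.
Qed.

(** For [b] nonzero this counts the groups formed by joined edges: going towards the root, each
    group has exactly one vertex whose edge leaves it. *)
Definition tops lam b := \sum_(r < n)
  (~~ joined (lam (ov r)) (lam (ou r)) && (act (lam (ov r)) == b)).

Definition witnesses (lam : nat -> label) b :=
  \sum_(j < n) (witness (lam j) && (act (lam j) == b)).

(** The multiplicity of [2 ^ i] in the final code sum. Index 0 gets 0 because leaving a void vertex
    adds no weight. *)
Definition item lam i :=
  if odd i then witnesses lam i./2 else if i == 0 then 0 else tops lam i./2.

Definition solution lam :=
  [/\ lam n = void_label,
      forall w, w < n ->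
        admissible O p G w (act (lam w)) (csize (lam w)) /\
        (witness (lam w) -> vetoes O w (act (lam w)) (csize (lam w))),
      forall r, r < n -> compatible r lam (members lam r (ov r))
    & forall i, i < p.+1.*2 -> item lam i = bit i G].

Lemma sum_pairs K (F : nat -> nat) :
  \sum_(i < K.*2) F i = \sum_(b < K) (F b.*2 + F b.*2.+1).
Proof.
elim: K => [|K IH]; first by rewrite !big_ord0.
by rewrite doubleS !big_ord_recr /= IH addnA.
Qed.

Lemma sum_by_value m K (P : 'I_m -> bool) (a : 'I_m -> nat) (h : nat -> nat) :
  (forall r, a r < K) ->
  \sum_(r < m) P r * h (a r) =
  \sum_(b < K) (\sum_(r < m) (P r && (a r == b))) * h b.
Proof.
move=> ha; under [RHS]eq_bigr => b _ do rewrite big_distrl /=.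
rewrite exchange_big /=; apply: eq_bigr => r _.
rewrite (bigD1 (Ordinal (ha r))) //= eqxx andbT big1 ?addn0 // => b.
by rewrite -val_eqE /= eq_sym => /negbTE ->; rewrite andbF.
Qed.

(** Applied twice: with weights [2 ^ i] it describes the code sum, and with all weights 1 the item
    count. *)
Lemma sum_items lam (h : nat -> nat) (x y : nat -> nat) :
  lam n = void_label -> (forall w, w < n -> act (lam w) <= p) ->
  (forall b, b <= p -> x b.*2.+1 = y b) ->
  (forall b, 0 < b <= p -> x b.*2 = h b) -> h 0 = 0 ->
  total (fun l => if witness l then y (act l) else 0) (fun l => h (act l))
    lam n n =
  \sum_(i < p.+1.*2) item lam i * x i.
Proof.
move=> ln la hy hh h0; rewrite total_root big_ord_recr /= ln /= addn0.
rewrite (sum_pairs _ (fun i => item lam i * x i)) big_split addnC /=; congr (_ + _).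
  transitivity (\sum_(r < n) ~~ joined (lam (ov r)) (lam (ou r)) *
                             h (act (lam (ov r)))).
    by apply: eq_bigr => r _; case: joined; rewrite ?mul1n.
  rewrite (@sum_by_value _ p.+1) => [|r]; last by rewrite ltnS la ?ov_lt.
  apply: eq_bigr => b _; rewrite /item odd_double doubleK double_eq0.
  case: (eqVneq (val b) 0) => [->|b0]; rewrite ?h0 ?muln0 // hh //.
  by rewrite lt0n b0 -ltnS /=.
transitivity (\sum_(j < n) witness (lam j) * y (act (lam j))).
  by apply: eq_bigr => j _; case: witness; rewrite ?mul1n.
rewrite (@sum_by_value _ p.+1) => [|r]; last by rewrite ltnS la.
apply: eq_bigr => b _; rewrite /item /= odd_double /= uphalf_double.
by rewrite hy // -ltnS.
Qed.

Lemma members_root lam r : lam n = void_label -> members lam r n = 1.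
Proof.
move=> ln; elim: r => [//|r /= ->].
by case: eqP => // <-; rewrite ln /joined andbF.
Qed.

(** The accepting entry says that the multiplicities [item lam i] represent [G] with as many terms
    as [G] has binary ones, so they are its bits. Conversely the bound on [G] lets its bits be
    summed back to [G]. *)
Lemma accepting :
  (realizable n n 0 1 1 G (bitcount p.+1.*2 G) -> exists lam, solution lam) /\
  (G < 2 ^ p.+1.*2 -> (exists lam, solution lam) ->
   realizable n n 0 1 1 G (bitcount p.+1.*2 G)).
Proof.
have items lam : lam n = void_label -> (forall w, w < n -> act (lam w) <= p) ->
    code_sum lam n n = \sum_(i < p.+1.*2) item lam i * 2 ^ i /\
    item_count lam n n = \sum_(i < p.+1.*2) item lam i.
  move=> ln la; split.
    apply: (@sum_items lam top_weight (expn 2) (fun a => 2 ^ a.*2.+1)) => // b.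
    by case/andP=> b0 _; rewrite /top_weight -if_neg -lt0n b0.
  transitivity (\sum_(i < p.+1.*2) item lam i * 1); last first.
    by apply: eq_bigr => i _; rewrite muln1.
  rewrite -(@sum_items lam (fun a => a != 0) (fun=> 1) (fun=> 1)) //.
  by move=> b /andP[]; case: b.
split=> [[lam [/good_root[g c] _ _ _ [s q]]]|hG [lam [ln la c it]]]; exists lam.
  have ln : lam n = void_label by have := g n (leqnn _); rewrite /= eqxx => /eqP.
  have gw w : w < n -> admissible O p G w (act (lam w)) (csize (lam w)) /\
      (witness (lam w) -> vetoes O w (act (lam w)) (csize (lam w))).
    move=> hw; have := g w (ltnW hw); rewrite /= ltn_eqF //.
    by case/andP=> ? /implyP.
  have la w : w < n -> act (lam w) <= p.
    by move=> /gw[/andP[/O_bound[]]].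
  have [e1 e2] := items lam ln la; split=> //.
  by apply: (@binary_expansion_unique _ _ (item lam)); rewrite -?e1 -?e2.
have lp w : w < n -> act (lam w) <= p.
  by move=> /la[/andP[/O_bound[]]].
have [e1 e2] := items lam ln lp.
rewrite members_root // ln; split=> //.
  apply/good_root; split=> // w; rewrite leq_eqVlt => /orP[/eqP ->|hw] /=.
    by rewrite eqxx ln.
  by rewrite ltn_eqF //; have [-> /implyP ->] := la w hw.
rewrite e1 e2; split; last by apply: eq_bigr => i _; rewrite it.
rewrite -[RHS](sum_bits hG).
by apply: eq_bigr => i _; rewrite it.
Qed.

(** * Coalitions along an elimination order *)

Section Leaders.

Variable lam : nat -> label.
Hypothesis lam_root : lam n = void_label.

Definition joins r := joined (lam (ov r)) (lam (ou r)).

(* Like [host], but stopping at the top of the coalition of [j]. *)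
Fixpoint leader r j :=
  if r is r'.+1 then
    if (leader r' j == ov r') && joins r' then ou r' else leader r' j
  else j.

Lemma joins_act r : joins r -> act (lam (ov r)) = act (lam (ou r)) /\
  act (lam (ou r)) <> 0.
Proof. by case/andP=> /eqP -> /eqP. Qed.

Lemma act_leader r j : act (lam (leader r j)) = act (lam j).
Proof.
by elim: r => //= r; case: ifP => // /andP[/eqP -> /joins_act[-> _]].
Qed.

(** Joined edges require equal intended sizes, so the size checked at the top of a coalition is the
    one intended by all its members. *)
Lemma csize_leader r j :
  (forall r', r' < r -> compatible r' lam (members lam r' (ov r'))) ->
  csize (lam (leader r j)) = csize (lam j).
Proof.
elim: r => //= r IH h; case: ifP => [/andP[/eqP e jr]|_]; last first.
  by apply: IH => r' hr'; apply: h; rewrite ltnW.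
have := h r (ltnSn r); rewrite /compatible -/(joins r) jr -e => /eqP <-.
by apply: IH => r' hr'; apply: h; rewrite ltnW.
Qed.

Lemma leader_void r j : act (lam j) = 0 -> leader r j = j.
Proof.
move=> h; elim: r => //= r IH; case: ifP => // /andP[/eqP e jr].
by have [e1] := joins_act jr; rewrite -e1 -e act_leader h.
Qed.

Lemma ou_joins r : r < n -> joins r -> ou r < n /\ adj (ov r) (ou r).
Proof.
move=> /elim[_ _ [e|[h1 h2 _]]] // _ /joins_act[_].
by rewrite e lam_root.
Qed.

Lemma leader_lt r j : r <= n -> j < n -> leader r j < n.
Proof.
move=> hr hj; elim: r hr => //= r IH hr.
case: ifP => [/andP[_ /(ou_joins hr)[]]//|_]; exact/IH/ltnW.
Qed.

Lemma leader_alive r w : alive r w -> leader r w = w.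
Proof.
elim: r => [//|r IH]; rewrite aliveS => /andP[/IH /= ->].
by rewrite eq_sym => /negbTE ->.
Qed.

Lemma leader_trans r1 r2 j1 j2 :
  r1 <= r2 -> leader r1 j1 = leader r1 j2 -> leader r2 j1 = leader r2 j2.
Proof.
by move=> /subnK <- e; elim: (r2 - r1) => //= k ->.
Qed.

Lemma leader_joins r : r < n -> joins r -> leader n (ov r) = leader n (ou r).
Proof.
move=> hr jr; apply: (leader_trans hr).
by rewrite [RHS]leader_alive ?alive_ouS //= leader_alive ?alive_ov // eqxx jr.
Qed.

(** Only step [r] could move players away from [ov r], and it does not join; no later step moves
    players to [ov r], which is then eliminated. The coalition is complete at step [r]. *)
Lemma leader_top_stable r r2 j : r <= r2 -> r2 <= n -> r < n -> ~~ joins r ->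
  (leader r2 j == ov r) = (leader r j == ov r).
Proof.
move=> /subnK <-; move: (r2 - r) => k hk hr nj; elim: k hk => //= k IH hk.
rewrite -IH 1?ltnW //; case: ifP => // /andP[/eqP -> jk].
have rk : r <> k + r by move=> e; move: nj; rewrite {1}e jk.
rewrite [RHS](introF eqP); last by move/(ov_inj hk hr)/esym.
have lt : r < k + r by lia.
by apply/eqP => e; have /aliveP/(_ r lt) := alive_ou hk; rewrite e.
Qed.

Lemma leader_top r : r < n -> ~~ joins r -> leader n (ov r) = ov r.
Proof.
move=> hr nj; apply/eqP; rewrite (leader_top_stable _ (ltnW hr) _ hr nj) //.
by rewrite leader_alive ?alive_ov.
Qed.

Lemma leader_not_joining r r2 j :
  r < r2 -> r2 <= n -> joins r -> leader r2 j != ov r.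
Proof.
move=> + + jr; elim: r2 => //= r2 IH; rewrite ltnS leq_eqVlt.
case/orP=> [/eqP <-|lt] hr2.
  case: ifP => [_|]; first by rewrite eq_sym ov_neq_ou.
  by rewrite jr andbT => ->.
case: ifP => _; last by apply: IH => //; apply: ltnW.
by apply/eqP => e; have /aliveP/(_ r lt) := alive_ou hr2; rewrite e.
Qed.

Lemma leader_is_top j : j < n ->
  exists2 r, r < n & ~~ joins r /\ leader n j = ov r.
Proof.
move=> hj; have [r hr e] := ov_surj (leader_lt (leqnn n) hj).
exists r => //; split=> //; apply/negP => jr.
by have := leader_not_joining j hr (leqnn n) jr; rewrite e eqxx.
Qed.

Lemma members_alive r w : r <= n -> w < n -> alive r w ->
  members lam r w = \sum_(j < n) (leader r j == w).
Proof.
elim: r w => [|r IH] w hr hw.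
  rewrite (bigD1 (Ordinal hw)) //= eqxx big1 // => j.
  by rewrite -val_eqE /= => /negbTE ->.
rewrite aliveS => /andP[al nv] /=.
rewrite IH ?(ltnW hr) // -/(joins r).
case: (boolP (joins r)) => jr; last first.
  by rewrite andbF addn0; apply: eq_bigr => j _; rewrite andbF.
rewrite andbT; case: (eqVneq w (ou r)) => [e|nu]; last first.
  rewrite addn0; apply: eq_bigr => j _; rewrite andbT.
  case: (eqVneq (leader r j) (ov r)) => [->|//].
  by rewrite (negbTE nv) eq_sym (negbTE nu).
rewrite IH ?(ltnW hr) ?alive_ov ?ov_lt // -big_split; apply: eq_bigr => j _ /=.
rewrite andbT; case: (eqVneq (leader r j) (ov r)) => [->|_]; last by rewrite addn0.
by rewrite e eqxx -e (negbTE nv).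
Qed.

Lemma members_top r : r < n -> ~~ joins r ->
  members lam r (ov r) = \sum_(j < n) (leader n j == ov r).
Proof.
move=> hr nj; rewrite members_alive ?(ltnW hr) ?alive_ov ?ov_lt //.
by apply: eq_bigr => j _; rewrite (leader_top_stable _ (ltnW hr) _ hr nj).
Qed.

End Leaders.

(** Of two adjacent vertices, the one eliminated first has the other as its only remaining
    neighbour. So checking the edges between [ov r] and [ou r] checks every edge of the network. *)
Lemma elimination_edge x y : (forall x y, adj x y = adj y x) ->
  x < n -> y < n -> adj x y -> x <> y ->
  exists2 r, r < n & (ov r = x /\ ou r = y) \/ (ov r = y /\ ou r = x).
Proof.
move=> sym hx hy xy nxy.
have [r1 hr1 e1] := ov_surj hx; have [r2 hr2 e2] := ov_surj hy.
have key r r' : r < r' -> r' < n -> adj (ov r) (ov r') -> ou r = ov r'.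
  move=> lt hr' a; have hr := ltn_trans lt hr'.
  case: (elim hr) => _ _ _ /(_ (ov r')) h; rewrite h ?ov_lt // => r3 hr3 e.
  by have := ov_inj (leq_ltn_trans hr3 hr) hr' e; move: hr3 lt; lia.
case: (ltngtP r1 r2) => [lt|lt|e].
- by exists r1 => //; left; rewrite (key _ _ lt) ?e1 ?e2.
- by exists r2 => //; right; rewrite (key _ _ lt) ?e1 ?e2 1?sym.
- by case: nxy; rewrite -e1 -e2 e.
Qed.

End Table.

Lemma sum_at_most_one m (P : pred 'I_m) :
  (forall r1 r2, P r1 -> P r2 -> r1 = r2) -> \sum_(r < m) P r = [exists r, P r].
Proof.
move=> h; case: (boolP [exists r, P r]) => [/existsP[r hr]|/existsPn hn].
  rewrite (bigD1 r) //= hr big1 // => s /eqP ns.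
  by case: (boolP (P s)) => // /(h _ _ hr) /esym.
by rewrite big1 // => r _; rewrite (negbTE (hn r)).
Qed.

Lemma sum_le_one_unique m (P : pred 'I_m) r1 r2 :
  \sum_(r < m) P r <= 1 -> P r1 -> P r2 -> r1 = r2.
Proof.
move=> h h1 h2; case: (eqVneq r1 r2) => // ne.
move: h; rewrite (bigD1 r1) //= (bigD1 r2) 1?eq_sym //= h1 h2.
by rewrite addnA addnC addn2.
Qed.

(** * Labellings along an elimination order and stable assignments *)

Section Correspondence.

Variable I : gGASP.

Notation n := (nplayers I).
Notation p := (nacts I).
Notation O := (gGASP_queries I).

Definition nat_adj : rel nat := fun u v =>
  [exists i : 'I_n, exists j : 'I_n, [&& val i == u, val j == v & @adj I i j]].

Lemma nat_adjE (i j : 'I_n) : nat_adj i j = @adj I i j.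
Proof.
apply/existsP/idP => [[i' /existsP[j' /and3P[/eqP/val_inj -> /eqP/val_inj ->]]]|h] //.
by exists i; apply/existsP; exists j; rewrite !eqxx.
Qed.

Lemma nat_adj_sym u v : nat_adj u v = nat_adj v u.
Proof.
by apply/existsP/existsP => -[i /existsP[j /and3P[h1 h2 h3]]];
  exists j; apply/existsP; exists i; rewrite h1 h2 adj_sym.
Qed.

Lemma activity_code_inj : injective (@activity_code p).
Proof. by move=> [a|] [b|] //= [/val_inj ->]. Qed.

Lemma activity_code_le (a : activity p) : activity_code a <= p.
Proof. by case: a => //= c. Qed.

Lemma queriesE (i : 'I_n) a k b l :
  O i (activity_code a) k (activity_code b) l =
  [&& (a, k) \in alternative n p, (b, l) \in alternative n p
    & pref i (a, k) (b, l)].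
Proof.
apply/existsP/idP => [[j /existsP[a' /existsP[b']]]|h].
  by case/and3P=> /eqP/val_inj -> /eqP/activity_code_inj -> /andP[
    /eqP/activity_code_inj -> ].
by exists i; apply/existsP; exists a; apply/existsP; exists b; rewrite !eqxx.
Qed.

Lemma queries_bound i a k b l :
  O i a k b l -> [/\ i < n, a <= p & 0 < k <= n].
Proof.
case/existsP=> j /existsP[a' /existsP[b']] /and3P[/eqP <- /eqP <-].
case/andP=> _ /andP[hk _]; split; rewrite ?activity_code_le ?ltn_ord //.
case: a' hk => [c|]; first by rewrite /in_mem /=.
by rewrite /in_mem /alternative /= => /eqP ->; apply: leq_ltn_trans (ltn_ord j).
Qed.

Variables (ov ou : nat -> nat).
Hypothesis elim : elimination_order n nat_adj ov ou.

Section Assignment.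

Variables (pi : assignment I) (lam : nat -> label).
Hypothesis lam_root : lam n = void_label.
Hypothesis lam_act : forall i : 'I_n, act (lam i) = activity_code (pi i).

Notation lead := (leader ov ou lam n).

Lemma mem_players_at a j : (j \in players_at pi a) = (act (lam j) == a.+1).
Proof.
rewrite inE lam_act; apply/eqP/eqP => [-> //|]; case: (pi j) => //= c [/val_inj ->] //.
Qed.

Lemma coalition_some i a : pi i = Some a -> coalition pi i = players_at pi a.
Proof. by rewrite /coalition => ->. Qed.

Lemma mem_coalition i : i \in coalition pi i.
Proof.
rewrite /coalition; case e: (pi i) => [a|]; last by rewrite inE.
by rewrite inE e.
Qed.

Lemma coalition_eq (i j : 'I_n) :
  act (lam i) = act (lam j) -> act (lam j) != 0 -> coalition pi i = coalition pi j.
Proof.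
rewrite !lam_act => /activity_code_inj e; rewrite /coalition e.
by case: (pi j).
Qed.

Lemma lead_coalition (i j : 'I_n) : lead j = lead i -> j \in coalition pi i.
Proof.
move=> e; have := act_leader ov ou lam n i; rewrite -e act_leader => eij.
case h : (pi i) => [a|].
  by rewrite (coalition_some h) mem_players_at eij lam_act h.
have ai : act (lam i) = 0 by rewrite lam_act h.
move: e; rewrite !leader_void ?eij // => /val_inj ->; exact: mem_coalition.
Qed.

(** This holds for different reasons in the two directions: for decoded solutions because an
    activity has at most one top, for stable assignments because coalitions are connected. *)
Hypothesis coalition_lead : forall i j : 'I_n, j \in coalition pi i -> lead j = lead i.

Lemma members_coalition r (i : 'I_n) :
  r < n -> ~~ joins ov ou lam r -> ov r = lead i ->
  members ov ou lam r (ov r) = #|coalition pi i|.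
Proof.
move=> hr nj e; rewrite (members_top elim hr nj) -sum1_card.
rewrite [RHS]big_mkcond; apply: eq_bigr => j _ /=; rewrite e.
case: ifP => [/coalition_lead ->|]; first by rewrite eqxx.
by case: eqP => // /lead_coalition ->.
Qed.

End Assignment.

Lemma void_coalition (pi : assignment I) i : pi i = None -> coalition pi i = [set i].
Proof. by rewrite /coalition => ->. Qed.

Lemma coalition_alternative (pi : assignment I) i :
  (pi i, #|coalition pi i|) \in alternative n p.
Proof.
rewrite /in_mem /=; case e: (pi i) => [a|]; rewrite /alternative /=.
  apply/andP; split; last by rewrite -[leqRHS]card_ord max_card.
  by apply/card_gt0P; exists i; apply: mem_coalition.
by rewrite void_coalition // cards1.
Qed.

Lemma induced_sym (S : {set 'I_n}) : symmetric (induced (@adj I) S).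
Proof.
by move=> x y; rewrite /induced /= adj_sym andbCA.
Qed.

Lemma induced_mono (S T : {set 'I_n}) x y : S \subset T ->
  connect (induced (@adj I) S) x y -> connect (induced (@adj I) T) x y.
Proof.
move=> /subsetP st; apply: connect_sub => u v /and3P[h1 h2 h3].
by apply: connect1; rewrite /induced /= !st.
Qed.

Lemma connected_setU1 (S : {set 'I_n}) x y :
  connected_in (@adj I) S -> y \in S -> @adj I x y ->
  connected_in (@adj I) (S :|: [set x]).
Proof.
move=> cS yS xy.
have cy z : z \in S :|: [set x] -> connect (induced (@adj I) (S :|: [set x])) y z.
  rewrite !inE => /orP[zS|/eqP ->].
    exact: induced_mono (subsetUl _ _) (cS _ _ yS zS).
  by apply: connect1; rewrite /induced /= !inE yS eqxx orbT adj_sym.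
move=> u v hu hv; apply: connect_trans (cy v hv).
rewrite (sym_connect_sym (@induced_sym _)); exact: cy.
Qed.

(** * Soundness: a solution decodes to a stable assignment *)

Section Soundness.

Variables (G : nat) (lam : nat -> label).
Hypothesis sol : solution O n p G ov ou lam.

Definition decoded : assignment I :=
  [ffun i : 'I_n => if act (lam i) is c.+1 then insub c else None].

Notation lead := (leader ov ou lam n).

Lemma solution_root : lam n = void_label.
Proof. by case: sol. Qed.

Lemma solution_admissible (i : 'I_n) :
  admissible O p G i (act (lam i)) (csize (lam i)).
Proof. by case: sol => _ /(_ i (ltn_ord i)) []. Qed.

Lemma solution_act (i : 'I_n) : act (lam i) <= p.
Proof. by have /andP[/queries_bound[]] := solution_admissible i. Qed.

Lemma decoded_act (i : 'I_n) : act (lam i) = activity_code (decoded i).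
Proof.
rewrite ffunE; have := solution_act i; case: (act _) => //= c hc.
by rewrite insubT.
Qed.

(** The number of tops of an activity is a bit of [G], hence at most one; two players with the same
    activity therefore have the same leader. *)
Lemma sound_coalition_lead (i j : 'I_n) :
  j \in coalition decoded i -> lead j = lead i.
Proof.
case e: (decoded i) => [a|]; last first.
  by rewrite void_coalition // inE => /eqP ->.
rewrite (coalition_some e) (mem_players_at decoded_act) => /eqP aj.
have ai : act (lam i) = a.+1 by rewrite decoded_act e.
have [r1 hr1 [n1 e1]] := leader_is_top elim solution_root (ltn_ord i).
have [r2 hr2 [n2 e2]] := leader_is_top elim solution_root (ltn_ord j).
have top : tops n ov ou lam a.+1 <= 1.
  case: sol => _ _ _ /(_ a.+1.*2); rewrite ltn_double ltnS ltn_ord.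
  by rewrite /item odd_double doubleK double_eq0 => /(_ isT) /= ->; case: bit.
rewrite e1 e2; congr ov.
have := @sum_le_one_unique n (fun r : 'I_n => ~~ joined (lam (ov r)) (lam (ou r)) &&
  (act (lam (ov r)) == a.+1)) (Ordinal hr2) (Ordinal hr1) top.
rewrite /= -!/(joins _ _ _ _) n1 n2 -e1 -e2 !act_leader ai aj eqxx.
by move=> /(_ isT isT) [].
Qed.

Lemma sound_csize (i : 'I_n) : csize (lam i) = #|coalition decoded i|.
Proof.
have [r hr [nj e]] := leader_is_top elim solution_root (ltn_ord i).
have [_ _ comp _] := sol.
rewrite -(csize_leader i comp) -(members_coalition decoded_act
  sound_coalition_lead hr nj (esym e)) e.
by have := comp r hr; rewrite /compatible /= [joined _ _](negbTE nj) => /and3P[/eqP ->].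
Qed.

(** Every move of the leader follows an edge of the network between two players of the same
    activity. *)
Lemma connect_leader a r (i : 'I_n) : r <= n -> i \in players_at decoded a ->
  exists2 i' : 'I_n, val i' = leader ov ou lam r i &
    connect (induced (@adj I) (players_at decoded a)) i i'.
Proof.
move=> + ia; elim: r => [|r IH] hr; first by exists i.
have [i' e c] := IH (ltnW hr); rewrite /=.
case: ifP => [/andP[/eqP e1 jr]|_]; last by exists i'.
have [hu uv] := ou_joins elim solution_root hr jr.
exists (Ordinal hu) => //; apply: connect_trans c _; apply: connect1.
have [a1 _] := joins_act jr.
have i'a : act (lam i') = a.+1.
  by move: ia; rewrite e act_leader (mem_players_at decoded_act) => /eqP.
rewrite /induced /= !(mem_players_at decoded_act) /= -a1 -e1 -e i'a eqxx.
by rewrite -nat_adjE /= e e1.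
Qed.

Lemma sound_feasible : feasible decoded.
Proof.
move=> i; case e: (decoded i) => [a|]; last first.
  by rewrite void_coalition // => x y /set1P -> /set1P ->.
move=> x y hx hy.
have := sound_coalition_lead hx; rewrite -(sound_coalition_lead hy) => exy.
move: hx hy; rewrite (coalition_some e) => hx hy.
have [x' ex cx] := connect_leader (leqnn n) hx.
have [y' ey cy] := connect_leader (leqnn n) hy.
apply: connect_trans cx _; rewrite (sym_connect_sym (@induced_sym _)).
by have -> : x' = y' by apply: val_inj; rewrite ex ey.
Qed.

Lemma sound_IS (i : 'I_n) a : ~ feasible_IS_deviation decoded i a.
Proof.
case=> nia conn /andP[sp nsp] accept.
have [_ adm comp items] := sol.
have strict : i \notin players_at decoded a.
  by rewrite inE.
(* Since [i] is outside, the enlarged coalition has at most [n] members, so the queries about it are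
   well formed. *)
have lt : #|players_at decoded a| < n.
  have := max_card (mem (i |: players_at decoded a)).
  by rewrite cardsU1 strict card_ord.
have alt k : 0 < k <= n -> (Some a, k) \in alternative n p by [].
have sO b l : (b, l) \in alternative n p ->
    spref i (Some a, #|players_at decoded a| + 1) (b, l) ->
    strictly O i a.+1 #|players_at decoded a|.+1 (activity_code b) l.
  move=> bl /andP[s1 s2]; rewrite addn1 in s1 s2.
  have := queriesE i (Some a) #|players_at decoded a|.+1 b l.
  have := queriesE i b l (Some a) #|players_at decoded a|.+1.
  rewrite /strictly /= bl alt ?lt //= => -> ->.
  by rewrite s1 (negbTE s2).
have {sO} sO := sO _ _ (coalition_alternative decoded i).
have {sO} := sO _; rewrite /spref sp nsp => /(_ isT).
rewrite -decoded_act -sound_csize => sO.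
have [e0|[j0 j0a]] := set_0Vmem (players_at decoded a).
  have /andP[_ /hasPn/(_ (val a))] := solution_admissible i.
  rewrite mem_iota ltn_ord => /(_ isT); rewrite e0 cards0 in sO.
  rewrite sO andbT negbK => used.
  have := items a.+1.*2; rewrite ltn_double ltnS ltn_ord used => /(_ isT).
  rewrite /item odd_double doubleK double_eq0 /= /tops big1 // => r _.
  have := mem_players_at decoded_act a (Ordinal (ov_lt elim (ltn_ord r))).
  by rewrite e0 inE /= => <-; rewrite andbF.
have cj (j : 'I_n) : j \in players_at decoded a -> csize (lam j) = #|players_at decoded a|.
  by rewrite sound_csize inE => /eqP /coalition_some ->.
(* Vetoed activity: the count provides a designated witness, and this member refuses [i]. *)
case: (boolP (bit a.+1.*2.+1 G)) => [blocked|open].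
  have := items a.+1.*2.+1; rewrite ltn_Sdouble ltnS ltn_ord blocked => /(_ isT).
  rewrite /item /= odd_double /= uphalf_double /witnesses.
  case: (boolP [exists j : 'I_n, witness (lam j) && (act (lam j) == a.+1)]).
    case/existsP=> j /andP[wj aj] _; have [_ /(_ wj)] := adm j (ltn_ord j).
    have ja : j \in players_at decoded a by rewrite (mem_players_at decoded_act).
    have k0 : 0 < #|players_at decoded a| by apply/card_gt0P; exists j.
    have /= := queriesE j (Some a) #|players_at decoded a|.+1 (Some a) #|players_at decoded a|.
    rewrite (eqP aj) cj // /vetoes /= => ->.
    have := accept j ja; rewrite addn1 => ->.
    by rewrite !alt ?lt // k0 ltnW.
  move/existsPn => none; rewrite big1 // => j _.
  by rewrite (negbTE (none j)).
have ij : i != j0 by apply: contra strict => /eqP ->.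
(* Otherwise the first edge of a path from [i] into the coalition ends at a member [x], and the
   check on this edge excludes the wish of [i]. *)
have [x xa ix] : exists2 x, x \in players_at decoded a & @adj I i x.
  have /connectP[[|x s] /=] : connect (induced (@adj I) (players_at decoded a :|: [set i])) i j0.
  - by apply: conn; rewrite in_setU ?j0a // in_set1 eqxx orbT.
  - by move=> _ e; rewrite e eqxx in ij.
  rewrite {1}/induced /= => /andP[/and3P[_ hx ix] _] _; exists x => //.
  by move: hx; rewrite inE => /orP[//|/set1P e]; rewrite e adj_irr in ix.
have ax : act (lam x) = a.+1 by move: xa; rewrite (mem_players_at decoded_act) => /eqP.
have nij : act (lam i) != a.+1 by rewrite -(mem_players_at decoded_act).
have wants : wants_to_join O G i (act (lam i)) (csize (lam i)) (act (lam x)) (csize (lam x)).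
  by rewrite /wants_to_join ax (cj x xa) open sO.
have nix : val i <> val x by move/val_inj => e; rewrite e ax eqxx in nij.
have adjix : nat_adj i x by rewrite nat_adjE.
have [r hr [[e1 e2]|[e1 e2]]] :=
    elimination_edge elim nat_adj_sym (ltn_ord i) (ltn_ord x) adjix nix;
  have := comp r hr; rewrite /compatible /= e1 e2 /joined ax.
- by rewrite (negbTE nij) /= -ax wants /= ?andbF.
- by rewrite eq_sym (negbTE nij) /= -ax wants /= ?andbF.
Qed.

Lemma sound_stable : individually_stable decoded.
Proof.
split; [exact: sound_feasible | move=> i | move=> i a; exact: sound_IS].
have /andP[+ _] := solution_admissible i.
have /= := queriesE i (decoded i) #|coalition decoded i| None 1.
by rewrite decoded_act sound_csize => -> /andP[].
Qed.

End Soundness.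

(** * Completeness: a stable assignment yields a guess and a solution *)

Section Completeness.

Variable pi : assignment I.
Hypothesis stable : individually_stable pi.

Notation size i := #|coalition pi i|.

(** [pick] is a canonical choice depending on the set only, so a coalition with vetoers designates
    exactly one of them. *)
Definition opponent (i : 'I_n) :=
  [pick j in coalition pi i | vetoes O j (activity_code (pi j)) (size j)] == Some i.

Definition labelling (j : nat) : label :=
  if insub j : option 'I_n is Some i then (activity_code (pi i), size i, opponent i)
  else void_label.

Definition guess_bit i :=
  if odd i then [exists j, opponent j && (activity_code (pi j) == i./2)]
  else (i != 0) && [exists j, activity_code (pi j) == i./2].

Definition guess := \sum_(i < p.+1.*2) guess_bit i * 2 ^ i.

Notation lead := (leader ov ou labelling n).

Lemma labelling_player (i : 'I_n) :
  labelling i = (activity_code (pi i), size i, opponent i).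
Proof. by rewrite /labelling valK. Qed.

Lemma labelling_root : labelling n = void_label.
Proof. by rewrite /labelling insubF // ltnn. Qed.

Lemma labelling_act (i : 'I_n) : act (labelling i) = activity_code (pi i).
Proof. by rewrite labelling_player. Qed.

Lemma bit_guess i : i < p.+1.*2 -> bit i guess = guess_bit i.
Proof. exact: bit_sum. Qed.

Lemma same_coalition (i j : 'I_n) :
  activity_code (pi i) = activity_code (pi j) -> activity_code (pi j) != 0 ->
  coalition pi i = coalition pi j.
Proof. by rewrite -!labelling_act; apply: coalition_eq labelling_act _ _. Qed.

Lemma opponent_vetoes (i : 'I_n) :
  opponent i -> vetoes O i (activity_code (pi i)) (size i).
Proof. by rewrite /opponent; case: pickP => // j /andP[_ hj] /eqP[<-]. Qed.

Lemma opponent_unique (i j : 'I_n) : opponent i -> opponent j ->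
  activity_code (pi i) = activity_code (pi j) -> i = j.
Proof.
move=> hi hj e; have /andP[nz _] := opponent_vetoes hj.
have /= := hi; rewrite /opponent (same_coalition e nz) (eqP hj).
by move=> /eqP[].
Qed.

(** By feasibility a path inside the coalition connects the two players; each of its edges is an
    elimination edge, and it is joined because its ends share the activity. *)
Lemma complete_coalition_lead (i j : 'I_n) :
  j \in coalition pi i -> lead j = lead i.
Proof.
have [feas _ _] := stable.
case e: (pi i) => [a|]; last by rewrite void_coalition // inE => /eqP ->.
move=> hj; have := feas i i j (mem_coalition _ _) hj.
rewrite (coalition_some e) => /connectP[s pth ->].
elim: s i e {hj} pth => //= x s IH i e /andP[/and3P[hi hx hix] pth].
have px : pi x = Some a by move: hx; rewrite inE => /eqP.
rewrite (IH x px pth).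
have nix : val i <> val x by move/val_inj => ix; rewrite ix adj_irr in hix.
have jr r : (ov r = i /\ ou r = x) \/ (ov r = x /\ ou r = i) ->
    joins ov ou labelling r.
  by rewrite /joins /joined => -[[-> ->]|[-> ->]]; rewrite !labelling_act e px eqxx.
have adjix : nat_adj i x by rewrite nat_adjE.
have [r hr h] := elimination_edge elim nat_adj_sym (ltn_ord i) (ltn_ord x) adjix nix.
have := leader_joins elim hr (jr r h).
by case: h => -[-> ->].
Qed.

Lemma complete_members r (i : 'I_n) : r < n -> ~~ joins ov ou labelling r ->
  ov r = i -> members ov ou labelling r i = size i.
Proof.
move=> hr nj e; rewrite -e.
apply: (members_coalition labelling_act complete_coalition_lead hr nj).
by rewrite -e (leader_top elim).
Qed.

(* A player who wants to enter a neighbouring coalition cannot be accepted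
   there, hence that coalition has an opponent. *)
Lemma no_wish (x y : 'I_n) : @adj I x y ->
  ~~ joined (labelling x) (labelling y) ->
  ~~ wants_to_join O guess x (activity_code (pi x)) (size x)
       (activity_code (pi y)) (size y).
Proof.
move=> xy; rewrite /joined !labelling_act => nj.
apply/negP => /and3P[]; case ey: (pi y) => [c|//] _ /=.
have [feas _ dev] := stable.
have cy : coalition pi y = players_at pi c by exact: coalition_some.
rewrite bit_guess ?ltn_Sdouble ?ltnS ?ltn_ord //.
rewrite /guess_bit /= odd_double /= uphalf_double => none.
case/andP=> s1 s2; apply: (dev x c); split.
- by apply: contra nj => /eqP ->; rewrite ey /= eqxx.
- by apply: connected_setU1 xy; rewrite -cy ?mem_coalition //; apply: feas.
- have := queriesE x (Some c) (size y).+1 (pi x) (size x).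
  have := queriesE x (pi x) (size x) (Some c) (size y).+1.
  rewrite /= s1 (negbTE s2) cy addn1 => /esym h1 /esym/and3P[h2 h3 h4].
  by rewrite /spref h4; move: h1; rewrite h2 h3 => /= ->.
(* A member that does not accept is a vetoer, so its coalition has an opponent and the veto bit
   would be set. *)
- move=> j hj; apply: contraNT none => nacc.
  have pj : pi j = Some c by move: hj; rewrite inE => /eqP.
  have cj := coalition_some pj.
  have vj : vetoes O j (activity_code (pi j)) (size j).
    have := queriesE j (Some c) (size j).+1 (Some c) (size j).
    rewrite /vetoes pj /= => ->; rewrite cj -addn1 (negbTE nacc).
    by rewrite !andbF.
  case E: [pick k in coalition pi j |
      vetoes O k (activity_code (pi k)) (size k)] => [k|]; move: (E); case: pickP => //.
    move=> k' /andP[hk _] [ek]; apply/existsP; exists k.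
    move: hk; rewrite ek cj inE => /eqP pk.
    by rewrite /opponent (coalition_some pk) -cj E pk !eqxx.
  by move/(_ j); rewrite mem_coalition vj.
Qed.

Lemma complete_compatible r : r < n ->
  compatible O guess ov ou r labelling (members ov ou labelling r (ov r)).
Proof.
move=> hr; have hv := ov_lt elim hr; pose v := Ordinal hv.
have lv : labelling (ov r) = (activity_code (pi v), size v, opponent v).
  exact: labelling_player v.
rewrite /compatible /=; case: ifP => [jr|/negbT nj].
  have [hu _] := ou_joins elim labelling_root hr jr.
  have lu := labelling_player (Ordinal hu); rewrite /= in lu.
  move: jr; rewrite /joined lu lv /csize /act /= => /andP[/eqP e nz].
  by rewrite (same_coalition e nz).
rewrite (complete_members (i := v) hr nj) // {1}lv eqxx /=.
have [_ _ [eu|[hu uv _]] _] := elim hr.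
  (* At the virtual vertex nothing can go wrong: its queries are answered negatively, and no one can
     wish to join the void activity. *)
  rewrite eu labelling_root; apply/andP; split; apply/negP => /and3P[] //.
  by move=> _ _ /andP[/queries_bound[]]; rewrite ltnn.
pose u := Ordinal hu; have lu : labelling (ou r) = (activity_code (pi u), size u, opponent u).
  exact: labelling_player u.
have a : @adj I v u by rewrite -nat_adjE.
have nj' : ~~ joined (labelling v) (labelling u) by [].
have nj'' : ~~ joined (labelling u) (labelling v).
  by move: nj'; rewrite /joined eq_sym; case: eqP => //= ->.
rewrite lu lv; apply/andP; split; last exact: no_wish a nj'.
by apply: no_wish nj''; rewrite adj_sym.
Qed.

Lemma complete_admissible (i : 'I_n) :
  admissible O p guess i (activity_code (pi i)) (size i).
Proof.
have [_ ir dev] := stable.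
have ai := coalition_alternative pi i.
apply/andP; split.
  have /= := queriesE i (pi i) (size i) None 1.
  by move=> ->; rewrite ai ir.
apply/hasPn => c; rewrite mem_iota /= => hc.
apply/negP => /andP[]; rewrite bit_guess ?ltn_double ?ltnS //.
rewrite /guess_bit odd_double doubleK double_eq0 /= => /existsPn none.
case/andP=> s1 s2; pose a := Ordinal hc.
have e0 : players_at pi a = set0.
  by apply/setP => j; rewrite !inE; apply/negP => /eqP h; have := none j; rewrite h eqxx.
apply: (dev i a); rewrite /feasible_IS_deviation e0 cards0 set0U; split.
- by have := none i; apply: contra => /eqP ->.
- by move=> x y /set1P -> /set1P ->.
- have := queriesE i (Some a) 1 (pi i) (size i).
  have := queriesE i (pi i) (size i) (Some a) 1.
  rewrite /= s1 (negbTE s2) => /esym h1 /esym/and3P[h2 h3 h4].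
  by rewrite /spref h4; move: h1; rewrite h2 h3 => /= ->.
- by move=> j; rewrite inE.
Qed.

Lemma complete_item i : i < p.+1.*2 -> item n ov ou labelling i = bit i guess.
Proof.
move=> hi; rewrite bit_guess // /item /guess_bit; case: ifP => [_|/negbT oi].
  rewrite /witnesses -sum_at_most_one; last first.
    move=> j k /andP[oj /eqP aj] /andP[ok /eqP ak].
    by apply: opponent_unique; rewrite ?aj.
  by apply: eq_bigr => j _; rewrite labelling_player.
case: eqP => //= i0.
have b0 : i./2 != 0 by lia.
(* Two tops with the same activity lie in one coalition and so have the same leader, but each top is
   its own leader. *)
rewrite /tops sum_at_most_one; last first.
  move=> r1 r2 /andP[n1 /eqP a1] /andP[n2 /eqP a2].
  apply/val_inj/(ov_inj elim (ltn_ord r1) (ltn_ord r2)).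
  rewrite -(leader_top elim (ltn_ord r1) n1) -(leader_top elim (ltn_ord r2) n2).
  pose v1 := Ordinal (ov_lt elim (ltn_ord r1)).
  pose v2 := Ordinal (ov_lt elim (ltn_ord r2)).
  apply: (@complete_coalition_lead v2 v1).
  rewrite (@same_coalition v2 v1) ?mem_coalition -?labelling_act /= ?a1 ?a2 //.
congr nat_of_bool; apply/existsP/existsP => [[r /andP[_ h]]|[j /eqP aj]].
  by exists (Ordinal (ov_lt elim (ltn_ord r))); rewrite -labelling_act.
have [r hr [nj e]] := leader_is_top elim labelling_root (ltn_ord j).
by exists (Ordinal hr); rewrite /= [X in ~~ X](negbTE nj) -e act_leader labelling_act aj eqxx.
Qed.

Lemma complete_solution : solution O n p guess ov ou labelling.
Proof.
split=> [|w hw|r hr|i hi].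
- exact: labelling_root.
- have -> : w = Ordinal hw by [].
  rewrite labelling_player; split; first exact: complete_admissible.
  exact: opponent_vetoes.
- exact: complete_compatible.
- exact: complete_item.
Qed.

Lemma guess_lt : guess < 2 ^ p.+1.*2.
Proof. exact: sum_pow2_lt. Qed.

End Completeness.

Lemma solution_iff_stable :
  (exists (pi : assignment I), individually_stable pi) <->
  exists2 G, G < 2 ^ p.+1.*2 & exists lam, solution O n p G ov ou lam.
Proof.
split=> [[pi st]|[G _ [lam sol]]]; last by exists (decoded lam); apply: sound_stable sol.
exists (guess pi); first exact: guess_lt.
by exists (labelling pi); apply: complete_solution.
Qed.

End Correspondence.

(** * The program *)

Definition eN := Read 0 (Const 0).
Definition eP := Read 0 (Const 1).
Definition eM := Read 3 (Const 0).

Definition eSucc e := Add e (Const 1).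

Fixpoint sequence (c : cmd) (cs : seq cmd) : cmd :=
  if cs is c' :: cs' then CSeq c (sequence c' cs') else c.

(* Arrays: 3 holds the bounds M = (n + m + p + 1) 4^(p + 1) and 2 (p + 1);
   4 the multiples of M; 6 the adjacency matrix; 7 marks [r; v] if v has two
   neighbours left at step r; 8 and 9 hold [ov] and [ou]; 10 marks eliminated
   vertices; 11 and 12 hold [iter i half N] and [bitcount i N] at [i; N];
   13 the weights of the activities; 15 the entries of [wants_unused]; 16 the
   table, indexed by [G; r; w; a; k; t; s; q]; 17 the answer.  Arrays from 20
   on are loop counters. *)
Definition set_bounds := sequence
  (CWrite 3 (Const 0) (eSucc (Add (Add eN eP) (Read 0 (Const 2)))))
  [:: CFor 20 0 1 (CWrite 3 (Const 0) (eQuad eM));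
      CWrite 3 (Const 0) (eQuad eM);
      CWrite 3 (Const 1) (Add (Add eP eP) (Const 2))].

(** Seven nested loops up to [M] run the body [M ^ 7] times; register [5.[0]] is the running index
    that the seven counters cannot supply without multiplication. *)
Definition set_multiples :=
  foldr (fun x c => CFor x 3 0 c)
    (CSeq (CWrite 4 (eSucc (eVar 5)) (Add (Read 4 (eVar 5)) eM))
          (CWrite 5 (Const 0) (eSucc (eVar 5))))
    (iota 20 7).

Definition set_edges (x y : nat) :=
  search [:: (20, 0, 2)] (Const 1) 6
    (eIdx [:: Read x (eVar 20); Read y (eVar 20)]) (Const 1).

Definition eAdjacent e1 e2 := Read 6 (eIdx [:: e1; e2]).

(** The marks are indexed by the round, so array 7 never has to be cleared. *)
Definition mark_crowded :=
  let v := eVar 20 in let x := eVar 21 in let y := eVar 22 in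
  search [:: (20, 0, 0); (21, 0, 0); (22, 0, 0)]
    (eAnd (eNot (Read 10 x)) (eAnd (eNot (Read 10 y))
      (eAnd (eAdjacent v x) (eAnd (eAdjacent v y) (eNot (eEq x y))))))
    7 (eIdx [:: eVar 32; v]) (Const 1).

Definition pick_leaf :=
  search [:: (20, 0, 0)]
    (eAnd (eNot (Read 10 (eVar 20)))
          (eNot (Read 7 (eIdx [:: eVar 32; eVar 20]))))
    8 (eVar 32) (eVar 20).

Definition pick_neighbour :=
  search [:: (20, 0, 0)]
    (eAnd (eNot (Read 10 (eVar 20))) (eAdjacent (Read 8 (eVar 32)) (eVar 20)))
    9 (eVar 32) (eVar 20).

(** The entry of array 9 is preset to [n], which survives as the virtual neighbour when the search
    finds none. *)
Definition set_order :=
  CFor 32 0 0 (sequence mark_crowded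
    [:: pick_leaf; CWrite 9 (eVar 32) eN; pick_neighbour;
        CWrite 10 (Read 8 (eVar 32)) (Const 1)]).

(** A shift by a variable amount is not an expression, so all iterated halves and bit counts are
    tabulated. *)
Definition set_bits :=
  let i := eVar 33 in let N := eVar 20 in
  CSeq (search [:: (20, 3, 0)] (Const 1) 11 (eIdx [:: Const 0; N]) N)
    (CFor 33 3 1 (CSeq
       (search [:: (20, 3, 0)] (Const 1) 12 (eIdx [:: eSucc i; N])
          (Add (Read 12 (eIdx [:: i; N])) (eOdd (Read 11 (eIdx [:: i; N])))))
       (search [:: (20, 3, 0)] (Const 1) 11 (eIdx [:: eSucc i; N])
          (Half (Read 11 (eIdx [:: i; N])))))).

Definition eBit i N := eOdd (Read 11 (eIdx [:: i; N])).

(** Register [14.[0]] runs through the powers of 4. Entry 0 of array 13 keeps its initial 0, the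
    weight of the void activity. *)
Definition set_weights :=
  CSeq (CWrite 14 (Const 0) (Const 1))
    (CFor 20 0 1 (CSeq (CWrite 14 (Const 0) (eQuad (eVar 14)))
                       (CWrite 13 (eSucc (eVar 20)) (eVar 14)))).

Definition eStrictly i a k b l := eAnd (Ask i a k b l) (eNot (Ask i b l a k)).

Definition set_wants_unused :=
  let G := eVar 20 in let i := eVar 21 in let a := eVar 22 in
  let k := eVar 23 in let c := eVar 24 in
  search [:: (20, 3, 0); (21, 0, 0); (22, 3, 0); (23, 3, 0); (24, 0, 1)]
    (eAnd (eNot (eBit (Add (eSucc c) (eSucc c)) G))
          (eStrictly i (eSucc c) (Const 1) a k))
    15 (eIdx [:: G; i; a; k]) (Const 1).

Definition eAdmissible G i a k :=
  eAnd (Ask i a k (Const 0) (Const 1)) (eNot (Read 15 (eIdx [:: G; i; a; k]))).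

Definition init_players :=
  let G := eVar 20 in let i := eVar 21 in let a := eVar 22 in
  let k := eVar 23 in
  search [:: (20, 3, 0); (21, 0, 0); (22, 3, 0); (23, 3, 0)]
    (eAdmissible G i a k)
    16 (eIdx [:: G; Const 0; i; a; k; Const 1; Const 0; Const 0]) (Const 1).

(** Doubling the weight [4 ^ a] of the activity gives the veto weight [2 ^ (2 a + 1)]. *)
Definition init_witnesses :=
  let G := eVar 20 in let i := eVar 21 in let a := eVar 22 in
  let k := eVar 23 in
  search [:: (20, 3, 0); (21, 0, 0); (22, 3, 0); (23, 3, 0)]
    (eAnd (eAdmissible G i a k) (eAnd a (eNot (Ask i a (eSucc k) a k))))
    16 (eIdx [:: G; Const 0; i; a; k; Const 1; Add (Read 13 a) (Read 13 a); Const 1])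
    (Const 1).

Definition init_root :=
  let G := eVar 20 in
  search [:: (20, 3, 0)] (Const 1)
    16 (eIdx [:: G; Const 0; eN; Const 0; Const 1; Const 1; Const 0; Const 0])
    (Const 1).

Definition eWants G i a k b l :=
  eAnd b (eAnd (eNot (eBit (eSucc (Add b b)) G)) (eStrictly i b (eSucc l) a k)).

(** The vertex index ranges up to [M], so that the virtual vertex [n] is included. *)
Definition copy_tables :=
  let G := eVar 20 in let w := eVar 21 in let a := eVar 22 in
  let k := eVar 23 in let t := eVar 24 in let s := eVar 25 in
  let q := eVar 26 in let r := eVar 32 in
  search [:: (20, 3, 0); (21, 3, 0); (22, 3, 0); (23, 3, 0); (24, 3, 0);
             (25, 3, 0); (26, 3, 0)]
    (eAnd (Read 16 (eIdx [:: G; r; w; a; k; t; s; q])) (eNot (eEq w (Read 9 r))))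
    16 (eIdx [:: G; eSucc r; w; a; k; t; s; q]) (Const 1).

Definition merge_same :=
  let G := eVar 20 in let a := eVar 22 in
  let k := eVar 23 in let t := eVar 24 in let s := eVar 25 in
  let q := eVar 26 in let t' := eVar 29 in let s' := eVar 30 in
  let q' := eVar 31 in let r := eVar 32 in
  search [:: (20, 3, 0); (22, 3, 0); (23, 3, 0); (24, 3, 0); (25, 3, 0);
             (26, 3, 0); (29, 3, 0); (30, 3, 0); (31, 3, 0)]
    (eAnd a (eAnd (Read 16 (eIdx [:: G; r; Read 9 r; a; k; t; s; q]))
                  (Read 16 (eIdx [:: G; r; Read 8 r; a; k; t'; s'; q']))))
    16 (eIdx [:: G; eSucc r; Read 9 r; a; k; Add t t'; Add s s'; Add q q'])
    (Const 1).

(** The coalition of [v] ends here, so its member count must equal its intended size: [l] fills both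
    positions. The doubled negation turns [b] into the 0 or 1 added to the item count. *)
Definition merge_other :=
  let G := eVar 20 in let a := eVar 22 in
  let k := eVar 23 in let t := eVar 24 in let s := eVar 25 in
  let q := eVar 26 in let b := eVar 27 in let l := eVar 28 in
  let s' := eVar 30 in let q' := eVar 31 in
  let r := eVar 32 in let v := Read 8 r in let u := Read 9 r in
  search [:: (20, 3, 0); (22, 3, 0); (23, 3, 0); (24, 3, 0); (25, 3, 0);
             (26, 3, 0); (27, 3, 0); (28, 3, 0); (30, 3, 0); (31, 3, 0)]
    (eAnd (Read 16 (eIdx [:: G; r; u; a; k; t; s; q]))
      (eAnd (Read 16 (eIdx [:: G; r; v; b; l; l; s'; q']))
        (eAnd (eNot (eAnd (eEq b a) a))
          (eAnd (eNot (eWants G u a k b l)) (eNot (eWants G v b l a k))))))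
    16 (eIdx [:: G; eSucc r; u; a; k; t; Add s (Add s' (Read 13 b));
                 Add q (Add q' (eNot (eNot b)))]) (Const 1).

Definition set_answer :=
  search [:: (20, 3, 0)]
    (Read 16 (eIdx [:: eVar 20; eN; eN; Const 0; Const 1; Const 1; eVar 20;
                       Read 12 (eIdx [:: Read 3 (Const 1); eVar 20])]))
    17 (Const 0) (Const 1).

Definition solve := sequence set_multiples
  [:: set_edges 1 2; set_edges 2 1; set_order; set_bits; set_weights;
      set_wants_unused; init_players; init_witnesses; init_root;
      CFor 32 0 0 (sequence copy_tables [:: merge_same; merge_other]);
      set_answer].

(** Separate from [solve], which takes loop bounds from array 0 and so must not write there;
    [set_bounds] is separate for the same reason with array 3. *)
Definition print_answer := CWrite 0 (Const 0) (Read 17 (Const 0)).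

Lemma set_bounds_ok : bounded_by [:: 0] set_bounds.
Proof. by []. Qed.

Lemma solve_ok : bounded_by [:: 0; 3] solve.
Proof. by []. Qed.

(** * Correctness of the program *)

Definition evalE := (eval_and, eval_not, eval_eq, eval_odd, eval_quad, eval_var).

Lemma run_seq O c1 c2 m : run O (CSeq c1 c2) m = run O c2 (run O c1 m).
Proof. by []. Qed.

Definition ready n p e M (m : memory) :=
  [/\ m 0 0 = n, m 0 1 = p, m 0 2 = e, m 3 0 = M &
      m 3 1 = p.+1.*2 /\ forall i, i <= M ^ 7 -> m 4 i = i * M].

Lemma ready_run O n p e M c m :
  all (fun y => y \notin writes c) [:: 0; 3; 4] ->
  ready n p e M m -> ready n p e M (run O c m).
Proof.
move=> /and4P[h0 h3 h4 _] [r0 r1 r2 r3 [r4 r5]].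
by split; rewrite ?run_frame //; split=> [|i hi]; rewrite ?run_frame ?r5.
Qed.

Lemma ready_frame n p e M m m' :
  (forall y j, y < 5 -> m' y j = m y j) -> ready n p e M m -> ready n p e M m'.
Proof.
move=> fr [r0 r1 r2 r3 [r4 r5]].
by split; rewrite ?fr //; split=> [|i hi]; rewrite ?fr ?r5.
Qed.

Lemma set_bounds_spec O n p e m :
  m 0 0 = n -> m 0 1 = p -> m 0 2 = e ->
  let m' := run O set_bounds m in
  [/\ m' 3 0 = (n + p + e).+1 * 2 ^ p.+1.*2, m' 3 1 = p.+1.*2 &
    forall j, 1 < j -> m' 3 j = m 3 j].
Proof.
move=> h0 h1 h2 m'; set M0 := (n + p + e).+1.
set m0 := run O (CWrite 3 (Const 0)
  (eSucc (Add (Add eN eP) (Read 0 (Const 2))))) m.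
set F := CFor 20 0 1 (CWrite 3 (Const 0) (eQuad eM)).
have -> : m' = run O (CSeq (CWrite 3 (Const 0) (eQuad eM))
  (CWrite 3 (Const 1) (Add (Add eP eP) (Const 2)))) (run O F m0) by [].
have e0 : m0 3 0 = M0 by rewrite /m0 /= write_same h0 h1 h2 /M0; lia.
have pow4 k : 4 * 2 ^ k.*2 = 2 ^ k.+1.*2 by rewrite doubleS !expnS mulnA.
have f2 j : run O F m0 0 j = m0 0 j by rewrite run_frame.
have [f1 f3] : run O F m0 3 0 = M0 * 2 ^ p.*2 /\
    forall j, 1 < j -> run O F m0 3 j = m 3 j.
  have -> : p = m0 0 1 by rewrite /m0 /= write_other.
  apply: (@run_for O 20 0 1 (CWrite 3 (Const 0) (eQuad eM)) m0
    (fun j m1 => m1 3 0 = M0 * 2 ^ j.*2 /\ forall j, 1 < j -> m1 3 j = m 3 j)) => //.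
    by rewrite !write_other // e0 muln1; split=> // -[|[|j]].
  move=> j m1 _ _ [h h']; rewrite write_other //= write_same eval_quad /= h.
  by rewrite mulnCA pow4; split=> // -[|[|i]] // /h'.
move: f1 f2 f3; set m2 := run O F m0 => f1 f2 f3.
rewrite /= /write /= !f2 eval_quad /= f1 /m0 /= !write_other // h1.
by split; [rewrite mulnCA pow4 | lia | move=> [|[|j]] // /f3].
Qed.

Lemma set_multiples_spec O M m :
  m 3 0 = M -> m 4 0 = 0 -> m 5 0 = 0 ->
  forall i, i <= M ^ 7 -> run O set_multiples m 4 i = i * M.
Proof.
move=> h3 h4 h5; rewrite /set_multiples; set body := CSeq _ _.
pose P k (m1 : memory) :=
  [/\ m1 3 0 = M, m1 5 0 = k & forall i, i <= k -> m1 4 i = i * M].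
have Pw k m1 x v : 19 < x -> P k m1 -> P k (write m1 x 0 v).
  move=> hx [p1 p2 p3].
  have wo y j : y < 6 -> write m1 x 0 v y j = m1 y j.
    by move=> hy; rewrite write_other // ltn_eqF // (leq_trans hy) // (leq_trans _ hx).
  by split; rewrite ?wo // => i hi; rewrite wo ?p3.
have step k m1 : P k m1 -> P k.+1 (run O body m1).
  case=> p1 p2 p3; rewrite /body /= !eval_var p2 write_other // p1 p2 !addn1.
  split; rewrite ?write_same //.
  move=> i hi; rewrite write_other // /write /=.
  case: eqP => [->|ne]; first by rewrite p3 // mulSn addnC.
  by rewrite p3 //; lia.
(* A nest of [j] loops advances the running index by [M ^ j]. *)
suff main x j : 20 <= x -> forall k m1, P k m1 ->
    P (k + M ^ j) (run O (foldr (fun x c => CFor x 3 0 c) body (iota x j)) m1).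
  have [|_ _ h] := main 20 7 isT 0 m; last exact: h.
  by split=> // i; rewrite leqn0 => /eqP ->.
have P3 k m1 : P k m1 -> m1 3 0 = M by case.
elim: j x => [|j IH] x hx k m1 Pm; first by rewrite expn0 addn1; apply: step.
rewrite [foldr _ _ _]/=; set c := foldr _ _ _.
rewrite expnS -[X in k + X * _](P3 _ _ Pm).
apply: (@run_for O x 3 0 c m1 (fun i m2 => P (k + i * M ^ j) m2)).
- suff h y : x < y -> x \notin writes (foldr (fun x c => CFor x 3 0 c) body (iota y j)).
    exact: h.
  elim: j y {IH c} => [|j IHj] y hy /=.
    by rewrite !inE; apply/norP; split; apply/eqP => e; rewrite e in hx.
  by rewrite inE negb_or IHj ?(leqW hy) // andbT neq_ltn hy.
- by rewrite mul0n addn0; apply: Pw.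
- by move=> i m2 _ _ Pm2; apply: Pw => //; rewrite mulSnr addnA; apply: IH => //; lia.
Qed.

Lemma set_edges_spec O n p e M m x y : x < 3 -> y < 3 -> 0 < M -> ready n p e M m ->
  (forall i, i < e -> m x i < M /\ m y i < M) ->
  forall j, run O (set_edges x y) m 6 j != 0 <->
    (m 6 j != 0 \/ exists2 i, i < e & encode M [:: m x i; m y i] = j).
Proof.
move=> hx hy M0 rd hm j; have [_ _ h2 _ [_ h4]] := rd.
rewrite /set_edges; apply: (iff_trans (@run_search_flag O _ _ _ _ m (fun=> true)
  (fun vs => if vs is [:: i] then encode M [:: m x i; m y i] else 0) _ _ j)) => //.
- move=> m' [|i [|//]] //; rewrite /in_range /= h2 andbT => hi [ei] fr _.
  have fx z : z < 5 -> forall k, m' z k = m z k.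
    by move: z => [|[|[|[|[|]]]]] // _ k; apply: fr.
  have [mx my] := hm _ hi.
  split=> // _; rewrite (@eval_idx _ _ M) //= ?eval_var ?ei.
  + by rewrite !fx // ltnW // ltnW.
  + by move=> k hk; rewrite fx // h4.
  + by rewrite !fx ?mx ?my // ltnW // ltnW.
- apply: or_iff_compat_l; split=> [[us [+ _ <-]]|[i hi <-]].
    case: us => [|i [|k us]] //; rewrite /in_range /= ?h2 ?andbT ?andbF // => hi.
    by exists i.
  by exists [:: i]; rewrite /in_range /= h2 hi.
Qed.

(** * Correctness of the computed elimination order *)

Section Order.

Variables (O : oracle) (n p e M : nat) (adj : rel nat).
Hypothesis nM : n < M.

Lemma eval_idx_ready m es : ready n p e M m ->
  all (fun e => eval O m e < M) es -> size es <= 8 ->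
  eval O m (eIdx es) = encode M [seq eval O m e | e <- es].
Proof.
move=> [_ _ _ _ [_ h]] al hs; rewrite (@eval_idx _ _ M) //.
by apply: leq_ltn_trans nM.
Qed.

Definition adjacency (m : memory) :=
  forall u v, u < n -> v < n -> (m 6 (encode M [:: u; v]) != 0) = adj u v.

Lemma eval_adjacent m e1 e2 : ready n p e M m -> adjacency m ->
  eval O m e1 < n -> eval O m e2 < n ->
  (eval O m (eAdjacent e1 e2) != 0) = adj (eval O m e1) (eval O m e2).
Proof.
move=> rd am h1 h2; rewrite /eAdjacent /= eval_idx_ready //= ?am //.
by rewrite !(ltn_trans _ nM).
Qed.

Lemma mark_crowded_spec m r : ready n p e M m -> adjacency m ->
  m 32 0 = r -> r < n ->
  forall j, run O mark_crowded m 7 j != 0 <->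
    (m 7 j != 0 \/ exists v x y,
      [/\ v < n, x < n, y < n, [&& m 10 x == 0, m 10 y == 0, adj v x, adj v y & x != y]
        & encode M [:: r; v] = j]).
Proof.
move=> rd am er hr j; have [h0 _ _ _ _] := rd.
rewrite /mark_crowded; apply: (iff_trans (@run_search_flag O _ _ _ _ m
  (fun vs => if vs is [:: v; x; y] then
     [&& m 10 x == 0, m 10 y == 0, adj v x, adj v y & x != y] else false)
  (fun vs => encode M [:: r; head 0 vs]) _ _ j)) => //.
- move=> m' [|v [|x [|y [|//]]]] //; rewrite /in_range /= h0.
  case/and4P=> hv hx hy _ [e1 e2 e3] fr _.
  have rd' : ready n p e M m'.
    by apply: ready_frame rd => -[|[|[|[|[|]]]]] // k _; apply: fr.
  have am' : adjacency m' by move=> u w hu hw; rewrite fr ?am.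
  rewrite !evalE !eval_adjacent //= ?evalE ?e1 ?e2 ?e3 // !fr // !negbK.
  split=> // _; rewrite eval_idx_ready //= !evalE ?e1 ?fr ?er //.
  by rewrite !(ltn_trans _ nM).
- apply: or_iff_compat_l; split=> [[us [+ + <-]]|[v [x [y [hv hx hy hc <-]]]]].
    case: us => [|v [|x [|y [|]]]] //; rewrite /in_range /= h0.
    by case/and4P=> hv hx hy _ hc; exists v, x, y.
  by exists [:: v; x; y]; rewrite /in_range /= h0 hv hx hy.
Qed.

Lemma pick_leaf_spec m r : ready n p e M m -> m 32 0 = r -> r < n ->
  (exists v, [/\ v < n, m 10 v = 0 & m 7 (encode M [:: r; v]) = 0]) ->
  let m' := run O pick_leaf m in
  (forall j, j != r -> m' 8 j = m 8 j) /\
  [/\ m' 8 r < n, m 10 (m' 8 r) = 0 & m 7 (encode M [:: r; m' 8 r]) = 0].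
Proof.
move=> rd er hr [v0 [hv0 dv0 bv0]]; have [h0 _ _ _ _] := rd.
move=> m'; pose C v := (m 10 v == 0) && (m 7 (encode M [:: r; v]) == 0).
have spec : forall j,
    (exists us, [/\ in_range m [:: (20, 0, 0)] us, C (head 0 us), r = j &
                    m' 8 j = head 0 us]) \/
    ((forall us, in_range m [:: (20, 0, 0)] us -> C (head 0 us) -> r <> j) /\
     m' 8 j = m 8 j).
  apply: run_search => // w [|v [|//]] //; rewrite /in_range /= h0 andbT.
  move=> hv [e1] fr _.
  have rd' : ready n p e M w.
    by apply: ready_frame rd => -[|[|[|[|[|]]]]] // k _; apply: fr.
  rewrite !evalE /= eval_idx_ready //= ?evalE ?e1 ?fr ?er // ?negbK //.
  by rewrite !(ltn_trans _ nM).
split=> [j /eqP nj|].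
  by case: (spec j) => [[us [_ _ e1 _]]|[_ ->]] //; case: nj.
case: (spec r) => [[us [+ + _ ->]]|[h _]].
  case: us => [|v [|x us]] //; rewrite /in_range /= ?h0 ?andbT ?andbF //.
  by move=> hv /andP[/eqP ? /eqP ?].
have := h [:: v0]; rewrite /in_range /= h0 hv0 /C dv0 bv0 => /(_ isT isT).
by case.
Qed.

Lemma pick_neighbour_spec m r : ready n p e M m -> adjacency m ->
  m 32 0 = r -> r < n -> m 8 r < n ->
  let m' := run O pick_neighbour m in
  let C x := (m 10 x == 0) && adj (m 8 r) x in
  (forall j, j != r -> m' 9 j = m 9 j) /\
  ((m' 9 r < n /\ C (m' 9 r)) \/
   ((forall x, x < n -> ~~ C x) /\ m' 9 r = m 9 r)).
Proof.
move=> rd am er hr hv m' C; have [h0 _ _ _ _] := rd.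
have spec : forall j,
    (exists us, [/\ in_range m [:: (20, 0, 0)] us, C (head 0 us), r = j &
                    m' 9 j = head 0 us]) \/
    ((forall us, in_range m [:: (20, 0, 0)] us -> C (head 0 us) -> r <> j) /\
     m' 9 j = m 9 j).
  apply: run_search => // w [|x [|//]] //; rewrite /in_range /= h0 andbT.
  move=> hx [e1] fr _.
  have rd' : ready n p e M w.
    by apply: ready_frame rd => -[|[|[|[|[|]]]]] // k _; apply: fr.
  have am' : adjacency w by move=> u v hu hw; rewrite fr ?am.
  rewrite !evalE eval_adjacent //= ?evalE ?e1 ?fr // ?er // ?fr //.
  by rewrite negbK.
split=> [j /eqP nj|].
  by case: (spec j) => [[us [_ _ e1 _]]|[_ ->]] //; case: nj.
case: (spec r) => [[us [+ + _ ->]]|[h ->]].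
  case: us => [|x [|y us]] //; rewrite /in_range /= ?h0 ?andbT ?andbF //.
  by left.
right; split=> // x hx; apply/negP => cx.
by case: (h [:: x]) => //; rewrite /in_range /= h0 hx.
Qed.

Hypothesis adj_irrefl : forall x, x < n -> ~~ adj x x.

Hypothesis leaf : forall (ov : nat -> nat) r,
  r < n -> exists v, [/\ v < n, alive ov r v & forall x y, x < n -> y < n ->
    alive ov r x -> alive ov r y -> adj v x -> adj v y -> x = y].

Lemma alive_ext ov ov' r w :
  (forall r', r' < r -> ov r' = ov' r') -> alive ov r w = alive ov' r w.
Proof.
by move=> h; apply: eq_in_all => r'; rewrite mem_iota /= => /h ->.
Qed.

Lemma elimination_step_ext ov ov' ou ou' r :
  (forall r', r' <= r -> ov r' = ov' r') -> ou r = ou' r ->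
  elimination_step n adj ov ou r -> elimination_step n adj ov' ou' r.
Proof.
move=> h hu [h1 h2 h3 h4]; rewrite /elimination_step -hu -h //; split=> //.
- by move=> r' hr'; rewrite -h ?h2 1?ltnW //; apply: h2.
- case: h3 => [->|[h5 h6 h7]]; [by left | right].
  by split=> // r' hr'; rewrite -h //; apply: h7.
- by move=> x hx hr; apply: h4 => // r' hr'; rewrite h //; apply: hr.
Qed.

(** The third clause, that the rows of array 7 for this and later rounds are blank, makes the marks
    of the current round exact. *)
Definition order_invariant m r (m1 : memory) :=
  [/\ forall y j, y < 7 -> m1 y j = m y j,
      forall v, v < n -> (m1 10 v == 0) = alive (m1 8) r v,
      forall r' v, r <= r' < n -> v < n -> m1 7 (encode M [:: r'; v]) = 0
    & forall r', r' < r -> elimination_step n adj (m1 8) (m1 9) r'].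

Lemma set_order_step m r m1 : ready n p e M m -> adjacency m ->
  r < n -> m1 32 0 = r -> order_invariant m r m1 ->
  order_invariant m r.+1 (run O (sequence mark_crowded
    [:: pick_leaf; CWrite 9 (eVar 32) eN; pick_neighbour;
        CWrite 10 (Read 8 (eVar 32)) (Const 1)]) m1).
Proof.
move=> rd am hr er [fr dead fresh steps].
have rd1 : ready n p e M m1.
  by apply: ready_frame rd => y j hy; rewrite fr // (leq_trans hy).
have am1 : adjacency m1 by move=> u v hu hv; rewrite fr ?am.
pose m2 := run O mark_crowded m1; pose m3 := run O pick_leaf m2.
pose m4 := write m3 9 r n; pose m5 := run O pick_neighbour m4.
have F2 y j : y \notin writes mark_crowded -> m2 y j = m1 y j.
  exact: run_frame.
have F3 y j : y \notin writes pick_leaf -> m3 y j = m2 y j.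
  exact: run_frame.
have F5 y j : y \notin writes pick_neighbour -> m5 y j = m4 y j.
  exact: run_frame.
have rd2 : ready n p e M m2 by apply: ready_run.
have rd3 : ready n p e M m3 by apply: ready_run.
have rd4 : ready n p e M m4.
  by apply: ready_frame rd3 => y j hy; rewrite /m4 write_other // ltn_eqF // (leq_trans hy).
have r2 : m2 32 0 = r by rewrite F2.
have r3 : m3 32 0 = r by rewrite F3.
have r4 : m4 32 0 = r by rewrite /m4 write_other.
have r5 : m5 32 0 = r by rewrite F5.
have -> : run O (sequence mark_crowded
    [:: pick_leaf; CWrite 9 (eVar 32) eN; pick_neighbour;
        CWrite 10 (Read 8 (eVar 32)) (Const 1)]) m1 = write m5 10 (m5 8 r) 1.
  have [n3 _ _ _ _] := rd3.
  have e4 : m4 = write m3 9 (eval O m3 (eVar 32)) (m3 0 0) by rewrite eval_var r3 n3.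
  have -> : m5 8 r = m5 8 (eval O m5 (eVar 32)) by rewrite eval_var r5.
  by rewrite /m5 e4.
have C2 := mark_crowded_spec rd1 am1 er hr.
have [|E3 [v3 d3 c3]] := pick_leaf_spec rd2 r2 hr.
  (* The forest guarantees a vertex left unmarked, so the search for a leaf succeeds. *)
  have [v [hv av lv]] := leaf (m1 8) hr.
  exists v; split=> //; first by apply/eqP; rewrite F2 // dead.
  apply/eqP/negP => /negP /C2 [|[v' [x [y [hv' hx hy hc ec]]]]].
    by rewrite fresh ?leqnn.
  have [ev] : [:: r; v'] = [:: r; v].
    by apply: encode_inj ec; rewrite //= !(ltn_trans _ nM).
  rewrite ev !dead // in lv hc.
  by case/and5P: hc => ax ay vx vy /eqP; apply; apply: lv.
rewrite -/m3 in E3 v3 d3 c3.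
have E4 j : j != r -> m4 9 j = m1 9 j.
  move=> nj; rewrite /m4 /write /= (negbTE nj) F3 // F2 //.
have E4' y j : y != 9 -> m4 y j = m3 y j by move=> hy; rewrite /m4 write_other.
have am4 : adjacency m4 by move=> u v hu hv; rewrite E4' // F3 // F2 // am1.
have v4 : m4 8 r < n by rewrite E4'.
have [E5 nb] := pick_neighbour_spec rd4 am4 r4 hr v4.
rewrite -/m5 in E5 nb.
have m58 j : m5 8 j = m3 8 j by rewrite F5 // E4'.
have m510 j : m5 10 j = m1 10 j by rewrite F5 // E4' // F3 // F2.
have ov_old r' : r' < r -> m5 8 r' = m1 8 r'.
  by move=> hr'; rewrite m58 E3 ?F2 // ltn_eqF.
have w8 m' y j i v : y != 10 -> write m' 10 i v y j = m' y j.
  exact: write_other.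
have d1 : alive (m1 8) r (m5 8 r) by rewrite m58 -dead // -F2 // d3.
(* The chosen vertex is unmarked, which means that it has at most one remaining neighbour. *)
have c1 x y : x < n -> y < n -> alive (m1 8) r x -> alive (m1 8) r y ->
    adj (m5 8 r) x -> adj (m5 8 r) y -> x = y.
  move=> hx hy ax ay vx vy; apply/eqP/negPn/negP => nxy.
  have /eqP[] : m2 7 (encode M [:: r; m3 8 r]) != 0; last exact: c3.
  apply/C2; right; exists (m3 8 r), x, y; split=> //.
  by rewrite !dead // ax ay -m58 vx vy.
split.
- move=> y j hy; rewrite w8 ?ltn_eqF ?(leq_trans hy) //.
  by move: y hy => [|[|[|[|[|[|[|]]]]]]] // _; rewrite F5 // E4' // F3 // F2 // fr.
- move=> v hv; rewrite aliveS (@alive_ext _ (m1 8)) => [|r' hr']; last first.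
    by rewrite w8 // ov_old.
  rewrite (w8 _ 8) // andbC /write /= [m5 8 r == v]eq_sym.
  by case: (v == m5 8 r) => //=; rewrite m510 dead.
- move=> r' v /andP[h1 h2] hv; rewrite w8 // F5 // E4' // F3 //.
  apply/eqP/negP => /negP /C2 [|[v' [x [y [hv' hx hy hc ec]]]]].
    by rewrite fresh ?(ltnW h1).
  have [er' _] : [:: r; v'] = [:: r'; v].
    by apply: encode_inj ec; rewrite //= !(ltn_trans _ nM).
  by rewrite er' ltnn in h1.
move=> r'; rewrite ltnS leq_eqVlt => /orP[/eqP ->|hr']; last first.
  apply: elimination_step_ext (steps r' hr').
    by move=> r'' hr''; rewrite w8 // ov_old // (leq_ltn_trans hr'').
  by rewrite w8 // E5 ?E4 // ltn_eqF.
have Cx x : x < n -> (m4 10 x == 0) && adj (m4 8 r) x =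
    alive (m1 8) r x && adj (m5 8 r) x.
  by move=> hx; rewrite !E4' // m58 F3 // F2 // dead.
have a8 x : alive (m1 8) r x <-> forall r6, r6 < r -> m5 8 r6 <> x.
  split=> [/aliveP h r6 hr6|h]; first by rewrite ov_old //; apply: h.
  by apply/aliveP => r6 hr6; rewrite -ov_old //; apply: h.
apply: (elimination_step_ext (ov := m5 8) (ou := m5 9)) => [r7 _||].
- by rewrite w8.
- by rewrite w8.
split; first by rewrite m58.
- exact/a8.
- case: nb => [[hu]|[_ ->]]; last by left; rewrite /m4 write_same.
  rewrite Cx // => /andP[/a8 au vu]; right; split=> // r7.
  rewrite leq_eqVlt => /orP[/eqP -> evu|]; last exact: au.
  by move: vu; rewrite evu (negbTE (adj_irrefl hu)).
move=> x hx ax vx; have ax' : alive (m1 8) r x.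
  by apply/a8 => r7 hr7; apply: ax; rewrite ltnW.
case: nb => [[hu]|[none _]]; last by have := none x hx; rewrite Cx // ax' vx.
by rewrite Cx // => /andP[au vu]; apply: c1.
Qed.

Lemma set_order_spec m : ready n p e M m -> adjacency m ->
  (forall j, m 7 j = 0) -> (forall j, m 10 j = 0) ->
  let m' := run O set_order m in elimination_order n adj (m' 8) (m' 9).
Proof.
move=> rd am z7 z10 m'; have [n0 _ _ _ _] := rd.
suff [_ _ _ h] : order_invariant m n m' by [].
rewrite -n0; apply: (@run_for O 32 0 0 _ m (order_invariant m)) => //.
  split=> // [y j hy|v hv|r' v _ _].
  - by rewrite write_other // ltn_eqF // (leq_trans hy).
  - by rewrite write_other // z10.
  - by rewrite write_other.
move=> r m1 hr er inv; rewrite n0 in hr.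
have [h1 h2 h3 h4] := set_order_step rd am hr er inv.
by split=> // y j hy; rewrite write_other ?h1 // ltn_eqF // (leq_trans hy).
Qed.

End Order.

(** * Searches that fill arrays indexed by tuples *)

Section Arrays.

Variables (O : oracle) (n p e M : nat).
Hypothesis nM : n < M.

Definition below := all (fun x => x < M).

(** Injectivity of [encode] lets cells be named by their index lists. The condition on cells that
    are no target allows a search to read the array it writes, as the merges do. *)
Lemma search_array xs cond X es m (C : seq nat -> bool) (F : seq nat -> seq nat) :
  ready n p e M m -> search_ok xs X ->
  all (fun y => y \notin X :: registers xs) [:: 0; 3; 4] -> size es <= 8 ->
  (forall vs, in_range m xs vs -> C vs -> size (F vs) = size es /\ below (F vs)) ->
  (forall m' vs, in_range m xs vs -> [seq m' c 0 | c <- registers xs] = vs ->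
     ready n p e M m' -> (forall y j, y \notin X :: registers xs -> m' y j = m y j) ->
     (forall js, size js = size es -> below js ->
        (forall us, in_range m xs us -> C us -> F us <> js) ->
        m' X (encode M js) = m X (encode M js)) ->
     (eval O m' cond != 0) = C vs /\
     (C vs -> [seq eval O m' e | e <- es] = F vs)) ->
  forall js, size js = size es -> below js ->
  run O (search xs cond X (eIdx es) (Const 1)) m X (encode M js) != 0 <->
    (m X (encode M js) != 0 \/ exists us, [/\ in_range m xs us, C us & F us = js]).
Proof.
move=> rd ok /and4P[f0 f3 f4 _] hs hF H js hjs bjs.
apply: (iff_trans (@run_search_flag O _ _ _ _ m C (fun vs => encode M (F vs)) ok _ _)).
  move=> m' vs hr er fr fX.
  have rd' : ready n p e M m'.
    have [r0 r1 r2 r3 [r4 r5]] := rd.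
    by split; rewrite ?fr //; split=> [|i hi]; rewrite ?fr ?r5.
  have [|h1 h2] := H m' vs hr er rd' fr.
    move=> ks hks bks nk; apply: fX => us hus cus eus; apply: (nk us hus cus).
    by have [h3 h4] := hF us hus cus; apply: encode_inj eus; rewrite // h3.
  split=> // /[dup] cvs /h2 e2; rewrite (eval_idx_ready nM rd') ?e2 //.
  have [_ b] := hF vs hr cvs.
  by move: b; rewrite -e2 /below all_map.
apply: or_iff_compat_l; split=> [[us [h1 h2 h3]]|[us [h1 h2 <-]]]; exists us => //.
split=> //; have [h4 h5] := hF us h1 h2.
by apply: encode_inj h3; rewrite // h4.
Qed.

Lemma search_row X e1 val m i (V : nat -> nat) :
  ready n p e M m -> search_ok [:: (20, 3, 0)] X -> 4 < X -> i < M ->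
  (forall m' N, N < M -> m' 20 0 = N -> ready n p e M m' ->
     (forall y j, y \notin [:: X; 20] -> m' y j = m y j) ->
     (forall i' N', i' < M -> N' < M -> i' <> i ->
        m' X (encode M [:: i'; N']) = m X (encode M [:: i'; N'])) ->
     eval O m' e1 = i /\ eval O m' val = V N) ->
  let m1 := run O (search [:: (20, 3, 0)] (Const 1) X (eIdx [:: e1; eVar 20]) val) m in
  (forall N, N < M -> m1 X (encode M [:: i; N]) = V N) /\
  (forall i' N, i' < M -> N < M -> i' <> i ->
     m1 X (encode M [:: i'; N]) = m X (encode M [:: i'; N])).
Proof.
move=> rd ok hX hi H m1; have [_ _ _ h3 _] := rd.
have spec : forall j,
    (exists us, [/\ in_range m [:: (20, 3, 0)] us, true,
                    encode M [:: i; head 0 us] = j & m1 X j = V (head 0 us)]) \/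
    ((forall us, in_range m [:: (20, 3, 0)] us -> true ->
        encode M [:: i; head 0 us] <> j) /\ m1 X j = m X j).
  apply: run_search => // m' [|N [|//]] //; rewrite /in_range /= h3 andbT.
  move=> hN [eN] fr fX; split=> // _.
  have rd' : ready n p e M m'.
    apply: ready_frame rd => y k hy; apply: fr; rewrite !inE.
    by rewrite ltn_eqF ?(leq_trans hy) // ltn_eqF ?(leq_trans hy).
  have [|h1 h2] := H m' N hN eN rd' fr.
    move=> i' N' hi' hN' ne; apply: fX => us hus _ eu; apply: ne.
    have [//] : [:: i; head 0 us] = [:: i'; N'].
      case: us hus eu => [|u [|? ?]]; rewrite /= ?h3 ?andbF // andbT => hu eu.
      by apply: encode_inj eu; rewrite //= ?hi ?hu ?hi' ?hN'.
  by rewrite (eval_idx_ready nM rd') //= !evalE h1 eN ?hi ?hN.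
split=> [N hN|i' N hi' hN ne].
  case: (spec (encode M [:: i; N])) => [[us [hr _ eu ->]]|[h _]]; last first.
    by case: (h [:: N]) => //; rewrite /in_range /= h3 hN.
  case: us hr eu => [|u [|? ?]]; rewrite /in_range /= ?h3 ?andbF // andbT => hu eu.
  have [->//] : [:: i; u] = [:: i; N].
  by apply: encode_inj eu; rewrite //= ?hi ?hu ?hN.
case: (spec (encode M [:: i'; N])) => [[us [hr _ eu _]]|[_ ->]] //.
case: ne; case: us hr eu => [|u [|? ?]]; rewrite /in_range /= ?h3 ?andbF // andbT => hu eu.
have [//] : [:: i; u] = [:: i'; N].
by apply: encode_inj eu; rewrite //= ?hi ?hu ?hi' ?hN.
Qed.

Lemma set_bits_spec m : ready n p e M m -> p.+1.*2 < M -> (forall j, m 12 j = 0) ->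
  let m1 := run O set_bits m in
  forall i N, i <= p.+1.*2 -> N < M ->
  m1 11 (encode M [:: i; N]) = iter i half N /\
  m1 12 (encode M [:: i; N]) = bitcount i N.
Proof.
move=> rd kM z12; rewrite /set_bits; cbv zeta; rewrite run_seq.
set m0 := run O (search _ _ _ _ _) m; set body := CSeq _ _.
have M0 : 0 < M by apply: leq_ltn_trans kM.
have rd0 : ready n p e M m0 by apply: ready_run.
have [_ _ _ h3 [hK _]] := rd0.
pose P k m1 := [/\ ready n p e M m1 &
  forall i N, i <= k -> N < M -> m1 11 (encode M [:: i; N]) = iter i half N /\
    m1 12 (encode M [:: i; N]) = bitcount i N].
suff [] : P p.+1.*2 (run O (CFor 33 3 1 body) m0) by [].
rewrite -hK; apply: (run_for (P := P)) => //.
  split=> [|i N].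
    by apply: ready_frame rd0 => y j hy; rewrite write_other // ltn_eqF // (leq_trans hy).
  rewrite leqn0 => /eqP -> hN; rewrite !write_other //.
  have [|h0 _] := @search_row 11 (Const 0) (eVar 20) m 0 id rd isT isT M0.
    by move=> m' N' _ eN _ _ _; rewrite evalE.
  by rewrite /m0 h0 // run_frame // z12 /bitcount big_ord0.
move=> k m1 hk ek [rd1 inv]; rewrite hK in hk.
rewrite /body run_seq; set m2 := run O (search _ _ 12 _ _) m1.
set m3 := run O _ m2.
have rd2 : ready n p e M m2 by apply: ready_run.
have rd3 : ready n p e M m3 by apply: ready_run.
have kM' : k.+1 < M by apply: leq_ltn_trans kM.
have rk m' : m' 33 0 = k -> eval O m' (eSucc (eVar 33)) = k.+1.
  by move=> h; rewrite /= evalE h addn1.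
have nk : k <> k.+1 by lia.
have [|e12 f12] := @search_row 12 (eSucc (eVar 33))
  (Add (Read 12 (eIdx [:: eVar 33; eVar 20])) (eOdd (Read 11 (eIdx [:: eVar 33; eVar 20]))))
  m1 k.+1 (bitcount k.+1) rd1 isT isT kM'.
  move=> m' N hN eN rd' fr fX; have k' : m' 33 0 = k by rewrite fr.
  split; first exact: rk.
  have [i1 i2] := inv k N (leqnn k) hN.
  rewrite /= evalE /= (eval_idx_ready nM rd') //= !evalE ?eN ?k' ?hN ?(ltnW kM') //.
  by rewrite fX ?(ltnW kM') // fr // i1 i2 [RHS]/bitcount big_ord_recr.
have [|e11 f11] := @search_row 11 (eSucc (eVar 33))
  (Half (Read 11 (eIdx [:: eVar 33; eVar 20])))
  m2 k.+1 (iter k.+1 half) rd2 isT isT kM'.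
  move=> m' N hN eN rd' fr fX; have k' : m' 33 0 = k by rewrite fr // [m2 33 _]run_frame.
  split; first exact: rk.
  have [i1 i2] := inv k N (leqnn k) hN.
  rewrite /= (eval_idx_ready nM rd') //= !evalE ?eN ?k' ?hN ?(ltnW kM') //.
  by rewrite fX ?(ltnW kM') // [m2 11 _]run_frame // i1.
split=> [|i N].
  by apply: ready_frame rd3 => y j hy; rewrite write_other // ltn_eqF // (leq_trans hy).
rewrite !write_other // leq_eqVlt => /orP[/eqP ->|hi] hN.
  by rewrite [m3 11 _]e11 // [m3 12 _]run_frame // [m2 12 _]e12.
have iM : i < M by apply: ltn_trans kM'.
have ni : i <> k.+1 by lia.
rewrite [m3 11 _]f11 // [m2 11 _]run_frame // [m3 12 _]run_frame // [m2 12 _]f12 //.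
exact: inv.
Qed.

Lemma set_weights_spec m : m 0 1 = p -> m 13 0 = 0 ->
  forall a, a <= p -> run O set_weights m 13 a = top_weight a.
Proof.
move=> h1 z; rewrite /set_weights run_seq; set body := CSeq _ _.
set m0 := run O _ m.
have hp : m0 0 1 = p by rewrite /m0 /= write_other.
pose P k (m1 : memory) :=
  m1 14 0 = 2 ^ k.*2 /\ forall a, a <= k -> m1 13 a = top_weight a.
suff [] : P p (run O (CFor 20 0 1 body) m0) by [].
rewrite -hp; apply: (run_for (P := P)) => //.
  split=> [|a]; first by rewrite write_other.
  by rewrite leqn0 => /eqP ->; rewrite write_other // /m0 /= write_other.
move=> k m1 _ ek [i1 i2]; rewrite /body run_seq /= !evalE i1 write_other // ek addn1.
have -> : 4 * 2 ^ k.*2 = 2 ^ k.+1.*2 by rewrite doubleS !expnS mulnA.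
split=> [|a]; first by rewrite write_other // write_other // write_same.
rewrite leq_eqVlt => /orP[/eqP ->|ha].
  by rewrite write_other // write_same.
by rewrite write_other // /write /= ltn_eqF // i2.
Qed.

Hypothesis K_lt : p.+1.*2 < M.

Definition digits m := forall i N, i <= p.+1.*2 -> N < M ->
  m 11 (encode M [:: i; N]) = iter i half N.

Lemma eval_bit m e1 e2 : ready n p e M m -> digits m ->
  eval O m e1 <= p.+1.*2 -> eval O m e2 < M ->
  (eval O m (eBit e1 e2) != 0) = bit (eval O m e1) (eval O m e2).
Proof.
move=> rd dg h1 h2; rewrite /eBit evalE /= (eval_idx_ready nM rd) //= ?dg //.
  by rewrite /bit; case: (odd _).
by rewrite h2 (leq_ltn_trans h1).
Qed.

Lemma eval_strictly m i a k b l :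
  (eval O m (eStrictly i a k b l) != 0) =
  strictly O (eval O m i) (eval O m a) (eval O m k) (eval O m b) (eval O m l).
Proof. by rewrite /eStrictly !evalE !eval_ask. Qed.

Lemma eval_wants m G i a k b l : ready n p e M m -> digits m ->
  eval O m b <= p -> eval O m G < M ->
  (eval O m (eWants G i a k b l) != 0) =
  wants_to_join O (eval O m G) (eval O m i) (eval O m a) (eval O m k)
    (eval O m b) (eval O m l).
Proof.
move=> rd dg hb hG; rewrite /eWants 2!eval_and eval_strictly eval_not.
rewrite eval_bit //= ?addn1 ?addnn //.
by rewrite ltn_double ltnS.
Qed.

Hypothesis O_bound : forall i a k b l, O i a k b l ->
  [/\ i < n, a <= p & 0 < k <= n].

Lemma set_wants_unused_spec m : ready n p e M m -> digits m ->
  (forall j, m 15 j = 0) ->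
  forall G i a k, G < M -> i < n -> a < M -> k < M ->
  (run O set_wants_unused m 15 (encode M [:: G; i; a; k]) != 0) =
  wants_unused O p G i a k.
Proof.
move=> rd dg z G i a k hG hi ha hk; have [h0 h1 _ h3 _] := rd.
have hiM := ltn_trans hi nM.
pose xs := [:: (20, 3, 0); (21, 0, 0); (22, 3, 0); (23, 3, 0); (24, 0, 1)].
pose C vs := if vs is [:: G; i; a; k; c] then
  ~~ bit c.+1.*2 G && strictly O i c.+1 1 a k else false.
have rng vs : in_range m xs vs -> exists G i a k c, vs = [:: G; i; a; k; c] /\
    [/\ G < M, i < n, a < M, k < M & c < p].
  rewrite /in_range; move: vs => [|G' [|i' [|a' [|k' [|c' [|? ?]]]]]] /=;
    rewrite ?h0 ?h1 ?h3 ?andbF // andbT.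
  by case/and5P=> *; exists G', i', a', k', c'.
have mk G' i' a' k' c' : G' < M -> i' < n -> a' < M -> k' < M -> c' < p ->
    in_range m xs [:: G'; i'; a'; k'; c'].
  by rewrite /in_range /= h0 h1 h3 => -> -> -> -> ->.
have spec : run O set_wants_unused m 15 (encode M [:: G; i; a; k]) != 0 <->
    (m 15 (encode M [:: G; i; a; k]) != 0 \/
     exists us, [/\ in_range m xs us, C us & take 4 us = [:: G; i; a; k]]).
  apply: search_array => //.
  - move=> vs /rng[G' [i' [a' [k' [c' [-> [h4 h5 h6 h7 _]]]]]]] _.
    by rewrite /= h4 h6 h7 (ltn_trans h5 nM).
  - move=> m' vs /rng[G' [i' [a' [k' [c' [-> [h4 h5 h6 h7 h8]]]]]]].
    case=> e1 e2 e3 e4 e5 rd' fr _.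
    have dg' : digits m' by move=> *; rewrite fr ?dg.
    rewrite eval_and eval_not eval_strictly eval_bit //=;
      rewrite !evalE ?e1 ?e2 ?e3 ?e4 ?e5 ?addn1 ?addnn //.
    by rewrite leq_double leqW.
  - by rewrite /= hG ha hk hiM.
apply/idP/hasP.
  case/spec => [|[us [/rng[G' [i' [a' [k' [c' [-> [_ _ _ _ hc]]]]]]] /= cs [e1 e2 e3 e4]]]].
    by rewrite z.
  by exists c'; rewrite ?mem_iota // -e1 -e2 -e3 -e4.
case=> c; rewrite mem_iota /= => hc cs; apply/spec; right.
by exists [:: G; i; a; k; c]; rewrite mk.
Qed.

End Arrays.

(** * The program fills the dynamic programming table *)

Section TableFilling.

Variables (O : oracle) (n p e M : nat) (adj : rel nat) (ov ou : nat -> nat).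
Hypothesis M_ge : 4 * 2 ^ p.*2 * n.+1 <= M.
Lemma M_gt : n.+1 < M.
Proof.
have := M_ge; have : 0 < 2 ^ p.*2 by rewrite expn_gt0.
by set P := 2 ^ _; nia.
Qed.

Hypothesis K_lt : p.+1.*2 < M.
Hypothesis elim : elimination_order n adj ov ou.
Hypothesis O_bound : forall i a k b l, O i a k b l ->
  [/\ i < n, a <= p & 0 < k <= n].


Let nM : n < M := ltnW M_gt.

Definition prepared m :=
  [/\ ready n p e M m, digits p M m, forall a, a <= p -> m 13 a = top_weight a,
      forall r, r < n -> m 8 r = ov r /\ m 9 r = ou r
    & forall G i a k, G < M -> i < n -> a < M -> k < M ->
        (m 15 (encode M [:: G; i; a; k]) != 0) = wants_unused O p G i a k].

Lemma prepared_frame (m m' : memory) :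
  (forall y j, y < 16 -> m' y j = m y j) -> prepared m -> prepared m'.
Proof.
move=> fr [h1 h2 h3 h4 h5]; split.
- by apply: ready_frame h1 => y j hy; rewrite fr // (leq_trans hy).
- by move=> i N hi hN; rewrite fr // h2.
- by move=> a ha; rewrite fr // h3.
- by move=> r hr; rewrite !fr //; apply: h4.
- by move=> *; rewrite fr // h5.
Qed.

Lemma frame16 (m m' : memory) xs : all (fun y => 16 < y) xs ->
  (forall y j, y \notin 16 :: xs -> m' y j = m y j) ->
  forall y j, y < 16 -> m' y j = m y j.
Proof.
move=> /allP al fr y j hy; apply: fr; rewrite inE ltn_eqF //=.
by apply/negP => /al; rewrite ltnNge ltnW.
Qed.

Definition entry (m : memory) G r w a k t s q :=
  m 16 (encode M [:: G; r; w; a; k; t; s; q]) != 0.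

Lemma eval_admissible m G i a k : prepared m ->
  eval O m G < M -> eval O m i < n -> eval O m a < M -> eval O m k < M ->
  (eval O m (eAdmissible G i a k) != 0) =
  admissible O p (eval O m G) (eval O m i) (eval O m a) (eval O m k).
Proof.
move=> [rd _ _ _ h] hG hi ha hk; rewrite /eAdmissible eval_and eval_ask eval_not /=.
rewrite (eval_idx_ready nM rd) //=; last by rewrite hG (ltn_trans hi nM) ha hk.
by rewrite h.
Qed.

Lemma player_ranges m vs : ready n p e M m ->
  in_range m [:: (20, 3, 0); (21, 0, 0); (22, 3, 0); (23, 3, 0)] vs <->
  exists G i a k, vs = [:: G; i; a; k] /\ [/\ G < M, i < n, a < M & k < M].
Proof.
case=> h0 _ _ h3 _; split; last first.
  by case=> G [i [a [k [-> [h1 h2 h4 h5]]]]]; rewrite /in_range /= h0 h3 h1 h2 h4 h5.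
rewrite /in_range; move: vs => [|G [|i [|a [|k [|? ?]]]]] /=;
  rewrite ?h0 ?h3 ?andbF // andbT.
by case/and4P=> *; exists G, i, a, k.
Qed.

Lemma init_players_spec m : prepared m ->
  forall G r w a k t s q, below M [:: G; r; w; a; k; t; s; q] ->
  entry (run O init_players m) G r w a k t s q <->
  (entry m G r w a k t s q \/ [/\ r = 0, t = 1, s = 0 & q = 0] /\
     w < n /\ admissible O p G w a k).
Proof.
move=> pm G r w a k t s q hb; have [rd _ _ _ _] := pm.
have M1 : 1 < M by apply: leq_trans M_gt.
apply: (iff_trans (@search_array O n p e M nM _ _ 16 _ m
  (fun vs => if vs is [:: G; i; a; k] then admissible O p G i a k else false)
  (fun vs => if vs is [:: G; i; a; k] then [:: G; 0; i; a; k; 1; 0; 0] else [::])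
  rd _ _ _ _ _ [:: G; r; w; a; k; t; s; q] _ _)) => //.
- move=> vs /(player_ranges _ rd)[G' [i [a' [k' [-> [h1 h2 h3 h4]]]]]] _.
  by rewrite /= h1 h3 h4 (ltn_trans h2 nM) M1 (ltnW M1).
- move=> m' vs /(player_ranges _ rd)[G' [i [a' [k' [-> [h1 h2 h3 h4]]]]]].
  case=> e1 e2 e3 e4 rd' fr _.
  have pm' : prepared m' by apply: prepared_frame pm; apply: frame16 fr.
  by rewrite eval_admissible ?evalE ?e1 ?e2 ?e3 ?e4 //= !evalE e1 e2 e3 e4.
- apply: or_iff_compat_l; split.
    case=> us [/(player_ranges _ rd)[G' [i [a' [k' [-> [h1 h2 h3 h4]]]]]] ad].
    by case=> <- <- <- <- <- <- <- <-.
  case=> [[-> -> -> ->] [hw ad]]; exists [:: G; w; a; k]; split=> //.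
  apply/(player_ranges _ rd); exists G, w, a, k; split=> //.
  by move: hb; rewrite /below /= => /and5P[-> _ _ -> /andP[->]].
Qed.

Lemma init_witnesses_spec m : prepared m ->
  forall G r w a k t s q, below M [:: G; r; w; a; k; t; s; q] ->
  entry (run O init_witnesses m) G r w a k t s q <->
  (entry m G r w a k t s q \/ [/\ r = 0, t = 1, s = 2 ^ a.*2.+1 & q = 1] /\
     w < n /\ admissible O p G w a k && vetoes O w a k).
Proof.
move=> pm G r w a k t s q hb; have [rd _ wt _ _] := pm.
have M1 : 1 < M by apply: leq_trans M_gt.
have sM b : b <= p -> 2 ^ b.*2.+1 < M.
  move=> hb'; apply: leq_trans M_ge; rewrite expnS.
  have : 2 ^ b.*2 <= 2 ^ p.*2 by rewrite leq_pexp2l // leq_double.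
  have : 0 < 2 ^ p.*2 by rewrite expn_gt0.
  by set x := 2 ^ _; set y := 2 ^ _; nia.
have ap G' i a' k' : admissible O p G' i a' k' -> a' <= p.
  by case/andP=> /O_bound[].
apply: (iff_trans (@search_array O n p e M nM _ _ 16 _ m
  (fun vs => if vs is [:: G; i; a; k] then
     admissible O p G i a k && vetoes O i a k else false)
  (fun vs => if vs is [:: G; i; a; k] then
     [:: G; 0; i; a; k; 1; 2 ^ a.*2.+1; 1] else [::])
  rd _ _ _ _ _ [:: G; r; w; a; k; t; s; q] _ _)) => //.
- move=> vs /(player_ranges _ rd)[G' [i [a' [k' [-> [h1 h2 h3 h4]]]]]] /andP[/ap ha _].
  by rewrite /= h1 h3 h4 (ltn_trans h2 nM) M1 (ltnW M1) sM.
- move=> m' vs /(player_ranges _ rd)[G' [i [a' [k' [-> [h1 h2 h3 h4]]]]]].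
  case=> e1 e2 e3 e4 rd' fr _.
  have pm' : prepared m' by apply: prepared_frame pm; apply: frame16 fr.
  rewrite 2!eval_and eval_not eval_ask.
  rewrite eval_admissible ?evalE ?e1 ?e2 ?e3 ?e4 //= !evalE e1 e2 e3 e4 addn1.
  split=> // /andP[/ap ha /andP[a0 _]].
  by rewrite fr // wt // /top_weight (negbTE a0) addnn -mul2n -expnS.
- apply: or_iff_compat_l; split.
    case=> us [/(player_ranges _ rd)[G' [i [a' [k' [-> [h1 h2 h3 h4]]]]]] ad].
    by case=> <- <- <- <- <- <- <- <-.
  case=> [[-> -> -> ->] [hw ad]]; exists [:: G; w; a; k]; split=> //.
  apply/(player_ranges _ rd); exists G, w, a, k; split=> //.
  by move: hb; rewrite /below /= => /and5P[-> _ _ -> /andP[->]].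
Qed.

Lemma init_root_spec m : prepared m ->
  forall G r w a k t s q, below M [:: G; r; w; a; k; t; s; q] ->
  entry (run O init_root m) G r w a k t s q <->
  (entry m G r w a k t s q \/
   [:: r; w; a; k; t; s; q] = [:: 0; n; 0; 1; 1; 0; 0]).
Proof.
move=> pm G r w a k t s q hb; have [rd _ _ _ _] := pm.
have M1 : 1 < M by apply: leq_trans M_gt.
have [h0 _ _ h3 _] := rd.
apply: (iff_trans (@search_array O n p e M nM _ _ 16 _ m (fun=> true)
  (fun vs => [:: head 0 vs; 0; n; 0; 1; 1; 0; 0])
  rd _ _ _ _ _ [:: G; r; w; a; k; t; s; q] _ _)) => //.
- move=> [|G' [|? ?]]; rewrite /in_range /= ?h3 ?andbF // andbT => -> _.
  by rewrite nM M1 (ltnW M1).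
- move=> m' [|G' [|? ?]]; rewrite /in_range /= ?h3 ?andbF // andbT.
  move=> hG [e1] rd' fr _.
  by split=> // _; rewrite evalE e1 fr // h0.
- apply: or_iff_compat_l; split.
    by case=> us [_ _ [_ <- <- <- <- <- <- <-]].
  case=> -> -> -> -> -> -> ->; exists [:: G]; split=> //.
  by rewrite /in_range /= h3 andbT; case/andP: hb.
Qed.

Definition row_filled m r := forall G w a k t s q,
  below M [:: G; w; a; k; t; s; q] ->
  entry m G r w a k t s q <-> realizable O n p G ov ou r w a k t s q.

Lemma table_ranges (m : memory) cs vs : m 3 0 = M ->
  in_range m [seq (c, 3, 0) | c <- cs] vs = (size vs == size cs) && below M vs.
Proof.
move=> h; elim: vs cs => [|v vs IH] [|c cs] //; rewrite /in_range /= h.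
rewrite -[all2 _ _ _]/(in_range _ _ _) IH eqSS andbCA.
by [].
Qed.

Lemma copy_tables_spec m r : prepared m -> m 32 0 = r -> r < n ->
  row_filled m r -> forall G r' w a k t s q,
  below M [:: G; r'; w; a; k; t; s; q] ->
  entry (run O copy_tables m) G r' w a k t s q <->
  (entry m G r' w a k t s q \/
   [/\ r' = r.+1, w != ou r & realizable O n p G ov ou r w a k t s q]).
Proof.
move=> pm er hr row G r' w a k t s q hb; have [rd _ _ oo _] := pm.
have [_ ur] := oo r hr; have [_ _ _ h3 _] := rd.
have rM : r.+1 < M by apply: leq_trans M_gt; rewrite ltnS ltnW.
apply: (iff_trans (@search_array O n p e M nM
  [seq (c, 3, 0) | c <- [:: 20; 21; 22; 23; 24; 25; 26]] _ 16 _ m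
  (fun vs => let v := nth 0 vs in
     entry m (v 0) r (v 1) (v 2) (v 3) (v 4) (v 5) (v 6) && (v 1 != ou r))
  (fun vs => let v := nth 0 vs in
     [:: v 0; r.+1; v 1; v 2; v 3; v 4; v 5; v 6])
  rd _ _ _ _ _ [:: G; r'; w; a; k; t; s; q] _ hb)) => //.
- move=> vs; rewrite table_ranges // => /andP[_ hvs] _; split=> //.
  have nM' i : nth 0 vs i < M.
    case: (ltnP i (size vs)) => hi; first exact: (all_nthP 0 hvs).
    by rewrite nth_default // (leq_ltn_trans _ rM).
  by rewrite /= !nM' rM.
- move=> m' vs; rewrite table_ranges // => /andP[/eqP hs hvs] ev rd' fr fX.
  case: vs hs hvs ev => [|G' [|w' [|a' [|k' [|t' [|s' [|q' [|//]]]]]]]] // _.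
  case/and5P=> b1 b2 b3 b4 /and4P[b5 b6 b7 _] [e1 e2 e3 e4 e5 e6 e7].
  have er' : m' 32 0 = r by rewrite fr.
  rewrite eval_and eval_not eval_eq /= (eval_idx_ready nM rd') //=;
    rewrite !evalE ?e1 ?e2 ?e3 ?e4 ?e5 ?e6 ?e7 ?er' ?addn1.
    by rewrite fX ?fr ?ur //= ?b1 ?b2 ?b3 ?b4 ?b5 ?b6 ?b7 ?(ltnW rM) // => us _ _ [_ /esym/n_Sn].
  by rewrite b1 b2 b3 b4 b5 b6 b7 (ltnW rM).
- apply: or_iff_compat_l; split.
    case=> us [hus /andP[h1 h2] [eG er1 ew ea ek et es eq]].
    split=> //; rewrite -?ew //; move: h1; rewrite eG ew ea ek et es eq => /row; apply.
    by move: hb; rewrite /below /= => /andP[-> /andP[_ ->]].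
  case=> -> nw rl; exists [:: G; w; a; k; t; s; q].
  have hb' : below M [:: G; w; a; k; t; s; q].
    by move: hb; rewrite /below /= => /andP[-> /andP[_ ->]].
  by split=> //; rewrite ?table_ranges //= nw andbT; apply/row.
Qed.

(** Every realizable value is a digit in base [M], so loops up to [M] miss no table entry. *)
Lemma realizable_below G r w a k t s q : r <= n -> w <= n -> alive ov r w ->
  realizable O n p G ov ou r w a k t s q -> below M [:: a; k; t; s; q].
Proof.
move=> hr hw al /(realizable_bounds elim O_bound hr hw al)[h1 h2 h3 h4 h5].
have := M_ge; have := M_gt; have := K_lt; have : 0 < 2 ^ p.*2 by rewrite expn_gt0.
move: h4; set P := 2 ^ _ => h4 P0 hK hn hM.
rewrite /below /=; apply/and5P; split; [lia|lia|lia|nia|].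
by rewrite andbT; nia.
Qed.

Lemma nth_below vs i : 0 < M -> below M vs -> nth 0 vs i < M.
Proof.
move=> M0 h; case: (ltnP i (size vs)) => hi; first exact: (all_nthP 0 h).
by rewrite nth_default.
Qed.

Definition merged_same G r a k t s q := exists t1 s1 q1 t2 s2 q2,
  [/\ a != 0, realizable O n p G ov ou r (ou r) a k t1 s1 q1,
      realizable O n p G ov ou r (ov r) a k t2 s2 q2
    & [/\ t = t1 + t2, s = s1 + s2 & q = q1 + q2]].

Definition merged_other G r a k t s q := exists s1 q1 b l s2 q2,
  [/\ realizable O n p G ov ou r (ou r) a k t s1 q1,
      realizable O n p G ov ou r (ov r) b l l s2 q2,
      [&& ~~ ((b == a) && (a != 0)), ~~ wants_to_join O G (ou r) a k b l
        & ~~ wants_to_join O G (ov r) b l a k]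
    & s = s1 + (s2 + top_weight b) /\ q = q1 + (q2 + (b != 0))].

Lemma realizable_merged G r a k t s q : r < n ->
  realizable O n p G ov ou r.+1 (ou r) a k t s q <->
  merged_same G r a k t s q \/ merged_other G r a k t s q.
Proof.
move=> hr; apply: (iff_trans (realizable_merge O p G elim a k t s q hr)); split.
  case=> t1 [s1 [q1 [b [l [t2 [s2 [q2 [h1 h2]]]]]]]].
  rewrite /mergeable; case: ifP => [/andP[/eqP eb a0] /eqP el|c].
    move=> [-> -> ->]; rewrite eb el in h2; left.
    by exists t1, s1, q1, t2, s2, q2; rewrite !addn0.
  case/and3P=> /eqP et w1 w2 [-> -> ->]; right; rewrite et in h2.
  by exists s1, q1, b, l, s2, q2; rewrite addn0 c w1 w2.
case=> [[t1 [s1 [q1 [t2 [s2 [q2 [a0 h1 h2 [-> -> ->]]]]]]]]|].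
  exists t1, s1, q1, a, k, t2, s2, q2; split=> //; rewrite /mergeable eqxx a0 //=.
  by rewrite !addn0.
case=> s1 [q1 [b [l [s2 [q2 [h1 h2 /and3P[/negbTE c w1 w2] [-> ->]]]]]]].
exists t, s1, q1, b, l, l, s2, q2; split=> //.
  by rewrite /mergeable c eqxx w1 w2.
by rewrite c addn0.
Qed.

Lemma merge_same_spec m r : prepared m -> m 32 0 = r -> r < n ->
  row_filled m r -> forall G r' w a k t s q,
  below M [:: G; r'; w; a; k; t; s; q] ->
  entry (run O merge_same m) G r' w a k t s q <->
  (entry m G r' w a k t s q \/
   [/\ r' = r.+1, w = ou r & merged_same G r a k t s q]).
Proof.
move=> pm er hr row G r' w a k t s q hb; have [rd _ _ oo _] := pm.
have [vr ur] := oo r hr; have [_ _ _ h3 _] := rd.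
have rM : r.+1 < M by apply: leq_trans M_gt; rewrite ltnS ltnW.
have M0 : 0 < M by apply: leq_ltn_trans rM.
have uM : ou r < M := leq_ltn_trans (ou_le elim hr) nM.
have vM : ov r < M := ltn_trans (ov_lt elim hr) nM.
pose C vs := let v := nth 0 vs in
  [&& v 1 != 0, entry m (v 0) r (ou r) (v 1) (v 2) (v 3) (v 4) (v 5)
    & entry m (v 0) r (ov r) (v 1) (v 2) (v 6) (v 7) (v 8)].
have CE vs : below M vs -> C vs -> let v := nth 0 vs in
  [/\ v 1 != 0, realizable O n p (v 0) ov ou r (ou r) (v 1) (v 2) (v 3) (v 4) (v 5)
    & realizable O n p (v 0) ov ou r (ov r) (v 1) (v 2) (v 6) (v 7) (v 8)].
  move=> hvs /and3P[h1 /row h2 /row h4]; split=> //; [apply: h2 | apply: h4];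
    by rewrite /below /= !nth_below ?uM ?vM.
apply: (iff_trans (@search_array O n p e M nM
  [seq (c, 3, 0) | c <- [:: 20; 22; 23; 24; 25; 26; 29; 30; 31]] _ 16 _ m C
  (fun vs => let v := nth 0 vs in
     [:: v 0; r.+1; ou r; v 1; v 2; v 3 + v 6; v 4 + v 7; v 5 + v 8])
  rd _ _ _ _ _ [:: G; r'; w; a; k; t; s; q] _ hb)) => //.
- move=> vs; rewrite table_ranges // => /andP[_ hvs] /(CE _ hvs)[h1 h2 h4].
  split=> //=; rewrite nth_below // rM uM /=.
  (* The sums stay below [M] because they are realizable values of step [r + 1]; adding the bounds
     of the summands would be too weak. *)
  apply: (realizable_below (G := nth 0 vs 0) hr (ou_le elim hr) (alive_ouS elim hr)).
  apply/realizable_merged => //; left.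
  by do 6!eexists; split; [exact: h1 | exact: h2 | exact: h4 |].
- move=> m' vs; rewrite table_ranges // => /andP[/eqP hs hvs] ev rd' fr fX.
  case: vs hs hvs ev => [|G' [|a' [|k' [|t' [|s' [|q' [|t2 [|s2 [|q2 [|//]]]]]]]]]] // _.
  case/and5P=> b1 b2 b3 b4 /and5P[b5 b6 b7 b8 /andP[b9 _]].
  move=> [e1 e2 e3 e4 e5 e6 e7 e8 e9].
  have er' : m' 32 0 = r by rewrite fr.
  rewrite !eval_and /= !(eval_idx_ready nM rd') //=;
    rewrite !evalE ?e1 ?e2 ?e3 ?e4 ?e5 ?e6 ?e7 ?e8 ?e9 ?er' ?addn1
      ?[m' 8 _]fr // ?[m' 9 _]fr // ?ur ?vr.
  + by rewrite !fX //= ?b1 ?b2 ?b3 ?b4 ?b5 ?b6 ?b7 ?b8 ?b9 ?uM ?vM ?(ltnW rM) //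
      => us _ _ [_ /esym/n_Sn].
  + by rewrite b1 b2 b3 b7 b8 b9 vM (ltnW rM).
  + by rewrite b1 b2 b3 b4 b5 b6 uM (ltnW rM).
- apply: or_iff_compat_l; split.
    case=> us [hus cus [eG er1 ew ea ek et es eq]]; split=> //.
    move: hus; rewrite table_ranges // => /andP[_ hus].
    have [h1 h2 h4] := CE _ hus cus; rewrite eG ea ek in h1 h2 h4.
    do 6!eexists; split; [exact: h1 | exact: h2 | exact: h4 | by []].
  case=> -> ew [t1 [s1 [q1 [t2 [s2 [q2 [a0 h1 h2 [et es eq]]]]]]]].
  have hr' := ltnW hr.
  have B1 := realizable_below hr' (ou_le elim hr) (alive_ou elim hr) h1.
  have B2 := realizable_below hr' (ltnW (ov_lt elim hr)) (alive_ov elim hr) h2.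
  have GM : G < M by move: hb; rewrite /below /= => /andP[].
  exists [:: G; a; k; t1; s1; q1; t2; s2; q2]; split.
  + move: B1 B2; rewrite table_ranges // /below /= !andbT.
    by case/and5P=> -> -> -> -> -> /and5P[_ _ -> -> ->]; rewrite GM.
  + by rewrite /C /= a0 /=; apply/andP; split; apply/row;
      rewrite // /below /= GM ?uM ?vM.
  + by rewrite ew et es eq.
Qed.

Lemma merge_other_spec m r : prepared m -> m 32 0 = r -> r < n ->
  row_filled m r -> forall G r' w a k t s q,
  below M [:: G; r'; w; a; k; t; s; q] ->
  entry (run O merge_other m) G r' w a k t s q <->
  (entry m G r' w a k t s q \/
   [/\ r' = r.+1, w = ou r & merged_other G r a k t s q]).
Proof.
move=> pm er hr row G r' w a k t s q hb; have [rd dg wt oo _] := pm.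
have [vr ur] := oo r hr; have [_ _ _ h3 _] := rd.
have rM : r.+1 < M by apply: leq_trans M_gt; rewrite ltnS ltnW.
have M0 : 0 < M by apply: leq_ltn_trans rM.
have uM : ou r < M := leq_ltn_trans (ou_le elim hr) nM.
have vM : ov r < M := ltn_trans (ov_lt elim hr) nM.
pose E1 vs := let v := nth 0 vs in
  entry m (v 0) r (ou r) (v 1) (v 2) (v 3) (v 4) (v 5).
pose E2 vs := let v := nth 0 vs in
  entry m (v 0) r (ov r) (v 6) (v 7) (v 7) (v 8) (v 9).
pose W vs := let v := nth 0 vs in
  [&& ~~ ((v 6 == v 1) && (v 1 != 0)),
      ~~ wants_to_join O (v 0) (ou r) (v 1) (v 2) (v 6) (v 7)
    & ~~ wants_to_join O (v 0) (ov r) (v 6) (v 7) (v 1) (v 2)].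
have E1E vs : below M vs -> E1 vs -> let v := nth 0 vs in
    realizable O n p (v 0) ov ou r (ou r) (v 1) (v 2) (v 3) (v 4) (v 5).
  by move=> hvs /row h; apply: h; rewrite /below /= !nth_below ?uM.
have E2E vs : below M vs -> E2 vs -> let v := nth 0 vs in
    realizable O n p (v 0) ov ou r (ov r) (v 6) (v 7) (v 7) (v 8) (v 9).
  by move=> hvs /row h; apply: h; rewrite /below /= !nth_below ?vM.
have hr' := ltnW hr.
apply: (iff_trans (@search_array O n p e M nM
  [seq (c, 3, 0) | c <- [:: 20; 22; 23; 24; 25; 26; 27; 28; 30; 31]] _ 16 _ m
  (fun vs => [&& E1 vs, E2 vs & W vs])
  (fun vs => let v := nth 0 vs in
     [:: v 0; r.+1; ou r; v 1; v 2; v 3; v 4 + (v 8 + top_weight (v 6));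
         v 5 + (v 9 + (v 6 != 0))])
  rd _ _ _ _ _ [:: G; r'; w; a; k; t; s; q] _ hb)) => //.
- move=> vs; rewrite table_ranges // => /andP[_ hvs] /and3P[h1 h2 h4].
  split=> //=; rewrite nth_below // rM uM /=.
  apply: (realizable_below (G := nth 0 vs 0) hr (ou_le elim hr) (alive_ouS elim hr)).
  apply/realizable_merged => //; right; do 6!eexists; split;
    [exact: E1E hvs h1 | exact: E2E hvs h2 | exact: h4 | by []].
- move=> m' vs; rewrite table_ranges // => /andP[/eqP hs hvs] ev rd' fr fX.
  have e1E := E1E vs hvs; have e2E := E2E vs hvs.
  case: vs hs hvs ev e1E e2E =>
    [|G' [|a' [|k' [|t' [|s' [|q' [|b [|l [|s2 [|q2 [|//]]]]]]]]]]] // _.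
  case/and5P=> b1 b2 b3 b4 /and5P[b5 b6 b7 b8 /and3P[b9 b10 _]].
  move=> [e1 e2 e3 e4 e5 e6 e7 e8 e9 e10] e1E e2E.
  have er' : m' 32 0 = r by rewrite fr.
  have dg' : digits p M m' by move=> *; rewrite fr ?dg.
  have u' : m' 9 r = ou r by rewrite fr.
  have v' : m' 8 r = ov r by rewrite fr.
  have T1 : (eval O m' (Read 16 (eIdx [:: eVar 20; eVar 32; Read 9 (eVar 32);
      eVar 22; eVar 23; eVar 24; eVar 25; eVar 26])) != 0) =
      E1 [:: G'; a'; k'; t'; s'; q'; b; l; s2; q2].
    rewrite /= (eval_idx_ready nM rd') //= !evalE e1 e2 e3 e4 e5 e6 er' u'.
      by rewrite fX //= ?b1 ?b2 ?b3 ?b4 ?b5 ?b6 ?uM ?(ltnW rM) // => us _ _ [_ /esym/n_Sn].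
    by rewrite b1 b2 b3 b4 b5 b6 uM (ltnW rM).
  have T2 : (eval O m' (Read 16 (eIdx [:: eVar 20; eVar 32; Read 8 (eVar 32);
      eVar 27; eVar 28; eVar 28; eVar 30; eVar 31])) != 0) =
      E2 [:: G'; a'; k'; t'; s'; q'; b; l; s2; q2].
    rewrite /= (eval_idx_ready nM rd') //= !evalE e1 e7 e8 e9 e10 er' v'.
      by rewrite fX //= ?b1 ?b7 ?b8 ?b9 ?b10 ?vM ?(ltnW rM) // => us _ _ [_ /esym/n_Sn].
    by rewrite b1 b7 b8 b9 b10 vM (ltnW rM).
  rewrite eval_and T1 eval_and T2.
  (* The bit table is only correct for activity codes up to [p]; realizability of both entries
     supplies this before the wishes are evaluated. *)
  case: (boolP (E1 _)) => [/e1E rl1|] //; case: (boolP (E2 _)) => [/e2E rl2|] //.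
  have [ap _ _ _ _] := realizable_bounds elim O_bound hr' (ou_le elim hr)
    (alive_ou elim hr) rl1.
  have [bp _ _ _ _] := realizable_bounds elim O_bound hr' (ltnW (ov_lt elim hr))
    (alive_ov elim hr) rl2.
  rewrite /= in ap bp.
  rewrite eval_and eval_not eval_and eval_eq eval_and 2!eval_not.
  rewrite !(eval_wants nM K_lt _ _ _ _ rd' dg') ?evalE ?e1 ?e2 ?e7 //=.
  rewrite !eval_not_value !evalE e1 e2 e3 e4 e5 e6 e7 e8 e9 e10 er' u' v' addn1.
  split=> // _; rewrite [m' 13 _]fr // wt //.
  by rewrite eqb0.
- apply: or_iff_compat_l; split.
    case=> us [hus /and3P[h1 h2 h4] [eG er1 ew ea ek et es eq]]; split=> //.
    move: hus; rewrite table_ranges // => /andP[_ hus].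
    move/(E1E _ hus): h1; move/(E2E _ hus): h2; move: h4.
    rewrite /W /= eG ea ek et => h4 h2 h1.
    do 6!eexists; split; [exact: h1 | exact: h2 | exact: h4 | by []].
  case=> -> ew [s1 [q1 [b [l [s2 [q2 [h1 h2 h4 [es eq]]]]]]]].
  have B1 := realizable_below hr' (ou_le elim hr) (alive_ou elim hr) h1.
  have B2 := realizable_below hr' (ltnW (ov_lt elim hr)) (alive_ov elim hr) h2.
  have GM : G < M by move: hb; rewrite /below /= => /andP[].
  exists [:: G; a; k; t; s1; q1; b; l; s2; q2]; split.
  + move: B1 B2; rewrite table_ranges // /below /= !andbT.
    by case/and5P=> -> -> -> -> -> /and5P[-> -> _ -> ->]; rewrite GM.
  + by apply/and3P; split=> //; apply/row; rewrite // /below /= GM ?uM ?vM.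
  + by rewrite ew es eq.
Qed.

Lemma prepared_run c m : all (fun y => 15 < y) (writes c) ->
  prepared m -> prepared (run O c m).
Proof.
move=> /allP al; apply: prepared_frame => y j hy; apply: run_frame.
by apply/negP => /al; rewrite ltnNge -ltnS hy.
Qed.

Definition filled m r := forall G r' w a k t s q,
  below M [:: G; r'; w; a; k; t; s; q] ->
  entry m G r' w a k t s q <->
  r' <= r /\ realizable O n p G ov ou r' w a k t s q.

Lemma filled_row m r : r < M -> filled m r -> row_filled m r.
Proof.
move=> hr f G w a k t s q hb; apply: iff_trans (f _ _ _ _ _ _ _ _ _) _.
  by move: hb; rewrite /below /= hr.
by rewrite leqnn; split=> [[]|].
Qed.

Lemma init_spec m : prepared m -> (forall j, m 16 j = 0) ->
  filled (run O init_root (run O init_witnesses (run O init_players m))) 0.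
Proof.
move=> pm z G r w a k t s q hb.
have pm1 : prepared (run O init_players m) by apply: prepared_run.
have pm2 : prepared (run O init_witnesses (run O init_players m)).
  by apply: prepared_run.
apply: iff_trans (init_root_spec pm2 hb) _; rewrite leqn0.
have z' : ~ entry m G r w a k t s q by rewrite /entry z.
split=> [[/(init_witnesses_spec pm1 hb)[/(init_players_spec pm hb)[//|]|]|]|].
- case=> -[-> -> -> ->] [hw ad]; split=> //.
  by apply/(realizable_player O p G ov ou) => //; split=> //; left.
- case=> -[-> -> -> ->] [hw /andP[ad ve]]; split=> //.
  by apply/(realizable_player O p G ov ou) => //; split=> //; right.
- by case=> -> -> -> -> -> -> ->; split=> //; apply/realizable_root.
case=> /eqP er; rewrite er => rl; rewrite er in hb *.
have [hw|hw|ew] := ltngtP w n.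
- left; apply/(init_witnesses_spec pm1 hb).
  move/(realizable_player O p G ov ou): rl => /(_ hw)[ad et [[es eq]|[ve es eq]]].
    by left; apply/(init_players_spec pm hb); right; rewrite et es eq.
  by right; rewrite et es eq ad ve.
(* Vertices beyond [n] have no entries, since the oracle rejects their queries. *)
- case: rl => lam [+ _ _ _ _]; rewrite /= gtn_eqF //.
  by case/andP=> /andP[/O_bound[]]; rewrite ltnNge ltnW.
- by rewrite ew in rl *; right; case/realizable_root: rl => -> -> -> -> ->.
Qed.

Definition merge_step := sequence copy_tables [:: merge_same; merge_other].

Lemma merge_step_spec m r : prepared m -> m 32 0 = r -> r < n -> filled m r ->
  filled (run O merge_step m) r.+1.
Proof.
move=> pm er hr f; rewrite /merge_step /sequence !run_seq.
set m1 := run O copy_tables m; set m2 := run O merge_same m1.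
have pm1 : prepared m1 by apply: prepared_run.
have pm2 : prepared m2 by apply: prepared_run.
have er1 : m1 32 0 = r by rewrite [m1 32 _]run_frame.
have er2 : m2 32 0 = r by rewrite [m2 32 _]run_frame.
have rM : r < M := ltn_trans hr nM.
have row := filled_row rM f.
(* New entries lie in row [r + 1] only, so row [r] remains a valid source for both merges. *)
have row1 : row_filled m1 r.
  move=> G w a k t s q hb; have hb' : below M [:: G; r; w; a; k; t; s; q].
    by move: hb; rewrite /below /= rM.
  apply: iff_trans (copy_tables_spec pm er hr row hb') _.
  split=> [[/row -/(_ hb)//|[/n_Sn//]]|h]; first by left; apply/row.
have row2 : row_filled m2 r.
  move=> G w a k t s q hb; have hb' : below M [:: G; r; w; a; k; t; s; q].
    by move: hb; rewrite /below /= rM.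
  apply: iff_trans (merge_same_spec pm1 er1 hr row1 hb') _.
  split=> [[/row1 -/(_ hb)//|[/n_Sn//]]|h]; first by left; apply/row1.
move=> G r' w a k t s q hb.
apply: iff_trans (merge_other_spec pm2 er2 hr row2 hb) _.
have S2 := merge_same_spec pm1 er1 hr row1 hb.
have S1 := copy_tables_spec pm er hr row hb.
have S0 := f G r' w a k t s q hb.
have Sm := realizable_merged G a k t s q hr.
have Sf := @realizable_frame O n p G ov ou r w a k t s q.
split.
- case=> [/S2[/S1[/S0[h1 h2]|[-> h1 h2]]|[-> -> h]]|[-> -> h]].
  + by rewrite leqW.
  + by split=> //; apply/Sf.
  + by split=> //; apply/Sm; left.
  + by split=> //; apply/Sm; right.
- case; rewrite leq_eqVlt => /orP[/eqP e1|h1 h2].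
    rewrite e1 in S1 S2 *; case: (eqVneq w (ou r)) => [ew|nw] rl; last first.
      by left; apply/S2; left; apply/S1; right; split=> //; apply/Sf.
    rewrite ew in rl; move/Sm: rl => [h|h]; last by right.
    by left; apply/S2; right.
  by left; apply/S2; left; apply/S1; left; apply/S0.
Qed.

Lemma merge_tables_spec m : prepared m -> filled m 0 ->
  filled (run O (CFor 32 0 0 merge_step) m) n.
Proof.
move=> pm f; have [[h0 _ _ _ _] _ _ _ _] := pm.
suff [] : prepared (run O (CFor 32 0 0 merge_step) m) /\
  filled (run O (CFor 32 0 0 merge_step) m) n by [].
have w16 (m1 : memory) v y j : y < 17 -> write m1 32 0 v y j = m1 y j.
  by move=> hy; rewrite write_other // ltn_eqF // (leq_trans hy).
have wf (m1 : memory) v r : filled m1 r -> filled (write m1 32 0 v) r.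
  by move=> h G r' w a k t s q hb; rewrite /entry w16 //; apply: h.
have wp (m1 : memory) v : prepared m1 -> prepared (write m1 32 0 v).
  by apply: prepared_frame => y j hy; rewrite w16 // ltnW.
rewrite -[X in filled _ X]h0; apply: (run_for (P := fun r m1 => prepared m1 /\ filled m1 r)) => //.
move=> r m1 hr er [pm1 f1]; rewrite h0 in hr.
by split; [apply/wp/prepared_run | apply/wf/merge_step_spec].
Qed.

Lemma bitcount_bound K N : bitcount K N <= K.
Proof.
rewrite -[leqRHS]card_ord -sum1_card; apply: leq_sum => i _.
by case: (bit _ _).
Qed.

Lemma set_answer_spec m : prepared m -> filled m n -> m 17 0 = 0 ->
  (forall N, N < M -> m 12 (encode M [:: p.+1.*2; N]) = bitcount p.+1.*2 N) ->
  run O set_answer m 17 0 != 0 <->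
  exists2 G, G < M & realizable O n p G ov ou n n 0 1 1 G (bitcount p.+1.*2 G).
Proof.
move=> pm f z pc; have [rd _ _ _ _] := pm; have [h0 _ _ h3 [h4 _]] := rd.
have M1 : 1 < M by apply: leq_trans M_gt.
have bM N : bitcount p.+1.*2 N < M by apply: leq_ltn_trans (bitcount_bound _ _) K_lt.
have hb G : G < M -> below M [:: G; n; n; 0; 1; 1; G; bitcount p.+1.*2 G].
  by rewrite /below /= nM M1 (ltnW M1) bM => ->.
rewrite /set_answer; apply: (iff_trans (@run_search_flag O _ _ _ _ m
  (fun vs => entry m (head 0 vs) n n 0 1 1 (head 0 vs) (bitcount p.+1.*2 (head 0 vs)))
  (fun=> 0) _ _ 0)) => //.
- move=> m' [|G [|? ?]]; rewrite /in_range /= ?h3 ?andbF // andbT => hG [e1] fr _.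
  have rd' : ready n p e M m'.
    by apply: ready_frame rd => -[|[|[|[|[|]]]]] // y _; apply: fr.
  have f0 : m' 0 0 = n by rewrite fr.
  have e12 : m' 12 (eval O m' (eIdx [:: Read 3 (Const 1); eVar 20])) =
      bitcount p.+1.*2 G.
    rewrite (eval_idx_ready nM rd') //= !evalE e1 [m' 3 1]fr // h4 ?K_lt ?hG //.
    by rewrite fr // pc.
  rewrite /= (eval_idx_ready nM rd') //= !e12 !evalE e1 f0; first by rewrite fr.
  by rewrite hG nM M1 bM (ltnW M1).
- rewrite z; split=> [[//|[us [hus ent _]]]|[G hG rl]].
    case: us hus ent => [|G [|? ?]]; rewrite /in_range /= ?h3 ?andbF // andbT => hG.
    by move/(f _ _ _ _ _ _ _ _ (hb G hG))=> [_ h]; exists G.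
  right; exists [:: G]; split=> //; first by rewrite /in_range /= h3 hG.
  by apply/(f _ _ _ _ _ _ _ _ (hb G hG)).
Qed.

End TableFilling.

(** * The algorithm on instances *)

Section Instance.

Variable I : gGASP.
Hypothesis forest : acyclic (@adj I).

Notation n := (nplayers I).
Notation p := (nacts I).
Notation e := (size (edges I)).
Notation O := (gGASP_queries I).

Definition table_bound := (n + p + e).+1 * 2 ^ p.+1.*2.

Notation M := table_bound.

Lemma table_bound_ge : 4 * 2 ^ p.*2 * n.+1 <= M.
Proof.
rewrite /table_bound [leqRHS]mulnC doubleS !expnS mulnA leq_mul //.
by rewrite ltnS -addnA leq_addr.
Qed.

Lemma digit_bound_lt : p.+1.*2 < M.
Proof.
have h : p.+1.*2 < 2 ^ p.+1.*2 by apply: ltn_expl.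
by apply: leq_trans h _; rewrite leq_pmull.
Qed.

Lemma player_bound_lt : n < M.
Proof. exact: ltnW (M_gt table_bound_ge). Qed.

Lemma mem_edges (i j : 'I_n) : ((i, j) \in edges I) = (i < j) && @adj I i j.
Proof. by rewrite mem_filter mem_enum andbT. Qed.

Lemma edges_adjacent u v :
  (exists2 i, i < e & nth 0 [seq val x.1 | x <- edges I] i = u /\
                      nth 0 [seq val x.2 | x <- edges I] i = v) \/
  (exists2 i, i < e & nth 0 [seq val x.2 | x <- edges I] i = u /\
                      nth 0 [seq val x.1 | x <- edges I] i = v) <->
  nat_adj I u v.
Proof.
split.
- case=> -[i hi]; case E: (edges I) hi => [//|x0 s]; rewrite -E => hi;
    rewrite !(nth_map x0) // => -[<- <-]; have := mem_nth x0 hi;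
    case: (nth x0 (edges I) i) => x y; rewrite mem_edges /= => /andP[_ xy].
    by rewrite nat_adjE.
  by rewrite nat_adj_sym nat_adjE.
- case/existsP=> x /existsP[y /and3P[/eqP <- /eqP <- xy]].
  have hit (a b : 'I_n) : (a, b) \in edges I -> exists2 i, i < e &
      nth 0 [seq val x.1 | x <- edges I] i = a /\
      nth 0 [seq val x.2 | x <- edges I] i = b.
    move=> h; exists (index (a, b) (edges I)); first by rewrite index_mem.
    by rewrite !(nth_map (a, b)) ?index_mem // nth_index.
  case: (ltngtP x y) => [lt|lt|/val_inj exy].
  + by left; apply: hit; rewrite mem_edges lt.
  + right; have [|i hi [h1 h2]] := hit y x; first by rewrite mem_edges lt adj_sym.
    by exists i.
  + by rewrite exy adj_irr in xy.
Qed.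

Lemma forest_leaf (ov : nat -> nat) r : r < n ->
  exists v, [/\ v < n, alive ov r v & forall x y, x < n -> y < n ->
    alive ov r x -> alive ov r y -> nat_adj I v x -> nat_adj I v y -> x = y].
Proof.
move=> hr; pose W := [set v : 'I_n | alive ov r v].
have W0 : W != set0.
  apply/negP => /eqP h.
  (* Pigeonhole: fewer than [n] steps cannot eliminate all [n] players. *)
  have : {subset iota 0 n <= map ov (iota 0 r)}.
    move=> v; rewrite mem_iota /= => hv.
    have /negbT/allPn[r' hr' /negPn/eqP <-] : alive ov r v = false.
      by move/setP/(_ (Ordinal hv)): h; rewrite !inE.
    exact: map_f.
  move/(uniq_leq_size (iota_uniq 0 n)).
  by rewrite size_map !size_iota leqNgt hr.
have [v vW h] := acyclic_leaf (@adj_sym I) (@adj_irr I) forest W0.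
exists v; split; [exact: ltn_ord | by move: vW; rewrite inE |].
move=> x y hx hy ax ay vx vy.
have := h (Ordinal hx) (Ordinal hy).
rewrite !inE -!nat_adjE => /(_ ax ay vx vy) e1.
by have := congr1 val e1.
Qed.

Notation m0 := (load (gGASP_encoding I)).

Lemma load_far y j : 2 < y -> m0 y j = 0.
Proof. by case: y => [|[|[|y]]] // _; rewrite /load /= nth_nil nth_nil. Qed.

Definition bounded_memory := run O set_bounds m0.

Lemma bounded_memory_spec :
  [/\ bounded_memory 3 0 = M, bounded_memory 3 1 = p.+1.*2
    & forall j, 1 < j -> bounded_memory 3 j = 0].
Proof.
have [||| h1 h2 h3] := @set_bounds_spec O n p e m0 => //.
by split=> // j hj; rewrite [LHS]h3 // load_far.
Qed.

Lemma solve_spec : run O solve bounded_memory 17 0 != 0 <->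
  exists pi : assignment I, individually_stable pi.
Proof.
have nM := player_bound_lt; have MG := table_bound_ge; have KM := digit_bound_lt.
have [b0 b1 b2] := bounded_memory_spec.
rewrite /solve /sequence !run_seq -/merge_step.
set mb := bounded_memory in b0 b1 b2 *.
set m1 := run O set_multiples mb; set m2 := run O (set_edges 1 2) m1.
set m3 := run O (set_edges 2 1) m2; set m4 := run O set_order m3.
set m5 := run O set_bits m4; set m6 := run O set_weights m5.
set m7 := run O set_wants_unused m6.
set m8 := run O init_root _; set m9 := run O (CFor 32 0 0 merge_step) m8.
have rd1 : ready n p e M m1.
  have f1 y j : y \notin writes set_multiples -> m1 y j = mb y j.
    exact: run_frame.
  have fb y j : y \notin writes set_bounds -> mb y j = m0 y j by exact: run_frame.
  split; rewrite ?f1 //; do ?[by rewrite fb]; split=> //.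
  by apply: set_multiples_spec; rewrite // fb ?load_far.
have rd2 : ready n p e M m2 by apply: ready_run.
have rd3 : ready n p e M m3 by apply: ready_run.
have rd4 : ready n p e M m4 by apply: ready_run.
have rd5 : ready n p e M m5 by apply: ready_run.
have rd6 : ready n p e M m6 by apply: ready_run.
have rd7 : ready n p e M m7 by apply: ready_run.
have M0 : 0 < M by apply: leq_ltn_trans nM.
have in1 i : m1 1 i = nth 0 [seq val x.1 | x <- edges I] i.
  by rewrite /m1 /mb /bounded_memory !run_frame.
have in2 i : m1 2 i = nth 0 [seq val x.2 | x <- edges I] i.
  by rewrite /m1 /mb /bounded_memory !run_frame.
have lt1 i : m1 1 i < M.
  rewrite in1; case: (ltnP i e) => hi; last by rewrite nth_default ?size_map.
  case: (edges I) hi => // x0 s hi; rewrite (nth_map x0) //.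
  exact: ltn_trans (ltn_ord _) nM.
have lt2 i : m1 2 i < M.
  rewrite in2; case: (ltnP i e) => hi; last by rewrite nth_default ?size_map.
  case: (edges I) hi => // x0 s hi; rewrite (nth_map x0) //.
  exact: ltn_trans (ltn_ord _) nM.
have adj3 : adjacency n M (nat_adj I) m3.
  move=> u v hu hv; have uM := ltn_trans hu nM; have vM := ltn_trans hv nM.
  have inj a b : a < M -> b < M ->
      encode M [:: a; b] = encode M [:: u; v] <-> a = u /\ b = v.
    move=> ha hb; split=> [h|[-> ->] //].
    have [//] : [:: a; b] = [:: u; v] by apply: encode_inj h; rewrite //= ?ha ?hb ?uM ?vM.
  have E1 := @set_edges_spec O n p e M m1 1 2 isT isT M0 rd1
    (fun i _ => conj (lt1 i) (lt2 i)) (encode M [:: u; v]).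
  have E2 : m3 6 (encode M [:: u; v]) != 0 <-> (m2 6 (encode M [:: u; v]) != 0 \/
      exists2 i, i < e & encode M [:: m1 2 i; m1 1 i] = encode M [:: u; v]).
    have f y j : y \notin writes (set_edges 1 2) -> m2 y j = m1 y j.
      exact: run_frame.
    apply: iff_trans (@set_edges_spec O n p e M m2 2 1 isT isT M0 rd2 _ _) _.
      by move=> i _; rewrite !f.
    by apply: or_iff_compat_l; split=> -[i hi h]; exists i => //; move: h; rewrite !f.
  apply/idP/idP.
    case/E2 => [/E1[|[i hi]]|[i hi]].
    - by rewrite /m1 /mb /bounded_memory !run_frame // load_far.
    - by rewrite inj // in1 in2 => h; apply/edges_adjacent; left; exists i.
    - by rewrite inj // in1 in2 => h; apply/edges_adjacent; right; exists i.
  case/edges_adjacent=> -[i hi h]; apply/E2; [left; apply/E1; right | right];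
    by exists i => //; apply/inj; rewrite // in1 in2.
have z7 j : m3 7 j = 0.
  by rewrite /m3 /m2 /m1 /mb /bounded_memory !run_frame // load_far.
have z10 j : m3 10 j = 0.
  by rewrite /m3 /m2 /m1 /mb /bounded_memory !run_frame // load_far.
have irr x : x < n -> ~~ nat_adj I x x.
  by move=> hx; have := @nat_adjE I (Ordinal hx) (Ordinal hx); rewrite adj_irr /= => ->.
have ord := set_order_spec O nM irr forest_leaf rd3 adj3 z7 z10.
rewrite -/m4 in ord; cbv zeta in ord.
have z12 j : m4 12 j = 0.
  by rewrite /m4 /m3 /m2 /m1 /mb /bounded_memory !run_frame // load_far.
have bits := set_bits_spec O nM rd4 KM z12; rewrite -/m5 in bits; cbv zeta in bits.
have dg6 : digits p M m6.
  by move=> i N hi hN; rewrite [m6 11 _]run_frame //; have [] := bits i N hi hN.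
have z15 j : m6 15 j = 0.
  by rewrite /m6 /m5 /m4 /m3 /m2 /m1 /mb /bounded_memory !run_frame // load_far.
have pm7 : prepared O n p e M (m4 8) (m4 9) m7.
  split=> //.
  - by move=> i N hi hN; rewrite [m7 11 _]run_frame //; apply: dg6.
  - move=> a ha; rewrite [m7 13 _]run_frame //; apply: set_weights_spec ha.
      by case: rd5.
    by rewrite /m5 /m4 /m3 /m2 /m1 /mb /bounded_memory !run_frame // load_far.
  - by move=> r _; rewrite /m7 /m6 /m5 !run_frame.
  - move=> G i a k h1 h2 h3 h4.
    exact: (set_wants_unused_spec O nM KM rd6 dg6 z15 h1 h2 h3 h4).
have z16 j : m7 16 j = 0.
  by rewrite /m7 /m6 /m5 /m4 /m3 /m2 /m1 /mb /bounded_memory !run_frame // load_far.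
have pm8 : prepared O n p e M (m4 8) (m4 9) m8 by do 3!apply: prepared_run => //.
have pm9 : prepared O n p e M (m4 8) (m4 9) m9 by apply: prepared_run.
have f8 := init_spec MG KM (@queries_bound I) pm7 z16; rewrite -/m8 in f8.
have f9 := merge_tables_spec MG KM ord (@queries_bound I) pm8 f8; rewrite -/m9 in f9.
have z17 : m9 17 0 = 0.
  by rewrite /m9 /m8 /m7 /m6 /m5 /m4 /m3 /m2 /m1 /mb /bounded_memory !run_frame.
have pc N : N < M -> m9 12 (encode M [:: p.+1.*2; N]) = bitcount p.+1.*2 N.
  move=> hN; rewrite /m9 /m8 /m7 /m6 !run_frame //.
  by have [] := bits p.+1.*2 N (leqnn _) hN.
apply: iff_trans (set_answer_spec MG KM pm9 f9 z17 pc) _; split.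
  (* The loop over [G] runs up to [M], beyond [4 ^ (p + 1)]; an accepting entry for any such [G]
     decodes to a stable assignment. *)
  case=> G _ /(accepting G ord (@queries_bound I)).1 [lam sol].
  by exists (decoded I lam); exact: (sound_stable ord sol).
move/(solution_iff_stable ord) => [G hG sol]; exists G.
  by apply: leq_trans hG _; rewrite /table_bound leq_pmull.
exact: (accepting G ord (@queries_bound I)).2.
Qed.

End Instance.

(** * The parameter-dependent factor and the total running time *)

Lemma computable_pow2 d : computable (fun k => 2 ^ (k.+1 * d).*2).
Proof.
(* [d] is a constant, so multiplication by [4 ^ d] is straight-line code; it is run once and then
   [k] more times. *)
pose quads := iter d (fun c => CSeq c (CWrite 1 (Const 0) (eQuad (eVar 1))))
  (CWrite 1 (Const 0) (eVar 1)).
have run_quads O m : run O quads m 1 0 = 2 ^ d.*2 * m 1 0.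
  rewrite /quads; elim: (d) => [|d' IH]; first by rewrite mul1n.
  by rewrite iterS run_seq /= write_same eval_quad eval_var IH doubleS !expnS !mulnA.
have quads_writes x : x != 1 -> x \notin writes quads.
  rewrite /quads => hx; elim: (d) => [|d' IH] /=; first by rewrite inE.
  by rewrite mem_cat negb_or IH inE.
pose c := CSeq (CWrite 1 (Const 0) (Const 1)) (CSeq quads (CFor 2 0 0 quads)).
have ok : bounded_by [:: 0] c.
  have h : bounded_by [:: 0] quads.
    by rewrite /quads; elim: (d) => [//|d' IH]; rewrite iterS /= IH.
  by rewrite /c /= h quads_writes.
exists (Seq (compile c) (Write 0 (Const 0) (Read 1 (Const 0)))) => k.
pose m := load [:: [:: k]].
have [|t et _] := @run_exec no_oracle _ _ m k ok.
  by move=> b i; rewrite inE => /eqP ->; case: i => [|i] //; rewrite /m /load /= nth_nil.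
exists (t + 4), (write (run no_oracle c m) 0 0 (run no_oracle c m 1 0)).
split; first by apply: ExecSeq et _; apply: (ExecWrite _ _ (Const 0) (Read 1 (Const 0))).
rewrite /output write_same /c !run_seq; set m1 := run _ _ m; set m2 := run _ _ m1.
have e1 : m1 1 0 = 1 by rewrite /m1 /= write_same.
have e2 : m2 0 0 = k by rewrite [m2 0 _]run_frame ?quads_writes.
rewrite -[X in _ = 2 ^ (X.+1 * d).*2]e2.
apply: (run_for (P := fun j m' => m' 1 0 = 2 ^ (j.+1 * d).*2)); rewrite ?quads_writes //.
  by rewrite write_other // [m2 1 _]run_quads e1 muln1 mul1n.
move=> j m' _ _ h; rewrite write_other // run_quads h -expnD.
by rewrite -doubleD -mulSn.
Qed.

Lemma horner_bound C1 d1 C2 d2 z :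
  ((C1%:P * ('X + 2%:P) ^+ d1 + C2%:P * ('X + 2%:P) ^+ d2 + 4%:P).[z])%R =
  C1 * (z + 2) ^ d1 + C2 * (z + 2) ^ d2 + 4.
Proof. by rewrite !(hornerD, hornerM, hornerC, horner_exp, hornerX). Qed.

Theorem theorem18 : FPT acyclic_gGASP_IS.
Proof.
have [C1 [d1 h1]] := cost_poly set_bounds.
have [C2 [d2 h2]] := cost_poly solve.
exists (Seq (compile set_bounds) (Seq (compile solve) (compile print_answer))).
exists (fun k => 2 ^ (k.+1 * d2).*2).
(* The summands pay for [set_bounds], for the polynomial part of [solve], and with 4 steps for
   [print_answer]. *)
exists ((C1%:P * ('X + 2%:P) ^+ d1 + C2%:P * ('X + 2%:P) ^+ d2 + 4%:P)%R).
split; first exact: computable_pow2.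
move=> I forest /=; set z := gGASP_size I.
pose m0 := load (gGASP_encoding I).
have [|t1 E1 l1] := @run_exec (gGASP_queries I) _ _ m0 z set_bounds_ok.
  move=> b i; rewrite inE => /eqP ->; rewrite /m0 /z /gGASP_size /load /=.
  by case: i => [|[|[|i]]] /=; rewrite ?nth_nil //; lia.
have [b0 b1 b2] := bounded_memory_spec I.
pose M := table_bound I.
have zM : z.+1 * 2 ^ (nacts I).+1.*2 = M.
  by [].
have zM' : z < M by rewrite -zM leq_pmulr // expn_gt0.
have [|t2 E2 l2] := @run_exec (gGASP_queries I) _ _ (bounded_memory I) M solve_ok.
  move=> b i; rewrite !inE => /orP[|] /eqP ->.
    rewrite /bounded_memory run_frame // /load /=; apply: leq_trans (ltnW zM').
    by rewrite /z /gGASP_size; case: i => [|[|[|i]]] /=; rewrite ?nth_nil //; lia.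
  case: i => [|[|i]]; rewrite ?b0 ?b1 ?b2 //.
  exact: ltnW (digit_bound_lt I).
set m2 := run _ solve _ in E2.
have E3 : exec (gGASP_queries I) (compile print_answer) m2 4 (write m2 0 0 (m2 17 0)).
  exact: (ExecWrite _ _ (Const 0) (Read 17 (Const 0))).
exists (t1 + (t2 + 4)), (write m2 0 0 (m2 17 0)); split.
- exact: ExecSeq E1 (ExecSeq E2 E3).
- have mono d a b : a <= b -> a ^ d <= b ^ d.
    by case: d => // d h; rewrite leq_exp2r.
  set F := 2 ^ _; have F0 : 0 < F by rewrite expn_gt0.
  have c1 : C1 * z.+1 ^ d1 <= C1 * (z + 2) ^ d1.
    by rewrite leq_mul // mono // addn2.
  (* From [M + 1 <= 4 ^ (p + 1) * (z + 2)], raising to the power [d2] separates the parameter from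
     the input size. *)
  have c2 : C2 * M.+1 ^ d2 <= F * (C2 * (z + 2) ^ d2).
    rewrite mulnCA leq_mul // /F doubleMl expnM -expnMn mono //.
    have : 0 < 2 ^ (nacts I).+1.*2 by rewrite expn_gt0.
    by rewrite -zM; set P := 2 ^ _; nia.
  have := leq_trans l1 (leq_trans (h1 z) c1).
  have := leq_trans l2 (leq_trans (h2 M) c2).
  rewrite horner_bound; set A := C1 * _; set B := C2 * _ => a2 a1.
  have : A + F * B + 4 <= F * (A + B + 4) by rewrite !mulnDr; nia.
  by move: a1 a2; set FB := F * B; lia.
- by rewrite /output write_same; apply: solve_spec.
Qed.
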